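(* Let $\rho(r)$ be an arbitrary proximate order, $\rho=\rho(\infty)$, let $\mu$ be a Radon measure on $(0,\infty)$ of class $\mathfrak M(\rho(r))$, and let $K$ be a Borel function on $(0,\infty)$ such that $t^{\rho-1}\gamma(t)K(t)\in L_1(0,\infty)$. Let the set $$\Lambda=\left\{\lambda\in(-\infty,\infty):\ \int_0^\infty K(t)t^{\rho-1-i\lambda}dt=0\right\}$$ be finite, with $0\in\Lambda$, and let $$\Psi(r)=\int_0^\infty K\left(\frac tr\right)d\mu(t).$$ Then, if the measure $s$, $ds(t)=\Psi(t)\,dt$, is a regular measure with respect to the proximate order $\rho(r)+1$, then $Fr[\rho(r)+1,s]=\{0\}$, the limit set $Fr[\mu]$ consists of absolutely continuous measures $\nu$, and the density $h(t)$ of each such measure has the form $$h(t)=\left(\sum_{\lambda\in\Lambda}c_\lambda t^{-i\lambda}\right)t^{\rho-1},$$ where $c_\lambda$ are some complex numbers.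
   Context: Proximate orders: a zero proximate order is a real function $\hat\rho(r)$ on $(0,\infty)$ (possibly undefined at $r=1$) such that $\lim_{r\to\infty}\hat\rho(r)=0$; $\hat\rho(1/r)=-\hat\rho(r)$; $\hat\rho$ is continuously differentiable on $(0,\infty)\setminus\{1\}$; $\lim_{r\to\infty}r\ln r\,\hat\rho'(r)=0$; and $r^{\hat\rho(r)}$ extends continuously to $r=1$ with value $1$. A proximate order is $\rho(r)=\rho+\hat\rho(r)$ with $\rho\in\mathbb R$ and $\hat\rho$ a zero proximate order; $\rho=\rho(\infty)=\lim_{r\to\infty}\rho(r)$. Put $V(r)=r^{\rho(r)}$ and $\gamma(t)=\sup_{r>0}\frac{V(rt)}{t^\rho V(r)}$. Radon measures: a real Radon measure on $(0,\infty)$ is $\mu=\mu_1-\mu_2$ with $\mu_1,\mu_2$ mutually singular positive Borel measures, finite on compact subsets of $(0,\infty)$; a complex Radon measure is $\mu_1+i\mu_2$ with $\mu_1,\mu_2$ real Radon measures; $|\mu|$ is the total variation. Wide convergence $\mu_n\to\mu$ means $\int\varphi\,d\mu_n\to\int\varphi\,d\mu$ for every continuous $\varphi$ with compact support in $(0,\infty)$. $\mathfrak M(\rho(r))$ is the set of Radon measures on $(0,\infty)$ with $\sup_{r>0}|\mu|([r,er])/V(r)<\infty$. With $\mu_t(E)=\mu(tE)/V(t)$, the Azarin limit set $Fr[\mu]=Fr[\rho(r),\mu]$ is the set of all wide limits $\nu=\lim_{n\to\infty}\mu_{t_n}$ with $t_n\to+\infty$. $Fr[\rho(r)+1,s]$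 is defined in the same way with $V(r)$ replaced by $rV(r)$. A measure is regular with respect to a proximate order if its limit set with respect to that proximate order consists of a single measure (the measure being assumed to satisfy $\sup_{r\ge1}|\mu|([r,er])/V(r)<\infty$ for the corresponding $V$). The function $\Psi$ is understood up to equality almost everywhere. *)

(* Defs.v *)
From HB Require Import structures.
From mathcomp Require Import all_boot all_order all_algebra.
From mathcomp Require Import complex.
From mathcomp Require Import all_classical all_reals all_analysis measurable_realfun.
Set Implicit Arguments.
Unset Strict Implicit.
Unset Printing Implicit Defensive.
Import Order.TTheory GRing.Theory Num.Theory.
Import numFieldNormedType.Exports.
Local Open Scope classical_set_scope.
Local Open Scope ring_scope.
Local Open Scope complex_scope.

Section proximate_orders.
Context {R : realType}.
Implicit Types (rho : R -> R) (r t : R).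

(* The value of a zero proximate order at 1 is irrelevant: every condition
   avoids r = 1, and V(1) = 1 whatever that value is. *)
Definition zero_proximate_order rho :=
  [/\ rho r @[r --> +oo] --> (0 : R),
      forall r, 0 < r -> r != 1 -> rho r^-1 = - rho r,
      forall r, 0 < r -> r != 1 ->
        derivable rho r 1 /\ {for r, continuous (derive1 rho)},
      r * ln r * derive1 rho r @[r --> +oo] --> (0 : R)
    & r `^ rho r @[r --> (1 : R)^'] --> (1 : R)].

Definition proximate_order rho :=
  exists rho0 : R, zero_proximate_order (fun r => rho r - rho0).

Definition order_at_infty rho : R := lim (rho r @[r --> +oo]).

Definition prox_weight rho r : R := r `^ rho r.

Definition prox_gamma rho t : \bar R :=
  ereal_sup [set (prox_weight rho (r * t) /
                  (t `^ order_at_infty rho * prox_weight rho r))%:E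
            | r in `]0, +oo[ ].

End proximate_orders.

Section complex_functions.
Context {R : realType}.

Definition cpow (t : R) (z : R[i]) : R[i] :=
  (t `^ complex.Re z)%:C *
  (cos (complex.Im z * ln t) +i* sin (complex.Im z * ln t)).

Definition cmeasurable (D : set (measurableTypeR R)) (f : R -> R[i]) :=
  measurable_fun D (fun t => complex.Re (f t)) /\
  measurable_fun D (fun t => complex.Im (f t)).

Definition cintegrable (D : set (measurableTypeR R)) (f : R -> R[i]) :=
  lebesgue_measure.-integrable D (fun t => (complex.Re (f t))%:E) /\
  lebesgue_measure.-integrable D (fun t => (complex.Im (f t))%:E).

Definition cintegral (D : set (measurableTypeR R)) (f : R -> R[i]) : R[i] :=
  (\int[lebesgue_measure]_(t in D) complex.Re (f t)) +i*
  (\int[lebesgue_measure]_(t in D) complex.Im (f t)).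

Definition ccvg (u : nat -> R[i]) (l : R[i]) :=
  (fun n => complex.Re (u n)) @ \oo --> complex.Re l /\
  (fun n => complex.Im (u n)) @ \oo --> complex.Im l.

Definition test_function (phi : R -> R[i]) :=
  [/\ continuous (fun t => complex.Re (phi t)),
      continuous (fun t => complex.Im (phi t)),
      compact (closure [set t | phi t != 0])
    & closure [set t | phi t != 0] `<=` `]0, +oo[ ].

End complex_functions.

(* A measure on (0, +oo) is a Borel measure on the line that is null on
   (-oo, 0]. *)
Record positive_radon (R : realType) := PositiveRadon {
  pradon :> {measure set (measurableTypeR R) -> \bar R};
  pradon_support : pradon `]-oo, (0 : R)]%classic = 0%E;
  pradon_compact : forall K : set R,
    compact K -> K `<=` `]0, +oo[ -> (pradon K < +oo)%E }.

Definition mutually_singular (R : realType)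
    (m1 m2 : {measure set (measurableTypeR R) -> \bar R}) :=
  exists A, [/\ measurable A, m1 A = 0%E & m2 (~` A) = 0%E].

Record real_radon (R : realType) := RealRadon {
  rpos : positive_radon R;
  rneg : positive_radon R;
  rsing : mutually_singular rpos rneg }.

Record complex_radon (R : realType) := ComplexRadon {
  cre : real_radon R;
  cim : real_radon R }.

Section radon_theory.
Context {R : realType}.
Implicit Types (mu nu s : complex_radon R) (A : set (measurableTypeR R)).

Definition rvalue (m : real_radon R) A : R := fine (rpos m A) - fine (rneg m A).

(* Meaningful for relatively compact Borel subsets of (0, +oo). *)
Definition cvalue mu A : R[i] := rvalue (cre mu) A +i* rvalue (cim mu) A.

Definition relcompact_borel A :=
  measurable A /\ exists a b : R, 0 < a /\ A `<=` `[a, b].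

(* Equality of measures: a {measure set T -> \bar R} also takes (unconstrained)
   values on nonmeasurable sets, so that Leibniz equality is too fine. *)
Definition radon_eq mu nu :=
  forall A, relcompact_borel A -> cvalue mu A = cvalue nu A.

Definition rintegral (m : real_radon R) (f : R -> R) : R :=
  \int[rpos m]_(t in `]0, +oo[) f t - \int[rneg m]_(t in `]0, +oo[) f t.

Definition radon_integral mu (f : R -> R[i]) : R[i] :=
  (rintegral (cre mu) (fun t => complex.Re (f t)) -
   rintegral (cim mu) (fun t => complex.Im (f t))) +i*
  (rintegral (cre mu) (fun t => complex.Im (f t)) +
   rintegral (cim mu) (fun t => complex.Re (f t))).

Definition radon_variation mu A : \bar R :=
  ereal_sup [set v | exists n (B : 'I_n -> set (measurableTypeR R)),
    [/\ forall i, measurable (B i), trivIset setT B,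
        \bigcup_i B i = A
      & v = (\sum_(i < n) ComplexField.Normc.normc (cvalue mu (B i)))%:E]].

Definition wide_cvg (mu_ : nat -> complex_radon R) nu :=
  forall phi : R -> R[i], test_function phi ->
    ccvg (fun n => radon_integral (mu_ n) phi) (radon_integral nu phi).

Definition radon_abs_continuous mu :=
  [/\ rpos (cre mu) `<< @lebesgue_measure R,
      rneg (cre mu) `<< @lebesgue_measure R,
      rpos (cim mu) `<< @lebesgue_measure R
    & rneg (cim mu) `<< @lebesgue_measure R].

Definition has_density mu (f : R -> R[i]) :=
  [/\ cmeasurable `]0, +oo[ f,
      forall a b : R, 0 < a -> cintegrable `[a, b] f
    & forall A, relcompact_borel A -> cvalue mu A = cintegral A f].

End radon_theory.

Section zero_radon.
Context {R : realType}.

Let mzero_support : @mzero _ (measurableTypeR R) R `]-oo, (0 : R)]%classic = 0%E.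
Proof. by []. Qed.

Let mzero_compact (K : set R) : compact K -> K `<=` `]0, +oo[ ->
  (@mzero _ (measurableTypeR R) R K < +oo)%E.
Proof. by move=> _ _; rewrite /mzero ltry. Qed.

Definition zero_positive_radon : positive_radon R :=
  PositiveRadon mzero_support mzero_compact.

Let mzero_sing : mutually_singular zero_positive_radon zero_positive_radon.
Proof. by exists set0; split. Qed.

Definition zero_radon : complex_radon R :=
  ComplexRadon (RealRadon mzero_sing) (RealRadon mzero_sing).

End zero_radon.

Section dilation.
Context {R : realType}.
Variables (c : {nonneg R}) (t : {posnum R}).

Definition divt (x : measurableTypeR R) : measurableTypeR R := x / t%:num.

Lemma measurable_divt : measurable_fun setT divt.
Proof. exact: mulrr_measurable. Qed.

Lemma preimage_divt (A : set R) : divt @^-1` A = [set x * t%:num | x in A].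
Proof.
apply/seteqP; split => [x Ax|_ [x Ax <-]]; rewrite /preimage/divt /=.
  by exists (x / t%:num) => //; rewrite divfK.
by rewrite mulfK.
Qed.

Section dilated_measure.
Variable m : {measure set (measurableTypeR R) -> \bar R}.

(* E |-> c * m (t E), since t E is the preimage of E under x |-> x / t *)
Definition dilated_measure (A : set (measurableTypeR R)) : \bar R :=
  (c%:num%:E * pushforward m divt A)%E.

Let dilated0 : dilated_measure set0 = 0%E.
Proof. by rewrite /dilated_measure /pushforward preimage_set0 measure0 mule0. Qed.

Let dilated_ge0 A : (0 <= dilated_measure A)%E.
Proof. by apply: mule_ge0; [rewrite lee_fin|exact: (measure_ge0 m)]. Qed.

Let pushforward_additive : semi_sigma_additive (pushforward m divt).
Proof.
have := measurable_divt => mf.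
exact: measure_semi_sigma_additive.
Qed.

Let dilated_additive : semi_sigma_additive dilated_measure.
Proof.
move=> F mF tF mUF; rewrite /dilated_measure.
rewrite [X in X @ \oo --> _](_ : _ = (fun n =>
    c%:num%:E * \sum_(0 <= i < n) pushforward m divt (F i))%E); last first.
  apply/funext => n; rewrite ge0_sume_distrr// => i _.
  exact: (measure_ge0 m).
apply: cvgeZl; first by [].
exact: pushforward_additive.
Qed.

HB.instance Definition _ := isMeasure.Build _ _ _ dilated_measure
  dilated0 dilated_ge0 dilated_additive.

End dilated_measure.

Section dilated_radon.
Variable m : positive_radon R.

Let dilated_support : dilated_measure m `]-oo, (0 : R)]%classic = 0%E.
Proof.
rewrite /dilated_measure /pushforward.
suff -> : divt @^-1` `]-oo, (0 : R)]%classic = `]-oo, (0 : R)]%classic by rewrite pradon_support mule0.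
apply/seteqP; split => x; rewrite /preimage /divt /= !in_itv /=.
  by rewrite pmulr_lle0// invr_gt0.
by move=> x0; rewrite pmulr_lle0// invr_gt0.
Qed.

Let dilated_compact (K : set R) : compact K -> K `<=` `]0, +oo[ ->
  (dilated_measure m K < +oo)%E.
Proof.
move=> cK K0; rewrite /dilated_measure /pushforward preimage_divt.
apply: lte_mul_pinfty; [by rewrite lee_fin|by []|].
apply: pradon_compact.
  apply: continuous_compact cK.
  by apply: continuous_subspaceT => x; exact: mulrr_continuous.
move=> _ [x /K0 + <-]; rewrite /= !in_itv /= !andbT => x0.
exact: mulr_gt0.
Qed.

Definition dilated_positive : positive_radon R :=
  PositiveRadon dilated_support dilated_compact.

End dilated_radon.

Let dilated_sing (m : real_radon R) :
  mutually_singular (dilated_positive (rpos m)) (dilated_positive (rneg m)).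
Proof.
case: (rsing m) => A [mA pA nA].
have AE : divt @^-1` ((fun x => x * t%:num) @^-1` A) = A.
  by apply/seteqP; split => x; rewrite /preimage /divt /= divfK.
exists ((fun x => x * t%:num) @^-1` A); split.
- rewrite -[X in measurable X]setTI.
  have : measurable_fun setT (fun x : measurableTypeR R => x * t%:num).
    exact: mulrr_measurable.
  by move=> /(_ measurableT); apply.
- by rewrite -[X in rpos m X]AE in pA; rewrite /= /dilated_measure /pushforward [X in (_ * X)%E]pA mule0.
- rewrite -[X in ~` X]AE in nA.
  by rewrite /= /dilated_measure /pushforward [X in (_ * X)%E]nA mule0.
Qed.

Definition dilated_radon (mu : complex_radon R) : complex_radon R :=
  ComplexRadon (RealRadon (dilated_sing (cre mu)))
               (RealRadon (dilated_sing (cim mu))).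


End dilation.

Section limit_sets.
Context {R : realType}.
Implicit Types (rho : R -> R) (mu nu : complex_radon R).

Definition radon_growth rho mu (D : set R) : \bar R :=
  ereal_sup [set (radon_variation mu `[r, (expR 1 * r)%R] *
                  ((prox_weight rho r)^-1)%:E)%E | r in D].

Definition radon_class rho mu := (radon_growth rho mu `]0%R, +oo[ < +oo)%E.

Lemma prox_weightV_ge0 rho (r : R) : 0 <= (prox_weight rho r)^-1.
Proof. by rewrite invr_ge0 powR_ge0. Qed.

Definition azarin_shift rho mu (t : {posnum R}) : complex_radon R :=
  dilated_radon (NngNum (prox_weightV_ge0 rho t%:num)) t mu.

Definition limit_set rho mu : set (complex_radon R) :=
  [set nu | exists t_ : nat -> {posnum R},
    (t_ n)%:num @[n --> \oo] --> +oo /\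
    wide_cvg (fun n => azarin_shift rho mu (t_ n)) nu].

Definition limit_set_singleton rho mu nu :=
  forall nu', limit_set rho mu nu' <-> radon_eq nu' nu.

Definition regular_radon rho mu :=
  (radon_growth rho mu `[1%R, +oo[ < +oo)%E /\
  exists nu, limit_set_singleton rho mu nu.

(* The integral converges absolutely for almost every r only; elsewhere the
   value is arbitrary. *)
Definition Psi (K : R -> R[i]) mu (r : R) : R[i] :=
  radon_integral mu (fun t => K (t / r)).

Definition kernel_condition rho (K : R -> R[i]) :=
  let w t := (t `^ (order_at_infty rho - 1))%:E in
  lebesgue_measure.-integrable (`]0%R, +oo[ : set (measurableTypeR R))
    (fun t => w t * prox_gamma rho t * (complex.Re (K t))%:E)%E /\
  lebesgue_measure.-integrable (`]0%R, +oo[ : set (measurableTypeR R))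
    (fun t => w t * prox_gamma rho t * (complex.Im (K t))%:E)%E.

Definition kernel_zeros rho (K : R -> R[i]) : set R :=
  [set l | cintegral `]0, +oo[
     (fun t => K t * cpow t ((order_at_infty rho - 1) +i* (- l))) = 0].

End limit_sets.

(* Main.v *)
Require Import Defs.
From HB Require Import structures.
From mathcomp Require Import all_boot all_order all_algebra.
From mathcomp Require Import complex.
From mathcomp Require Import all_classical all_reals all_analysis.
From mathcomp Require Import ring lra measurable_realfun.
Import Order.TTheory GRing.Theory Num.Theory.
Import numFieldNormedType.Exports.
Local Open Scope classical_set_scope.
Local Open Scope ring_scope.
Local Open Scope complex_scope.
Set Implicit Arguments.
Unset Strict Implicit.

(** Put [r = order_at_infty rho] and pass to logarithmic coordinates.  Then
    [V(e^x) = exp (r x + u x)] with [u = slow rho] even and slowly varying, the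
    measure [e^(-r y) dmu(e^y)] has mass at most a constant times [exp (u x)] on
    [x, x + 1], and [Psi] becomes, up to the factor [e^(r x)], the correlation of
    that measure with the kernel [k z = e^(r z) K(e^z)].  As [gamma (e^z)] is the
    supremum of [exp (u (x + z) - u x)] over [x], the hypothesis on [K] says exactly
    that [k] is integrable after the loss caused by the variation of [u]
    ([log_kernel_le]); this is what Fubini's theorem needs ([convolution_fubini]) to
    write the integral of a test function against [s] as the integral of [k] against
    [pairing psi], the pairing of the tilted measure with the translates of a
    compactly supported continuous [psi] ([radon_integral_Psi]).  The set [Lambda]
    is the set of real zeros of the Fourier transform of [k] ([kernel_zerosE]).

    The limit set of [s] is invariant under dilations, so if it is a single measure
    then the limit of the correlations along [ln t_n + x] does not depend on [x], and
    it equals the limit of their averages over long windows of [x].  Such an average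
    is [k] integrated against an average of [pairing psi]; the latter is nearly
    constant over the essential support of [k], and [k] has integral zero because
    [0] is in [Lambda].  Hence the limit is zero ([limit_zero], [limit_integral_zero]).

    Let now [nu] be a limit of [mu] along [t_n].  The growth bound passes to the limit
    and loses its weight ([growth_limit]), so the pairings of [nu] are bounded
    continuous functions.  By dominated convergence the correlation of [nu] with [k]
    is the density of a limit of the corresponding dilations of [s], which is zero:
    [k] annihilates every pairing of [nu] ([limit_annihilated]).  A bounded continuous
    function annihilated by an integrable kernel whose Fourier transform has finitely
    many zeros is an exponential sum with frequencies among these zeros
    ([finite_spectrum]).  Three facts give this form of Wiener's theorem.  Near a
    frequency where the transform of [k] does not vanish, narrow Fejer means of the
    function vanish, by a contraction argument ([regular_vanish]).  A function whose
    Fejer means vanish near every frequency is zero ([empty_spectrum]), since a Fejer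
    kernel of any width is a combination of modulated narrow ones.  At an isolated
    point of the spectrum the Fejer mean is an exponential ([isolated_spectrum]),
    which can be subtracted.

    It remains to read [nu] off its pairings.  The coefficients depend on [psi], but
    integrating the pairing of one test function against another is symmetric in the
    two ([pairing_symmetry]); comparing exponential sums, the coefficient at [l] is a
    constant, the same for all [psi], times the Fourier transform of [psi] at [l]
    ([pairing_density]).  This is the pairing of an exponential sum, and test functions
    determine a Radon measure ([radon_eq_test], [exponential_measure]). *)

Local Notation Re := complex.Re.
Local Notation Im := complex.Im.
Local Notation normc := ComplexField.Normc.normc.

(** * Complex-valued integrals *)

Section complex_modulus.
Context {R : realType}.
Implicit Types (z w : R[i]) (x a b : R).

Lemma ReD z w : Re (z + w) = Re z + Re w. Proof. by case: z w => [? ?] [? ?]. Qed.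
Lemma ImD z w : Im (z + w) = Im z + Im w. Proof. by case: z w => [? ?] [? ?]. Qed.
Lemma ReN z : Re (- z) = - Re z. Proof. by case: z. Qed.
Lemma ImN z : Im (- z) = - Im z. Proof. by case: z. Qed.
Lemma ReB z w : Re (z - w) = Re z - Re w. Proof. by rewrite ReD ReN. Qed.
Lemma ImB z w : Im (z - w) = Im z - Im w. Proof. by rewrite ImD ImN. Qed.
Lemma ReM z w : Re (z * w) = Re z * Re w - Im z * Im w.
Proof. by case: z w => [? ?] [? ?]. Qed.
Lemma ImM z w : Im (z * w) = Re z * Im w + Im z * Re w.
Proof. by case: z w => [? ?] [? ?]. Qed.

Definition ReImE := (ReB, ImB, ReD, ImD, ReN, ImN, ReM, ImM).

Lemma eqC z w : Re z = Re w -> Im z = Im w -> z = w.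
Proof. by case: z w => [? ?] [? ?] /= -> ->. Qed.

Lemma normc_ge0 z : 0 <= normc z. Proof. by case: z => a b; exact: sqrtr_ge0. Qed.
Lemma normcD z w : normc (z + w) <= normc z + normc w.
Proof. exact: complex.le_normcD. Qed.
Lemma normcM z w : normc (z * w) = normc z * normc w.
Proof. exact: ComplexField.Normc.normcM. Qed.
Lemma normcN z : normc (- z) = normc z.
Proof. exact: complex.normcN. Qed.
Lemma normcB z w : normc (z - w) <= normc z + normc w.
Proof. by rewrite -(normcN w); exact: normcD. Qed.
Lemma normc0 : normc (0 : R[i]) = 0. Proof. exact: ComplexField.Normc.normc0. Qed.
Lemma normc_eq0 z : normc z = 0 -> z = 0.
Proof. exact: ComplexField.Normc.eq0_normc. Qed.

Lemma normc_Re z : `|Re z| <= normc z.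
Proof.
by case: z => a b /=; rewrite -sqrtr_sqr; apply: ler_wsqrtr; rewrite lerDl sqr_ge0.
Qed.
Lemma normc_Im z : `|Im z| <= normc z.
Proof.
by case: z => a b /=; rewrite -sqrtr_sqr; apply: ler_wsqrtr; rewrite lerDr sqr_ge0.
Qed.
Lemma normc_real a : normc a%:C = `|a|.
Proof. by rewrite /= expr0n addr0 sqrtr_sqr. Qed.
Lemma normc_le z : normc z <= `|Re z| + `|Im z|.
Proof.
case: z => a b /=; rewrite -[leRHS]ger0_norm ?addr_ge0// -sqrtr_sqr.
apply: ler_wsqrtr; rewrite sqrrD !real_normK ?num_real//.
by rewrite lerD2r lerDl mulrn_wge0// mulr_ge0.
Qed.

Lemma normc_sum (I : Type) (r : seq I) (P : pred I) (F : I -> R[i]) :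
  normc (\sum_(i <- r | P i) F i) <= \sum_(i <- r | P i) normc (F i).
Proof.
elim/big_rec2: _ => [|i y1 y2 _ ih]; first by rewrite normc0.
by rewrite (le_trans (normcD _ _))// lerD2l.
Qed.

Definition expi x : R[i] := cos x +i* sin x.

Lemma expi0 : expi 0 = 1. Proof. by rewrite /expi cos0 sin0. Qed.
Lemma expiD x a : expi (x + a) = expi x * expi a.
Proof. by apply: eqC; rewrite !ReImE /= ?cosD ?sinD; ring. Qed.
Lemma normc_expi x : normc (expi x) = 1.
Proof. by rewrite /= cos2Dsin2 sqrtr1. Qed.
Lemma expiNK x : expi (- x) * expi x = 1.
Proof. by rewrite -expiD addNr expi0. Qed.
Lemma expi_neq0 x : expi x != 0.
Proof.
apply/eqP => h; have := normc_expi x; rewrite h normc0 => /esym/eqP.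
by rewrite oner_eq0.
Qed.
Lemma expi_pi : expi pi = -1.
Proof. by apply: eqC; rewrite /= ?cospi ?sinpi// oppr0. Qed.

Lemma abs_sin_le x : `|sin x| <= `|x|.
Proof.
wlog x0 : x / 0 <= x.
  move=> h; case: (leP 0 x) => [/h//|/ltW x0].
  by rewrite -normrN -sinN -(normrN x); apply: h; rewrite oppr_ge0.
move: x0; rewrite le_eqVlt => /predU1P[<-|x0]; first by rewrite sin0.
have [c _] := @MVT R sin cos 0 x x0 (fun y _ => is_derive_sin y)
  (continuous_subspaceT (@continuous_sin R)).
rewrite sin0 !subr0 => ->; rewrite normrM ler_piMl//.
by rewrite ler_norml cos_geN1 cos_le1.
Qed.

Lemma normc_expi1 x : normc (expi x - 1) <= `|x|.
Proof.
have -> : normc (expi x - 1) = Num.sqrt (2 * (1 - cos x)).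
  rewrite /expi /=; congr Num.sqrt; have := cos2Dsin2 x => h.
  have -> : (sin x - 0) ^+ 2 = 1 - cos x ^+ 2 by rewrite subr0; apply: (addIr (cos x ^+ 2)); rewrite subrK addrC.
  by ring.
rewrite -sqrtr_sqr; apply: ler_wsqrtr.
have -> : cos x = 1 - 2 * sin (x / 2) ^+ 2.
  have {1}-> : x = x / 2 + x / 2 by rewrite -splitr.
  rewrite cosD.
  have -> : cos (x / 2) * cos (x / 2) = 1 - sin (x / 2) ^+ 2.
    by apply: (addIr (sin (x / 2) ^+ 2)); rewrite subrK -expr2 cos2Dsin2.
  by ring.
have := abs_sin_le (x / 2).
rewrite -ler_sqr ?nnegrE ?normr_ge0// !real_normK ?num_real// => h.
have -> : x ^+ 2 = 4 * (x / 2) ^+ 2 by field.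
by nra.
Qed.

End complex_modulus.

Section complex_integral.
Context {R : realType}.

Definition cmeas d (T : measurableType d) (f : T -> R[i]) :=
  measurable_fun setT (fun x => Re (f x)) /\
  measurable_fun setT (fun x => Im (f x)).

Definition cint d (T : measurableType d) (m : {measure set T -> \bar R}) (f : T -> R[i]) :=
  m.-integrable setT (fun x => (Re (f x))%:E) /\
  m.-integrable setT (fun x => (Im (f x))%:E).

Definition CI d (T : measurableType d) (m : {measure set T -> \bar R}) (f : T -> R[i]) : R[i] :=
  (\int[m]_x Re (f x)) +i* (\int[m]_x Im (f x)).

Section measurability.
Context d (T : measurableType d).
Implicit Types f g : T -> R[i].

Lemma cmeas_real (h : T -> R) : measurable_fun setT h -> cmeas (fun x => (h x)%:C).
Proof. by move=> mh; split => //=; exact: measurable_cst. Qed.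
Lemma cmeas_cst (c : R[i]) : cmeas (fun _ : T => c).
Proof. by split; exact: measurable_cst. Qed.
Lemma cmeasD f g : cmeas f -> cmeas g -> cmeas (fun x => f x + g x).
Proof.
move=> [f1 f2] [g1 g2]; split; under eq_fun do rewrite ?ReD ?ImD;
  exact: measurable_funD.
Qed.
Lemma cmeasN f : cmeas f -> cmeas (fun x => - f x).
Proof.
by move=> [f1 f2]; split; under eq_fun do rewrite ?ReN ?ImN; exact: measurableT_comp.
Qed.
Lemma cmeasB f g : cmeas f -> cmeas g -> cmeas (fun x => f x - g x).
Proof. by move=> mf /cmeasN; exact: cmeasD. Qed.
Lemma cmeasM f g : cmeas f -> cmeas g -> cmeas (fun x => f x * g x).
Proof.
move=> [f1 f2] [g1 g2]; split; under eq_fun do rewrite ?ReM ?ImM.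
  by apply: measurable_funB; exact: measurable_funM.
by apply: measurable_funD; exact: measurable_funM.
Qed.
Lemma cmeas_sum (I : Type) (r : seq I) (F : I -> T -> R[i]) :
  (forall i, cmeas (F i)) -> cmeas (fun x => \sum_(i <- r) F i x).
Proof.
move=> mF; elim: r => [|i r ih].
  by under eq_fun do rewrite big_nil; exact: cmeas_cst.
by under eq_fun do rewrite big_cons; exact: cmeasD.
Qed.
Lemma cmeas_comp d' (T' : measurableType d') (h : T' -> T) f :
  measurable_fun setT h -> cmeas f -> cmeas (fun x => f (h x)).
Proof.
move=> mh [f1 f2]; split.
  by apply: (measurableT_comp f1).
by apply: (measurableT_comp f2).
Qed.
Lemma measurable_normc f : cmeas f -> measurable_fun setT (fun x => normc (f x)).
Proof.
move=> [f1 f2].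
rewrite (_ : (fun x => _) = (fun x => (Re (f x) ^+ 2 + Im (f x) ^+ 2) `^ 2^-1)).
  apply: (measurableT_comp (measurable_powR _)).
  by apply: measurable_funD; exact: measurable_funX.
by apply/funext => x; rewrite powR12_sqrt ?addr_ge0 ?sqr_ge0//; case: (f x).
Qed.

End measurability.

Section integration.
Context d (T : measurableType d) (m : {measure set T -> \bar R}).
Implicit Types f g : T -> R[i].

Lemma cint_meas f : cint m f -> cmeas f.
Proof. by move=> [/measurable_int/measurable_EFinP ? /measurable_int/measurable_EFinP]. Qed.

Lemma cint_dom f (h : T -> R) : cmeas f -> m.-integrable setT (EFin \o h) ->
  (forall x, normc (f x) <= h x) -> cint m f.
Proof.
move=> [f1 f2] ih fh; split; apply: (le_integrable _ _ _ ih) => //.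
- exact/measurable_EFinP.
- move=> x _ /=; rewrite lee_fin (le_trans (normc_Re _))// (le_trans (fh x))//.
  exact: ler_norm.
- exact/measurable_EFinP.
- move=> x _ /=; rewrite lee_fin (le_trans (normc_Im _))// (le_trans (fh x))//.
  exact: ler_norm.
Qed.

Lemma integrable_normc f : cint m f -> m.-integrable setT (EFin \o (fun x => normc (f x))).
Proof.
move=> cf; have mf := cint_meas cf; case: cf => [f1 f2].
have := integrableD measurableT (integrable_norm f1) (integrable_norm f2).
apply: le_integrable => //; first exact/measurable_EFinP/measurable_normc.
move=> x _ /=; rewrite lee_fin ger0_norm ?normc_ge0// (le_trans (normc_le _))//.
exact: ler_norm.
Qed.

Lemma cintD f g : cint m f -> cint m g -> cint m (fun x => f x + g x).
Proof.
move=> [f1 f2] [g1 g2]; split; under eq_fun do rewrite ?ReD ?ImD ?EFinD;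
  exact: integrableD.
Qed.
Lemma cintN f : cint m f -> cint m (fun x => - f x).
Proof.
move=> [f1 f2]; split; under eq_fun do rewrite ?ReN ?ImN ?EFinN; exact: integrableN.
Qed.
Lemma cintB f g : cint m f -> cint m g -> cint m (fun x => f x - g x).
Proof. by move=> cf /cintN; exact: cintD. Qed.
Lemma cintZ (c : R[i]) f : cint m f -> cint m (fun x => c * f x).
Proof.
move=> cf; have mf := cint_meas cf.
apply: (@cint_dom _ (fun x => normc c * normc (f x))).
- by apply: cmeasM => //; exact: cmeas_cst.
- have := integrableZl measurableT (normc c) (integrable_normc cf).
  by apply: eq_integrable.
- by move=> x; rewrite normcM.
Qed.
Lemma cint0 : cint m (fun=> 0). Proof. by split; exact: integrable0. Qed.
Lemma cint_sum (I : Type) (r : seq I) (F : I -> T -> R[i]) :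
  (forall i, cint m (F i)) -> cint m (fun x => \sum_(i <- r) F i x).
Proof.
move=> mF; elim: r => [|i r ih].
  by under eq_fun do rewrite big_nil; exact: cint0.
by under eq_fun do rewrite big_cons; exact: cintD.
Qed.

Lemma eq_CI f g : f =1 g -> CI m f = CI m g.
Proof. by move=> /funext ->. Qed.

Lemma CI0 : CI m (fun=> 0) = 0.
Proof. by rewrite /CI /= /Rintegral integral0. Qed.

Lemma CID f g : cint m f -> cint m g -> CI m (fun x => f x + g x) = CI m f + CI m g.
Proof.
move=> [f1 f2] [g1 g2]; apply: eqC => /=.
  by under eq_Rintegral do rewrite ReD; rewrite RintegralD.
by under eq_Rintegral do rewrite ImD; rewrite RintegralD.
Qed.

Lemma CIZ (c : R[i]) f : cint m f -> CI m (fun x => c * f x) = c * CI m f.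
Proof.
move=> [f1 f2].
have Z (a : R) (h : T -> R) : m.-integrable setT (EFin \o h) ->
  m.-integrable setT (EFin \o (fun x => a * h x)).
  move=> ih; have := integrableZl measurableT a ih; exact: eq_integrable.
apply: eqC; rewrite !ReImE /=.
  under eq_Rintegral do rewrite ReM.
  by rewrite RintegralB ?RintegralZl//; exact: Z.
under eq_Rintegral do rewrite ImM.
by rewrite RintegralD ?RintegralZl//; exact: Z.
Qed.

Lemma CIN f : cint m f -> CI m (fun x => - f x) = - CI m f.
Proof.
move=> cf; rewrite -mulN1r -CIZ//; apply: eq_CI => x; by rewrite mulN1r.
Qed.

Lemma CIB f g : cint m f -> cint m g -> CI m (fun x => f x - g x) = CI m f - CI m g.
Proof. by move=> cf cg; rewrite CID ?CIN//; exact: cintN. Qed.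

Lemma CI_sum (I : Type) (r : seq I) (F : I -> T -> R[i]) :
  (forall i, cint m (F i)) -> CI m (fun x => \sum_(i <- r) F i x) = \sum_(i <- r) CI m (F i).
Proof.
move=> mF; elim: r => [|i r ih].
  by under eq_CI do rewrite big_nil; rewrite CI0 big_nil.
under eq_CI do rewrite big_cons.
by rewrite CID ?ih ?big_cons//; exact: cint_sum.
Qed.

(** After a rotation making the integral a nonnegative real, the modulus of
    the integral is the integral of a real part. *)
Lemma CI_le f (h : T -> R) : cmeas f -> m.-integrable setT (EFin \o h) ->
  (forall x, normc (f x) <= h x) -> normc (CI m f) <= \int[m]_x h x.
Proof.
move=> mf ih fh; have cf := cint_dom mf ih fh.
have [->|I0] := eqVneq (CI m f) 0.
  rewrite normc0; apply: Rintegral_ge0 => x _.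
  by rewrite (le_trans (normc_ge0 _) (fh x)).
set I := CI m f in I0 *.
have nI0 : normc I != 0 by apply: contra_neq I0; exact: normc_eq0.
pose c : R[i] := (normc I)%:C / I.
have nc : normc c = 1.
  have : normc (c * I) = normc I.
    by rewrite /c divfK// normc_real ger0_norm ?normc_ge0.
  rewrite normcM => /eqP; rewrite -subr_eq0 -{2}(mul1r (normc I)) -mulrBl mulf_eq0.
  by rewrite (negbTE nI0) orbF subr_eq0 => /eqP.
have -> : normc I = Re (CI m (fun x => c * f x)).
  by rewrite CIZ// -/I /c divfK.
have [icf _] := cintZ c cf.
rewrite /=; apply: le_Rintegral => // x _.
by rewrite (le_trans (ler_norm _))// (le_trans (normc_Re _))// normcM nc mul1r.
Qed.

Lemma CI_le_normc f : cint m f -> normc (CI m f) <= \int[m]_x normc (f x).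
Proof. by move=> cf; apply: CI_le => //; [exact: cint_meas|exact: integrable_normc]. Qed.

Lemma CI_dct (f_ : nat -> T -> R[i]) f (h : T -> R) :
  (forall n, cmeas (f_ n)) -> cmeas f ->
  m.-integrable setT (EFin \o h) -> (forall n x, normc (f_ n x) <= h x) ->
  (forall x, ccvg (fun n => f_ n x) (f x)) ->
  ccvg (fun n => CI m (f_ n)) (CI m f).
Proof.
move=> mf_ mf ih fh ff.
have key (g_ : nat -> T -> R) (g : T -> R) : (forall n, measurable_fun setT (g_ n)) ->
    measurable_fun setT g -> (forall n x, `|g_ n x| <= h x) ->
    (forall x, g_ n x @[n --> \oo] --> g x) ->
    \int[m]_x g_ n x @[n --> \oo] --> \int[m]_x g x.
  move=> mg_ mg gh gg.
  have [|||||ig _ c] := @dominated_convergence _ _ _ m setT measurableT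
     (fun n => EFin \o g_ n) (EFin \o g) (EFin \o h).
  - by move=> n; exact/measurable_EFinP.
  - exact/measurable_EFinP.
  - by apply/aeW => x _ /=; apply: cvg_EFin; [exact: nearW|exact: gg].
  - by [].
  - by apply/aeW => x n _ /=; rewrite lee_fin.
  by apply: fine_cvg; rewrite fineK//; exact: integrable_fin_num.
split => /=.
- apply: key => [n||n x|x]; [exact: (mf_ n).1|exact: mf.1| |exact: (ff x).1].
  by rewrite (le_trans (normc_Re _)).
- apply: key => [n||n x|x]; [exact: (mf_ n).2|exact: mf.2| |exact: (ff x).2].
  by rewrite (le_trans (normc_Im _)).
Qed.

End integration.

End complex_integral.

(** * Images of measures *)

Section transfer.
Context {R : realType} d1 d2 (X : measurableType d1) (Y : measurableType d2).
Variables (phi : X -> Y) (mphi : measurable_fun setT phi).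
Variable m : {measure set X -> \bar R}.

Definition imeas : {measure set Y -> \bar R} :=
  @measure_function_pushforward__canonical__measure_function_Measure _ _ X Y R m phi mphi.

Lemma integral_pushforwardT (f : Y -> R) : measurable_fun setT f ->
  (\int[imeas]_y (f y)%:E = \int[m]_x (f (phi x))%:E)%E.
Proof.
move=> mf; have mEf : measurable_fun setT (EFin \o f) by exact/measurable_EFinP.
rewrite (integralE _ setT (EFin \o f)).
rewrite [X in (X - _)%E]ge0_integral_pushforward//; last exact: measurable_funepos.
rewrite [X in (_ - X)%E]ge0_integral_pushforward//; last exact: measurable_funeneg.
rewrite preimage_setT [RHS]integralE; congr (_ - _)%E;
  by apply: eq_integral => x _; rewrite /= ?funeposE ?funenegE.
Qed.

Lemma Rintegral_pushforwardT (f : Y -> R) : measurable_fun setT f ->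
  \int[imeas]_y f y = \int[m]_x f (phi x).
Proof. by move=> mf; rewrite /Rintegral integral_pushforwardT. Qed.

Lemma integrable_pushforwardT (f : Y -> R) : measurable_fun setT f ->
  imeas.-integrable setT (EFin \o f) <->
  m.-integrable setT (EFin \o (f \o phi)).
Proof.
move=> mf; split=> [|i]; last first.
  by apply: integrable_pushforward => //; exact/measurable_EFinP.
move=> /integrableP[_ i]; apply/integrableP; split.
  by apply/measurable_EFinP; exact: measurableT_comp.
move: i; rewrite ge0_integral_pushforward//.
by apply: measurableT_comp => //; exact/measurable_EFinP.
Qed.

Lemma CI_pushforward (f : Y -> R[i]) : cmeas f ->
  CI imeas f = CI m (f \o phi).
Proof. by move=> [f1 f2]; rewrite /CI !Rintegral_pushforwardT. Qed.

Lemma cint_pushforward (f : Y -> R[i]) : cmeas f ->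
  cint imeas f <-> cint m (f \o phi).
Proof.
move=> [f1 f2]; split => -[i1 i2]; split.
- by have /(integrable_pushforwardT f1) := i1.
- by have /(integrable_pushforwardT f2) := i2.
- by apply/(integrable_pushforwardT f1).
- by apply/(integrable_pushforwardT f2).
Qed.

End transfer.

Section same_measure.
Context {R : realType} d (T : measurableType d).
Variables m1 m2 : {measure set T -> \bar R}.
Hypothesis m12 : forall A, measurable A -> m1 A = m2 A.

Lemma same_integral (f : T -> \bar R) : (\int[m1]_x f x = \int[m2]_x f x)%E.
Proof. by apply: eq_measure_integral => A mA _; exact: m12. Qed.

Lemma same_integrable (f : T -> \bar R) : m1.-integrable setT f -> m2.-integrable setT f.
Proof.
by move=> /integrableP[mf i]; apply/integrableP; split => //; rewrite -same_integral.
Qed.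

Lemma same_CI (f : T -> R[i]) : CI m1 f = CI m2 f.
Proof. by rewrite /CI /Rintegral !same_integral. Qed.

Lemma same_cint (f : T -> R[i]) : cint m1 f -> cint m2 f.
Proof. by move=> [f1 f2]; split; exact: same_integrable. Qed.

End same_measure.

(** * Measures with a density *)

Section density_measure.
Context {R : realType} d (T : measurableType d) (m : {measure set T -> \bar R}).
Variables (h : T -> R) (mh : measurable_fun setT h).

(** The modulus makes the formula a measure for every measurable [h]. *)
Definition dens of measurable_fun setT h := fun A : set T => (\int[m]_(x in A) `|h x|%:E)%E.

Let dens0 : dens mh set0 = 0%E. Proof. by rewrite /dens integral_set0. Qed.
Let dens_ge0 A : (0 <= dens mh A)%E.
Proof. by apply: integral_ge0 => x _; rewrite lee_fin. Qed.
Let dens_sigma : semi_sigma_additive (dens mh).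
Proof.
apply: semi_sigma_additive_nng_induced => [|x]; last by rewrite lee_fin.
by apply/measurable_EFinP; exact: measurableT_comp.
Qed.

HB.instance Definition _ := isMeasure.Build _ _ _ (dens mh) dens0 dens_ge0 dens_sigma.

Import HBNNSimple.

Lemma ge0_integral_dens (f : T -> \bar R) : measurable_fun setT f ->
  (forall x, 0 <= f x)%E -> (\int[dens mh]_x f x = \int[m]_x (f x * `|h x|%:E))%E.
Proof.
move=> mf f0; have mnh : measurable_fun setT (fun x => `|h x|%:E).
  by apply/measurable_EFinP; exact: measurableT_comp.
pose f_ := nnsfun_approx measurableT mf.
transitivity (limn (fun n => \int[dens mh]_x (f_ n x)%:E)%E).
  rewrite -monotone_convergence//.
  - by apply: eq_integral => y _; apply/esym/cvg_lim => //; exact: cvg_nnsfun_approx.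
  - by move=> n; exact/measurable_EFinP/measurable_funP.
  - by move=> n y _; rewrite lee_fin.
  - by move=> y _ p n pn; rewrite lee_fin; exact/lefP/nd_nnsfun_approx.
transitivity (limn (fun n => \int[m]_x ((f_ n x)%:E * `|h x|%:E))%E); last first.
  rewrite -monotone_convergence//.
  - apply: eq_integral => y _; apply/cvg_lim => //.
    by apply: cvgeZr => //; exact: cvg_nnsfun_approx.
  - by move=> n; apply: emeasurable_funM => //; exact/measurable_EFinP/measurable_funP.
  - by move=> n y _; rewrite mule_ge0// lee_fin.
  - move=> y _ p n pn; apply: lee_wpmul2r; rewrite ?lee_fin//.
    exact/lefP/nd_nnsfun_approx.
congr (limn _); apply/funext => n.
transitivity (\sum_(k \in range (f_ n))
    \int[dens mh]_x (k * \1_(f_ n @^-1` [set k]) x)%:E)%E.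
  under eq_integral do rewrite fimfunE -fsumEFin//.
  rewrite ge0_integral_fsum//.
  - by move=> y; exact/measurable_EFinP/measurable_funM.
  - by move=> y x _; rewrite nnfun_muleindic_ge0.
transitivity (\sum_(k \in range (f_ n))
    \int[m]_x ((k * \1_(f_ n @^-1` [set k]) x)%:E * `|h x|%:E))%E; last first.
  rewrite -ge0_integral_fsum//.
  - apply: eq_integral => x _; rewrite [in RHS]fimfunE -fsumEFin// ge0_mule_fsuml//.
    by move=> r; exact: nnfun_muleindic_ge0.
  - by move=> r; apply: emeasurable_funM => //; exact/measurable_EFinP/measurable_funM.
  - by move=> r x _; apply: mule_ge0; [rewrite nnfun_muleindic_ge0|rewrite lee_fin].
apply: eq_fsbigr => r _; have [r0|r0] := ltP r 0.
  by rewrite !integral0_eq// => x _; rewrite preimage_nnfun0// indic0 mulr0 ?mul0e.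
rewrite integralZl_indic_nnsfun// integral_indic//= setIT /dens.
under [RHS]eq_integral do rewrite EFinM -muleA.
rewrite ge0_integralZl//; last first.
  by apply: emeasurable_funM => //; exact/measurable_EFinP.
congr (_ * _)%E; rewrite integral_mkcond; apply: eq_integral => x _.
by rewrite /patch indicE; case: ifP => _; rewrite ?mul1e ?mul0e.
Qed.

Hypothesis h0 : forall x, 0 <= h x.

Lemma integral_dens (f : T -> R) : measurable_fun setT f ->
  (\int[dens mh]_x (f x)%:E = \int[m]_x (f x * h x)%:E)%E.
Proof.
move=> mf; have mEf : measurable_fun setT (EFin \o f) by exact/measurable_EFinP.
rewrite (integralE _ setT (EFin \o f)) !ge0_integral_dens//; last 2 first.
- exact: measurable_funeneg.
- exact: measurable_funepos.
rewrite [RHS]integralE; congr (_ - _)%E; apply: eq_integral => x _.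
  by rewrite !funeposE /= ger0_norm// -!EFin_max -EFinM maxr_pMl// mul0r.
by rewrite !funenegE /= ger0_norm// -!EFin_max -EFinM maxr_pMl// mul0r mulNr.
Qed.

Lemma Rintegral_dens (f : T -> R) : measurable_fun setT f ->
  \int[dens mh]_x f x = \int[m]_x (f x * h x).
Proof. by move=> mf; rewrite /Rintegral integral_dens. Qed.

End density_measure.

(** * Changes of variable for Lebesgue measure *)

Section change_of_variables.
Context {R : realType}.
Local Notation lam := (@lebesgue_measure R).

Let measurable_shift (a : R) :
  measurable_fun setT (fun x : measurableTypeR R => (a + x : measurableTypeR R)).
Proof. exact: measurable_funD. Qed.

Let lebesgue_shift (a : R) (A : set (measurableTypeR R)) : measurable A ->
  imeas (measurable_shift a) lam A = lam A.
Proof.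
move=> mA; apply/esym.
apply: (@lebesgue_measure_unique R (imeas (measurable_shift a) lam)) => //.
move=> _ [[c e]] _ <-.
have -> : imeas (measurable_shift a) lam `]c, e]%classic =
    lam `]c - a, e - a]%classic.
  congr (lam _); apply/seteqP; split => x /=.
    by rewrite !in_itv /= ltrBlDl lerBrDl.
  by rewrite !in_itv /= ltrBlDl lerBrDl.
by rewrite !lebesgue_measure_itv /= !lte_fin ltrD2r -!EFinB opprB addrA subrK.
Qed.

Lemma CI_shift (a : R) (f : R -> R[i]) : cmeas (T := measurableTypeR R) f ->
  CI lam (fun x => f (a + x)) = CI lam f.
Proof.
by move=> mf; rewrite -[RHS](same_CI (lebesgue_shift a)) CI_pushforward.
Qed.

Lemma cint_shift (a : R) (f : R -> R[i]) : cint lam f -> cint lam (fun x => f (a + x)).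
Proof.
move=> cf; have mf := cint_meas cf.
apply/(cint_pushforward (measurable_shift a) _ mf).
by apply: same_cint cf => A mA; rewrite lebesgue_shift.
Qed.

Let mN : measurable_fun setT (fun x : measurableTypeR R => (- x : measurableTypeR R)).
Proof. by apply: measurableT_comp => //; exact: measurable_id. Qed.

Let lebesgue_opp (A : set (measurableTypeR R)) : measurable A ->
  imeas mN lam A = lam A.
Proof. exact: lebesgue_measureN. Qed.

Lemma CI_opp (f : R -> R[i]) : cmeas (T := measurableTypeR R) f ->
  CI lam (fun x => f (- x)) = CI lam f.
Proof. by move=> mf; rewrite -[RHS](same_CI lebesgue_opp) CI_pushforward. Qed.

(** The substitution [z = y - x] as [x] varies. *)
Lemma CI_sub (y : R) (f : R -> R[i]) : cmeas (T := measurableTypeR R) f ->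
  CI lam (fun x => f (y - x)) = CI lam f.
Proof.
move=> mf; rewrite -(CI_shift y mf) -[RHS]CI_opp//.
by apply: cmeas_comp mf; exact: measurable_funD.
Qed.

(** The same substitution for nonnegative extended-valued functions. *)
Lemma ge0_integral_sub (y : R) (f : R -> \bar R) :
  measurable_fun (setT : set (measurableTypeR R)) f -> (forall x, 0 <= f x)%E ->
  (\int[lam]_x f (y - x)%R = \int[lam]_x f x)%E.
Proof.
move=> mf f0.
have my : measurable_fun setT (fun x : measurableTypeR R => f (y + x)).
  exact: (measurableT_comp mf (measurable_shift y)).
rewrite -[RHS](same_integral (lebesgue_shift y)).
rewrite (ge0_integral_pushforward (measurable_shift y))// preimage_setT.
rewrite -[RHS](same_integral lebesgue_opp).
rewrite (ge0_integral_pushforward mN); last 3 first.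
- by [].
- exact: my.
- by move=> x _; exact: f0.
by rewrite preimage_setT.
Qed.

Let mZ (a : R) : measurable_fun setT (fun x : measurableTypeR R => (a * x : measurableTypeR R)).
Proof. exact: measurable_funM. Qed.

Let lebesgue_scale (a : {posnum R}) (A : set (measurableTypeR R)) : measurable A ->
  mscale (NngNum (ge0 a)) (imeas (mZ a%:num) lam) A = lam A.
Proof.
move=> mA; apply/esym.
apply: (@lebesgue_measure_unique R (mscale (NngNum (ge0 a)) (imeas (mZ a%:num) lam))) => //.
move=> _ [[c e]] _ <-.
pose I : set R := `]c / a%:num, e / a%:num]%classic.
transitivity (a%:num%:E * lam I)%E; last first.
  congr (_ * lam _)%E; apply/seteqP; split => x; rewrite /I /=.
    by rewrite !in_itv /= ltr_pdivrMr// ler_pdivlMr// !(mulrC x).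
  by rewrite !in_itv /= ltr_pdivrMr// ler_pdivlMr// !(mulrC x).
rewrite /I !lebesgue_measure_itv /= !lte_fin ltr_pM2r// -!EFinB.
case: ifP => _; last by rewrite mule0.
by rewrite -EFinM -mulrBl mulrC divfK.
Qed.

Let ge0_integral_scale (a : R) (f : R -> \bar R) : 0 < a ->
  measurable_fun (setT : set (measurableTypeR R)) f -> (forall x, 0 <= f x)%E ->
  (a%:E * \int[lam]_x f (a * x)%R = \int[lam]_x f x)%E.
Proof.
move=> a0 mf f0; pose a' := PosNum a0.
rewrite -[RHS](same_integral (lebesgue_scale a')) ge0_integral_mscale//.
by rewrite (ge0_integral_pushforward (mZ a))// preimage_setT.
Qed.

Lemma integrable_scale (a : R) (f : R -> R) : 0 < a ->
  lam.-integrable setT (EFin \o f) ->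
  lam.-integrable setT (EFin \o (fun x => f (a * x))).
Proof.
move=> a0 /integrableP[mf i]; apply/integrableP; split.
  exact: (measurableT_comp mf (mZ a)).
move: i; rewrite -(ge0_integral_scale a0)//; last exact: measurableT_comp.
set I := integral _ _ _ => aI.
have : (a^-1%:E * (a%:E * I) < +oo)%E.
  apply: lte_mul_pinfty => //; rewrite ?lee_fin ?invr_ge0 ?ltW//.
by rewrite muleA -EFinM mulVf ?gt_eqF// mul1e.
Qed.

Let Rintegral_scale_ge0 (a : R) (f : R -> R) : 0 < a -> (forall x, 0 <= f x) ->
  lam.-integrable setT (EFin \o f) ->
  \int[lam]_x (a * f (a * x)) = \int[lam]_x f x.
Proof.
move=> a0 f0 i; have ia := integrable_scale a0 i.
rewrite RintegralZl// /Rintegral.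
rewrite -[LHS]/(fine a%:E * _) -fineM//; last exact: integrable_fin_num.
rewrite -(ge0_integral_scale a0 (f := EFin \o f))//; exact: measurable_int i.
Qed.

Lemma Rintegral_scale (a : R) (f : R -> R) : 0 < a ->
  lam.-integrable setT (EFin \o f) ->
  \int[lam]_x (a * f (a * x)) = \int[lam]_x f x.
Proof.
move=> a0 i; pose g x := `|f x| + f x.
have in_ : lam.-integrable setT (EFin \o (fun x => `|f x|)).
  exact: integrable_norm.
have ig : lam.-integrable setT (EFin \o g).
  by apply: eq_integrable (integrableD measurableT in_ i).
have g0 x : 0 <= g x by rewrite -lerBlDr sub0r -normrN ler_norm.
transitivity (\int[lam]_x (a * g (a * x)) - \int[lam]_x (a * `|f (a * x)|)).
  rewrite -RintegralB//.
  - by apply: eq_Rintegral => x _; rewrite /g mulrDr addrC addKr.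
  - by apply: eq_integrable (integrableZl measurableT a (integrable_scale a0 ig)).
  - by apply: eq_integrable (integrableZl measurableT a (integrable_scale a0 in_)).
rewrite (Rintegral_scale_ge0 a0 g0 ig).
rewrite (Rintegral_scale_ge0 a0 (f := fun x => `|f x|) _ in_)// -RintegralB//.
by apply: eq_Rintegral => x _; rewrite /g addrC addKr.
Qed.

Lemma CI_scale (a : R) (f : R -> R[i]) : 0 < a -> cint lam f ->
  CI lam (fun x => a%:C * f (a * x)) = CI lam f.
Proof.
move=> a0 [f1 f2]; apply: eqC => /=.
  rewrite -(Rintegral_scale (f := fun x => Re (f x)) a0)//.
  by apply: eq_Rintegral => x _; rewrite ReM /=; ring.
rewrite -(Rintegral_scale (f := fun x => Im (f x)) a0)//.
by apply: eq_Rintegral => x _; rewrite ImM /=; ring.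
Qed.

End change_of_variables.

(** * Fubini's theorem for complex integrands *)

Section complex_fubini.
Context {R : realType} d1 d2 (T1 : measurableType d1) (T2 : measurableType d2).
Variable m1 : {sigma_finite_measure set T1 -> \bar R}.
Variable m2 : {sigma_finite_measure set T2 -> \bar R}.

Let fine_integrable d (T : measurableType d) (m : {measure set T -> \bar R})
    (F : T -> \bar R) : m.-integrable setT F ->
  m.-integrable setT (fun x => (fine (F x))%:E) /\
  (\int[m]_x (fine (F x))%:E = \int[m]_x F x)%E.
Proof.
move=> iF; have mF : measurable_fun setT (fun x => (fine (F x))%:E).
  apply/measurable_EFinP; apply: measurableT_comp => //.
  exact: measurable_int iF.
split.
  apply: le_integrable iF => // x _.
  by case: (F x) => [r| |] //=; rewrite normr0 leey.
apply: ae_eq_integral => //; first exact: measurable_int iF.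
have /= := integrable_ae measurableT iF.
apply: filterS => x /(_ I) h _; by rewrite fineK.
Qed.

Let real_fubini (f : T1 * T2 -> R) : (m1 \x m2)%E.-integrable setT (EFin \o f) ->
  [/\ m1.-integrable setT (EFin \o (fun x => \int[m2]_y f (x, y))),
      m2.-integrable setT (EFin \o (fun y => \int[m1]_x f (x, y))) &
      \int[m1]_x \int[m2]_y f (x, y) = \int[m2]_y \int[m1]_x f (x, y)].
Proof.
move=> i.
have [i1 e1] := fine_integrable (integrable_fubini_F i).
pose f' (z : T2 * T1) := (f (z.2, z.1))%:E.
have mf : measurable_fun setT (EFin \o f) by exact: measurable_int i.
have i' : (m2 \x m1)%E.-integrable setT f'.
  apply/integrable12ltyP; first by apply: (measurableT_comp mf); exact: measurable_fun_pair.
  by have /(integrable21ltyP m1 m2 mf) := i.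
have [i2 e2] := fine_integrable (integrable_fubini_F i').
split => //.
rewrite /Rintegral; congr fine.
by rewrite [LHS]e1 [RHS]e2; exact: Fubini i.
Qed.

Lemma measurable_Rintegral_param (f : T1 * T2 -> R) : measurable_fun setT f ->
  measurable_fun setT (fun x => \int[m2]_y f (x, y)).
Proof.
move=> mf; apply: measurableT_comp => //.
have mEf : measurable_fun setT (EFin \o f) by exact/measurable_EFinP.
rewrite (_ : (fun x => _) = (fun x => \int[m2]_y ((EFin \o f)^\+%E (x, y)) -
    \int[m2]_y ((EFin \o f)^\-%E (x, y)))%E).
  apply: emeasurable_funB.
    apply: (@measurable_fun_fubini_tonelli_F _ _ _ _ _ m2) => //.
    exact: measurable_funepos.
  apply: (@measurable_fun_fubini_tonelli_F _ _ _ _ _ m2) => //.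
  exact: measurable_funeneg.
apply/funext => x; rewrite integralE; congr (_ - _)%E; apply: eq_integral => y _.
  by rewrite !funeposE.
by rewrite !funenegE.
Qed.

Lemma cmeas_CI_param (g : T1 * T2 -> R[i]) : cmeas g ->
  cmeas (fun x => CI m2 (fun y => g (x, y))).
Proof.
move=> [g1 g2]; split => /=.
  exact: (measurable_Rintegral_param g1).
exact: (measurable_Rintegral_param g2).
Qed.

Lemma measurable_normc_param (g : T1 * T2 -> R[i]) : cmeas g ->
  measurable_fun setT (fun x => \int[m2]_y (normc (g (x, y)))%:E)%E.
Proof.
move=> mg; have mf : measurable_fun setT (fun z => (normc (g z))%:E).
  by apply/measurable_EFinP; exact: measurable_normc.
have f0 z : (0 <= (normc (g z))%:E)%E by rewrite lee_fin normc_ge0.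
exact: measurable_fun_fubini_tonelli_F mf f0.
Qed.

Lemma cfubini (g : T1 * T2 -> R[i]) : cmeas g ->
  (\int[m1]_x \int[m2]_y (normc (g (x, y)))%:E < +oo)%E ->
  [/\ cint m1 (fun x => CI m2 (fun y => g (x, y))),
      cint m2 (fun y => CI m1 (fun x => g (x, y))) &
      CI m1 (fun x => CI m2 (fun y => g (x, y))) =
      CI m2 (fun y => CI m1 (fun x => g (x, y)))].
Proof.
move=> mg gfin; have mn := measurable_normc mg; case: mg => [g1 g2].
have ile (f : T1 * T2 -> R) : measurable_fun setT f ->
    (forall z, `|f z| <= normc (g z)) -> (m1 \x m2)%E.-integrable setT (EFin \o f).
  move=> mf fg.
  have ig : (m1 \x m2)%E.-integrable setT (fun z => (normc (g z))%:E).
    apply/integrable12ltyP; first exact/measurable_EFinP.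
    rewrite (_ : integral _ _ _ = (\int[m1]_x \int[m2]_y (normc (g (x, y)))%:E)%E) //.
    apply: eq_integral => x _; apply: eq_integral => y _.
    by rewrite gee0_abs// lee_fin normc_ge0.
  apply: le_integrable ig => //; first exact/measurable_EFinP.
  by move=> z _ /=; rewrite lee_fin (le_trans (fg z))// ler_norm.
have [a1 a2 a3] := real_fubini (ile _ g1 (fun z => normc_Re (g z))).
have [b1 b2 b3] := real_fubini (ile _ g2 (fun z => normc_Im (g z))).
by split; [split|split|rewrite /CI /= a3 b3].
Qed.

End complex_fubini.

(** * Kernels with compactly supported Fourier transform *)

Section profiles.
Context {R : realType}.
Local Notation lam := (@lebesgue_measure R).
Implicit Types (p g : R -> R) (c d y u theta : R).

(** The constant bounds two derivatives, because two integrations by parts turn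
    smoothness of the Fourier transform into decay like [1 / (1 + y^2)]. *)
Definition profile c p := exists p1 p2 : R -> R,
  [/\ forall u, is_derive u 1 p (p1 u), forall u, is_derive u 1 p1 (p2 u),
      continuous p2 & forall u, 0 <= u <= 1 -> [/\ `|p u| <= c, `|p1 u| <= c & `|p2 u| <= c]].

Definition cos_kernel p y := \int[lam]_(u in `[0, 1]) (p u * cos (u * y)).
Definition sin_kernel p y := \int[lam]_(u in `[0, 1]) (p u * sin (u * y)).

Lemma derive_continuous (f df : R -> R) : (forall u, is_derive u 1 f (df u)) -> continuous f.
Proof.
move=> d u; apply: differentiable_continuous; apply/derivable1_diffP.
by have := d u => ?; exact: ex_derive.
Qed.

Lemma profile_continuous c p : profile c p -> continuous p.
Proof. by move=> [p1 [p2 [d _ _ _]]]; exact: derive_continuous d. Qed.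

Lemma integrable01 (f : R -> R) : continuous f -> lam.-integrable `[0, 1] (EFin \o f).
Proof.
move=> cf; apply: continuous_compact_integrable; first exact: segment_compact.
exact: continuous_subspaceT.
Qed.

Lemma Rintegral01_le c (f : R -> R) : continuous f ->
  (forall u, 0 <= u <= 1 -> `|f u| <= c) -> `|\int[lam]_(u in `[0, 1]) f u| <= c.
Proof.
move=> cf fc; have mI : measurable (`[0, 1]%classic : set R) by exact: measurable_itv.
rewrite (le_trans (le_normr_Rintegral _ _))//; first exact: integrable01.
have -> : c = \int[lam]_(u in `[0, 1]) (cst c u).
  by rewrite Rintegral_cst//= lebesgue_measure_itv /= lte_fin ltr01 /= subr0 mulr1.
apply: le_Rintegral => //.
- by apply: integrable_norm; exact: integrable01.
- by apply: integrable01 => u; exact: cst_continuous.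
Qed.

Lemma continuous_cosM y : continuous (fun u => cos (u * y)).
Proof.
move=> u; apply: continuous_comp; first exact: mulrr_continuous.
exact: continuous_cos.
Qed.
Lemma continuous_sinM y : continuous (fun u => sin (u * y)).
Proof.
move=> u; apply: continuous_comp; first exact: mulrr_continuous.
exact: continuous_sin.
Qed.

Lemma is_derive_cosM y u : is_derive u 1 (fun u => cos (u * y)) (- (y * sin (u * y))).
Proof.
have -> : (fun u => cos (u * y)) = cos \o (fun u => u * y) by [].
have h : is_derive u 1 (fun u => u * y) y.
  by apply: is_derive_eq; rewrite /GRing.scale /= mulr0 add0r mulr1.
apply: is_derive_eq; rewrite /GRing.scale /=; ring.
Qed.
Lemma is_derive_sinM y u : is_derive u 1 (fun u => sin (u * y)) (y * cos (u * y)).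
Proof.
have -> : (fun u => sin (u * y)) = sin \o (fun u => u * y) by [].
have h : is_derive u 1 (fun u => u * y) y.
  by apply: is_derive_eq; rewrite /GRing.scale /= mulr0 add0r mulr1.
apply: is_derive_eq; rewrite /GRing.scale /=; ring.
Qed.

Lemma FTC01 (f F : R -> R) : continuous f -> (forall u, is_derive u 1 F (f u)) ->
  \int[lam]_(u in `[0, 1]) f u = F 1 - F 0.
Proof.
move=> cf dF; rewrite /Rintegral (@continuous_FTC2 R f F 0 1)//=.
- exact: continuous_subspaceT.
- have cF := derive_continuous dF; split.
  + by move=> u _; have := dF u => ?; exact: ex_derive.
  + exact/cvg_at_right_filter/cF.
  + exact/cvg_at_left_filter/cF.
- by move=> u _; rewrite derive1E; have := dF u => ?; rewrite derive_val.
Qed.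

(** Integrate by parts twice. *)
Lemma cos_kernel_sqr p p1 p2 y : (forall u, is_derive u 1 p (p1 u)) ->
  (forall u, is_derive u 1 p1 (p2 u)) -> continuous p2 -> p 1 = 0 ->
  y ^+ 2 * cos_kernel p y =
  p1 1 * cos y - p1 0 - \int[lam]_(u in `[0, 1]) (p2 u * cos (u * y)).
Proof.
move=> d1 d2 c2 p10; have cp := derive_continuous d1.
have cc := @continuous_cosM y.
have c1 : continuous (fun u => y ^+ 2 * (p u * cos (u * y))).
  by move=> u; apply: cvgMr; apply: cvgM; [exact: cp|exact: cc].
have c3 : continuous (fun u => p2 u * cos (u * y)).
  by move=> u; apply: cvgM; [exact: c2|exact: cc].
apply: (addIr (\int[lam]_(u in `[0, 1]) (p2 u * cos (u * y)))); rewrite subrK.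
rewrite /cos_kernel -RintegralZl//; last first.
  by apply: integrable01 => u; apply: cvgM; [exact: cp|exact: cc].
rewrite -RintegralD//; [|exact: integrable01|exact: integrable01].
pose F u := p u * (y * sin (u * y)) + p1 u * cos (u * y).
transitivity (F 1 - F 0); last by rewrite /F p10 !mul0r sin0 cos0 !mul1r; ring.
apply: FTC01.
- by move=> u; apply: cvgD; [exact: c1|exact: c3].
- move=> u; have := d1 u; have := d2 u; have := is_derive_cosM y u.
  have := is_derive_sinM y u => ? ? ? ?.
  by rewrite /F; apply: is_derive_eq; rewrite /GRing.scale /=; ring.
Qed.

Lemma sin_kernel_sqr p p1 p2 y : (forall u, is_derive u 1 p (p1 u)) ->
  (forall u, is_derive u 1 p1 (p2 u)) -> continuous p2 -> p 0 = 0 -> p 1 = 0 ->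
  y ^+ 2 * sin_kernel p y =
  p1 1 * sin y - \int[lam]_(u in `[0, 1]) (p2 u * sin (u * y)).
Proof.
move=> d1 d2 c2 p00 p10; have cp := derive_continuous d1.
have cc := @continuous_sinM y.
have c1 : continuous (fun u => y ^+ 2 * (p u * sin (u * y))).
  by move=> u; apply: cvgMr; apply: cvgM; [exact: cp|exact: cc].
have c3 : continuous (fun u => p2 u * sin (u * y)).
  by move=> u; apply: cvgM; [exact: c2|exact: cc].
apply: (addIr (\int[lam]_(u in `[0, 1]) (p2 u * sin (u * y)))); rewrite subrK.
rewrite /sin_kernel -RintegralZl//; last first.
  by apply: integrable01 => u; apply: cvgM; [exact: cp|exact: cc].
rewrite -RintegralD//; [|exact: integrable01|exact: integrable01].
pose F u := - (p u * (y * cos (u * y))) + p1 u * sin (u * y).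
transitivity (F 1 - F 0); last by rewrite /F p10 p00 !mul0r sin0 !mul1r; ring.
apply: FTC01.
- by move=> u; apply: cvgD; [exact: c1|exact: c3].
- move=> u; have := d1 u; have := d2 u; have := is_derive_cosM y u.
  have := is_derive_sinM y u => ? ? ? ?.
  by rewrite /F; apply: is_derive_eq; rewrite /GRing.scale /=; ring.
Qed.

Lemma profile_ge0 c p : profile c p -> 0 <= c.
Proof.
move=> [p1 [p2 [_ _ _ /(_ 0)]]]; rewrite lexx ler01 => /(_ isT)[h _ _].
exact: le_trans h.
Qed.

Lemma profileM c t p s : profile c p -> profile t s ->
  profile (4 * (c * t)) (fun u => p u * s u).
Proof.
move=> [p1 [p2 [dp dp1 cp2 pc]]] [s1 [s2 [ds ds1 cs2 sc]]].
have cp := derive_continuous dp; have cs := derive_continuous ds.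
have cp1 := derive_continuous dp1; have cs1 := derive_continuous ds1.
exists (fun u => p1 u * s u + p u * s1 u).
exists (fun u => p2 u * s u + 2 * (p1 u * s1 u) + p u * s2 u); split.
- move=> u; have := dp u; have := ds u => ? ?.
  by apply: is_derive_eq; rewrite /GRing.scale /=; ring.
- move=> u; have := dp u; have := ds u; have := dp1 u; have := ds1 u => ? ? ? ?.
  by apply: is_derive_eq; rewrite /GRing.scale /=; ring.
- move=> u; apply: cvgD; [apply: cvgD|].
  + by apply: cvgM; [exact: cp2|exact: cs].
  + by apply: cvgMr; apply: cvgM; [exact: cp1|exact: cs1].
  + by apply: cvgM; [exact: cp|exact: cs2].
move=> u u01; have [a0 a1 a2] := pc u u01; have [b0 b1 b2] := sc u u01.
have M (x y a b : R) : `|x| <= a -> `|y| <= b -> `|x * y| <= a * b.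
  by move=> xa yb; rewrite normrM ler_pM.
have ct : 0 <= c * t by apply: mulr_ge0; apply: le_trans (normr_ge0 _) _; eassumption.
split.
- by rewrite (le_trans (M _ _ _ _ a0 b0))//; lra.
- rewrite (le_trans (ler_normD _ _))//.
  by have := M _ _ _ _ a1 b0; have := M _ _ _ _ a0 b1; lra.
- rewrite (le_trans (ler_normD _ _))//.
  have h := ler_normD (p2 u * s u) (2 * (p1 u * s1 u)).
  have := M _ _ _ _ a2 b0; have := M _ _ _ _ a1 b1; have := M _ _ _ _ a0 b2.
  by move: h; rewrite (normrM 2) (ger0_norm (ler0n R 2)); lra.
Qed.

Lemma profile_cosB1 theta : `|theta| <= 1 -> profile `|theta| (fun u => cos (u * theta) - 1).
Proof.
move=> t1; exists (fun u => - (theta * sin (u * theta))).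
exists (fun u => - (theta * (theta * cos (u * theta)))); split.
- move=> u; have := is_derive_cosM theta u => ?.
  by apply: is_derive_eq; rewrite subr0.
- move=> u; have := is_derive_sinM theta u => ?.
  by apply: is_derive_eq; rewrite /GRing.scale /=; ring.
- move=> u; apply: cvgN; apply: cvgMr; apply: cvgMr; exact: continuous_cosM.
- move=> u /andP[u0 u1]; split.
  + rewrite (le_trans (_ : _ <= normc (expi (u * theta) - 1)))//.
      by have := normc_Re (expi (u * theta) - 1); rewrite ReB.
    rewrite (le_trans (normc_expi1 _))// normrM (ger0_norm u0) ler_piMl//.
  + rewrite normrN normrM ler_piMr// ler_norml sin_geN1 sin_le1//.
  + rewrite normrN !normrM ler_piMr// mulr_ile1// ler_norml cos_geN1 cos_le1//.
Qed.

Lemma profile_sin theta : `|theta| <= 1 -> profile `|theta| (fun u => sin (u * theta)).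
Proof.
move=> t1; exists (fun u => theta * cos (u * theta)).
exists (fun u => - (theta * (theta * sin (u * theta)))); split.
- by move=> u; exact: is_derive_sinM.
- move=> u; have := is_derive_cosM theta u => ?.
  by apply: is_derive_eq; rewrite /GRing.scale /=; ring.
- move=> u; apply: cvgN; apply: cvgMr; apply: cvgMr; exact: continuous_sinM.
- move=> u /andP[u0 u1]; split.
  + by rewrite (le_trans (abs_sin_le _))// normrM (ger0_norm u0) ler_piMl.
  + by rewrite normrM ler_piMr// ler_norml cos_geN1 cos_le1.
  + by rewrite normrN !normrM ler_piMr// mulr_ile1// ler_norml sin_geN1 sin_le1.
Qed.

(** Kernels whose Fourier transform is carried by a compact interval and is
    smooth enough for the kernel to be integrable.  The point of this class is
    [band_shift]: a small translation changes the kernel by a small multiple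
    of kernels of the same class. *)
Definition band c g := exists p,
  [/\ profile c p, p 0 = 0, p 1 = 0 & g = cos_kernel p \/ g = sin_kernel p].

Local Notation w y := (oneDsqr y)^-1.

Lemma le_oneDsqrV c d y (x : R) : `|x| <= c -> y ^+ 2 * `|x| <= d -> `|x| <= (c + d) * w y.
Proof.
move=> xc xd; have y0 : 0 < oneDsqr y by rewrite (lt_le_trans ltr01).
rewrite ler_pdivlMr// /oneDsqr mulrDr mulr1 lerD// mulrC//.
Qed.

Lemma cos_kernel_le c p y : profile c p -> p 1 = 0 -> `|cos_kernel p y| <= 4 * c * w y.
Proof.
move=> pp p10; have c0 := profile_ge0 pp; have cp := profile_continuous pp.
move: pp => [p1 [p2 [d1 d2 c2 pc]]].
have cc := @continuous_cosM y.
have cle (v : R) : `|cos v| <= 1 by rewrite ler_norml cos_geN1 cos_le1.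
have -> : 4 * c = c + 3 * c by ring.
apply: le_oneDsqrV.
  apply: Rintegral01_le => [u|u u01].
    by apply: cvgM; [exact: cp|exact: cc].
  by have [a _ _] := pc u u01; rewrite normrM -(mulr1 c) ler_pM.
rewrite -{1}(ger0_norm (sqr_ge0 y)) -normrM (cos_kernel_sqr y d1 d2)//.
have : `|\int[lam]_(u in `[0, 1]) (p2 u * cos (u * y))| <= c.
  apply: Rintegral01_le => [u|u u01].
    by apply: cvgM; [exact: c2|exact: cc].
  by have [_ _ a] := pc u u01; rewrite normrM -(mulr1 c) ler_pM.
have [|_ a _] := pc 0; first by rewrite lexx ler01.
have [|_ b _] := pc 1; first by rewrite lexx ler01.
have : `|p1 1 * cos y| <= c by rewrite normrM -(mulr1 c) ler_pM.
by move: a; rewrite !ler_norml => /andP[? ?] /andP[? ?] /andP[? ?]; apply/andP; split; lra.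
Qed.

Lemma sin_kernel_le c p y : profile c p -> p 0 = 0 -> p 1 = 0 ->
  `|sin_kernel p y| <= 4 * c * w y.
Proof.
move=> pp p00 p10; have c0 := profile_ge0 pp; have cp := profile_continuous pp.
move: pp => [p1 [p2 [d1 d2 c2 pc]]].
have cc := @continuous_sinM y.
have cle (v : R) : `|sin v| <= 1 by rewrite ler_norml sin_geN1 sin_le1.
have -> : 4 * c = c + 3 * c by ring.
apply: le_oneDsqrV.
  apply: Rintegral01_le => [u|u u01].
    by apply: cvgM; [exact: cp|exact: cc].
  by have [a _ _] := pc u u01; rewrite normrM -(mulr1 c) ler_pM.
rewrite -{1}(ger0_norm (sqr_ge0 y)) -normrM (sin_kernel_sqr y d1 d2)//.
have : `|\int[lam]_(u in `[0, 1]) (p2 u * sin (u * y))| <= c.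
  apply: Rintegral01_le => [u|u u01].
    by apply: cvgM; [exact: c2|exact: cc].
  by have [_ _ a] := pc u u01; rewrite normrM -(mulr1 c) ler_pM.
have [|_ b _] := pc 1; first by rewrite lexx ler01.
have : `|p1 1 * sin y| <= c by rewrite normrM -(mulr1 c) ler_pM.
by rewrite !ler_norml => /andP[? ?] /andP[? ?]; apply/andP; split; lra.
Qed.

Lemma band_le c g y : band c g -> `|g y| <= 4 * c * w y.
Proof.
by move=> [p [pp p0 p1 [->|->]]]; [exact: cos_kernel_le|exact: sin_kernel_le].
Qed.

Let measurable_kernel p (trig : R -> R) : continuous p -> continuous trig ->
  measurable_fun (setT : set (measurableTypeR R))
    (fun y => \int[lam]_(u in `[0, 1]) (p u * trig (u * y))).
Proof.
move=> cp ct; under eq_fun do rewrite Rintegral_mkcond.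
apply: (@measurable_Rintegral_param R _ _ (measurableTypeR R) (measurableTypeR R) lam
  (fun z => ((fun u => p u * trig (u * z.1)) \_ `[0, 1]) z.2)).
rewrite (_ : (fun z => _) = (fun z : measurableTypeR R * measurableTypeR R =>
    \1_(`[0, 1]%classic : set R) z.2 * (p z.2 * trig (z.2 * z.1)))).
  have m1 := @measurable_fst _ _ (measurableTypeR R) (measurableTypeR R).
  have m2 := @measurable_snd _ _ (measurableTypeR R) (measurableTypeR R).
  apply: measurable_funM; last apply: measurable_funM.
  - by apply: (measurableT_comp (measurable_indic _)).
  - by apply: (measurableT_comp (continuous_measurable_fun cp)).
  - apply: (measurableT_comp (continuous_measurable_fun ct)).
    exact: measurable_funM.
apply/funext => z; rewrite /patch indicE; case: ifP => _; rewrite ?mul1r ?mul0r//.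
Qed.

Lemma measurable_cos_kernel c p : profile c p ->
  measurable_fun (setT : set (measurableTypeR R)) (cos_kernel p).
Proof. by move=> /profile_continuous ?; apply: measurable_kernel => //; exact: continuous_cos. Qed.
Lemma measurable_sin_kernel c p : profile c p ->
  measurable_fun (setT : set (measurableTypeR R)) (sin_kernel p).
Proof. by move=> /profile_continuous ?; apply: measurable_kernel => //; exact: continuous_sin. Qed.

Lemma band_measurable c g : band c g ->
  measurable_fun (setT : set (measurableTypeR R)) g.
Proof.
move=> [p [pp _ _ [->|->]]]; first exact: measurable_cos_kernel pp.
exact: measurable_sin_kernel pp.
Qed.

Lemma cos_kernel_shift c p theta : profile c p -> p 1 = 0 -> `|theta| <= 1 ->
  exists g1 g2, [/\ band (4 * (c * `|theta|)) g1, band (4 * (c * `|theta|)) g2 &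
    forall y, cos_kernel p (y - theta) - cos_kernel p y = g1 y + g2 y].
Proof.
move=> pp p10 t1.
have pc := profileM pp (profile_cosB1 t1); have ps := profileM pp (profile_sin t1).
exists (cos_kernel (fun u => p u * (cos (u * theta) - 1))).
exists (sin_kernel (fun u => p u * sin (u * theta))); split.
- exists (fun u => p u * (cos (u * theta) - 1)); split => //; last by left.
  + by rewrite mul0r cos0 subrr mulr0.
  + by rewrite p10 mul0r.
- exists (fun u => p u * sin (u * theta)); split => //; last by right.
  + by rewrite mul0r sin0 mulr0.
  + by rewrite p10 mul0r.
move=> y.
have ip (q trig : R -> R) : continuous q -> continuous trig ->
    lam.-integrable `[0, 1] (EFin \o (fun u => q u * trig u)).
  by move=> cq ct; apply: integrable01 => u; apply: cvgM; [exact: cq|exact: ct].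
have cp := profile_continuous pp.
have cpc := profile_continuous pc; have cps := profile_continuous ps.
rewrite /cos_kernel /sin_kernel -RintegralB -?RintegralD//;
  try by apply: ip => //; (exact: continuous_cosM || exact: continuous_sinM).
by apply: eq_Rintegral => u _; rewrite mulrBr cosB; ring.
Qed.

Lemma sin_kernel_shift c p theta : profile c p -> p 0 = 0 -> p 1 = 0 -> `|theta| <= 1 ->
  exists g1 g2, [/\ band (4 * (c * `|theta|)) g1, band (4 * (c * `|theta|)) g2 &
    forall y, sin_kernel p (y - theta) - sin_kernel p y = g1 y + g2 y].
Proof.
move=> pp p00 p10 t1.
have t1' : `|- theta| <= 1 by rewrite normrN.
have pc := profileM pp (profile_cosB1 t1); have := profileM pp (profile_sin t1').
rewrite normrN => ps.
exists (sin_kernel (fun u => p u * (cos (u * theta) - 1))).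
exists (cos_kernel (fun u => p u * sin (u * - theta))); split.
- exists (fun u => p u * (cos (u * theta) - 1)); split => //; last by right.
  + by rewrite p00 mul0r.
  + by rewrite p10 mul0r.
- exists (fun u => p u * sin (u * - theta)); split => //; last by left.
  + by rewrite p00 mul0r.
  + by rewrite p10 mul0r.
move=> y.
have ip (q trig : R -> R) : continuous q -> continuous trig ->
    lam.-integrable `[0, 1] (EFin \o (fun u => q u * trig u)).
  by move=> cq ct; apply: integrable01 => u; apply: cvgM; [exact: cq|exact: ct].
have cp := profile_continuous pp.
have cpc := profile_continuous pc; have cps := profile_continuous ps.
rewrite /cos_kernel /sin_kernel -RintegralB -?RintegralD//;
  try by apply: ip => //; (exact: continuous_cosM || exact: continuous_sinM).
by apply: eq_Rintegral => u _; rewrite mulrBr sinB mulrN sinN; ring.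
Qed.

(** By the addition formulas the difference has the profiles [p u] times
    [cos (u theta) - 1] and [p u] times [sin (u theta)]; the second factors are of
    order [|theta|], with their derivatives. *)
Lemma band_shift c g theta : band c g -> `|theta| <= 1 ->
  exists g1 g2, [/\ band (4 * (c * `|theta|)) g1, band (4 * (c * `|theta|)) g2 &
    forall y, g (y - theta) - g y = g1 y + g2 y].
Proof.
by move=> [p [pp p0 p1 [->|->]]] t1; [exact: cos_kernel_shift|exact: sin_kernel_shift].
Qed.

(** The Fejer kernel: its Fourier transform is a tent on [-1, 1]. *)
Definition fejer := cos_kernel (fun u => 2 * (1 - u)).

Let is_derive_ramp u : is_derive u 1 (fun u : R => 2 * (1 - u)) (- 2).
Proof. by apply: is_derive_eq; rewrite /GRing.scale /=; ring. Qed.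

Lemma profile_ramp : profile 2 (fun u => 2 * (1 - u)).
Proof.
exists (fun=> - 2), (fun=> 0); split.
- exact: is_derive_ramp.
- by move=> u; exact: is_derive_cst.
- by move=> u; exact: cst_continuous.
- move=> u /andP[u0 u1]; rewrite normrN normr0 !ger0_norm//; first by split; lra.
  by rewrite mulr_ge0// subr_ge0.
Qed.

Lemma fejer_sqr y : y ^+ 2 * fejer y = 2 * (1 - cos y).
Proof.
transitivity (- 2 * cos y - - 2 - \int[lam]_(u in `[0, 1]) (0 * cos (u * y))).
  apply: (@cos_kernel_sqr _ (fun=> - 2) (fun=> 0)).
  - exact: is_derive_ramp.
  - by move=> u; exact: cst_continuous.
  - by rewrite subrr mulr0.
rewrite (_ : Rintegral _ _ _ = 0); first by ring.
by under eq_Rintegral do rewrite mul0r; rewrite /Rintegral integral0.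
Qed.

Lemma fejer_le y : `|fejer y| <= 8 * w y.
Proof.
have -> : 8 = 4 * 2 :> R by ring.
by apply: (cos_kernel_le _ profile_ramp); rewrite subrr mulr0.
Qed.

Lemma measurable_fejer : measurable_fun (setT : set (measurableTypeR R)) fejer.
Proof. exact: measurable_cos_kernel profile_ramp. Qed.

(** The tent does not vanish at 0, so the Fejer kernel is not in the class [band];
    but [cos (u theta) - 1] and [sin (u theta)] vanish there, so its differences are. *)
Lemma fejer_shift theta : `|theta| <= 1 ->
  exists g1 g2, [/\ band (8 * `|theta|) g1, band (8 * `|theta|) g2 &
    forall y, fejer (y - theta) - fejer y = g1 y + g2 y].
Proof.
move=> t1; have -> : 8 * `|theta| = 4 * (2 * `|theta|) by ring.
by apply: cos_kernel_shift => //; [exact: profile_ramp|rewrite subrr mulr0].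
Qed.

Lemma fejer0 : fejer 0 = 1.
Proof.
rewrite /fejer /cos_kernel.
under eq_Rintegral do rewrite mulr0 cos0 mulr1.
transitivity ((2 * 1 - 1 * 1) - (2 * 0 - 0 * 0) : R); last by ring.
apply: (@FTC01 _ (fun u : R => 2 * u - u * u)).
- by move=> u; apply: cvgMr; apply: cvgB; [exact: cst_continuous|exact: cvg_id].
- by move=> u; apply: is_derive_eq; rewrite /GRing.scale /=; ring.
Qed.

Lemma fejer_ge0 y : 0 <= fejer y.
Proof.
have [->|y0] := eqVneq y 0; first by rewrite fejer0.
have y2 : 0 < y ^+ 2 by rewrite exprn_even_gt0.
by rewrite -(pmulr_rge0 _ y2) fejer_sqr mulr_ge0// subr_ge0 cos_le1.
Qed.

End profiles.

(** * Correlation of bounded functions with integrable kernels *)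

Section correlation.
Context {R : realType}.
Local Notation lam := (@lebesgue_measure R).
Implicit Types (k f g : R -> R[i]) (C : R) (z : R[i]).

Definition bdd f C := cmeas (T := measurableTypeR R) f /\ forall x, normc (f x) <= C.

Definition corr k f x := CI lam (fun y => k y * f (x + y)).

Definition fourier k (w : R) := CI lam (fun y => k y * expi (- (w * y))).

Definition mass k := \int[lam]_x normc (k x).

Definition annihilates k f := forall x, corr k f x = 0.

Lemma cmeas_shift f (x : R) : cmeas (T := measurableTypeR R) f ->
  cmeas (T := measurableTypeR R) (fun y => f (x + y)).
Proof. by apply: cmeas_comp; exact: measurable_funD. Qed.

Lemma bdd_ge0 f C : bdd f C -> 0 <= C.
Proof. by move=> [_ /(_ 0)]; apply: le_trans; exact: normc_ge0. Qed.

Lemma bdd_shift f C x : bdd f C -> bdd (fun y => f (x + y)) C.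
Proof. by move=> [mf fC]; split => //; exact: cmeas_shift. Qed.

Lemma mass_ge0 k : 0 <= mass k.
Proof. by apply: Rintegral_ge0 => x _; exact: normc_ge0. Qed.

Lemma cintM_bdd k f C : cint lam k -> bdd f C -> cint lam (fun y => k y * f y).
Proof.
move=> ik [mf fC].
apply: (@cint_dom R _ (measurableTypeR R) lam _ (fun x => C * normc (k x))).
- by apply: cmeasM => //; exact: cint_meas ik.
- by apply: eq_integrable (integrableZl measurableT C (integrable_normc ik)).
- by move=> x; rewrite normcM mulrC ler_wpM2r// normc_ge0.
Qed.

Lemma cint_corr k f C x : cint lam k -> bdd f C -> cint lam (fun y => k y * f (x + y)).
Proof. by move=> ik /(bdd_shift x); exact: cintM_bdd. Qed.

Lemma CIM_le k f C : cint lam k -> bdd f C ->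
  normc (CI lam (fun y => k y * f y)) <= mass k * C.
Proof.
move=> ik [mf fC]; have C0 := bdd_ge0 (conj mf fC).
rewrite /mass mulrC -RintegralZl//; last exact: integrable_normc.
apply: CI_le.
- by apply: cmeasM => //; exact: cint_meas ik.
- by apply: eq_integrable (integrableZl measurableT C (integrable_normc ik)).
- by move=> y; rewrite normcM mulrC ler_wpM2r// normc_ge0.
Qed.

Lemma corr_le k f C x : cint lam k -> bdd f C -> normc (corr k f x) <= mass k * C.
Proof. by move=> ik /(bdd_shift x); exact: CIM_le. Qed.

Lemma cmeas_corr k f : cmeas (T := measurableTypeR R) k ->
  cmeas (T := measurableTypeR R) f -> cmeas (T := measurableTypeR R) (corr k f).
Proof.
move=> mk mf.
pose g (z : measurableTypeR R * measurableTypeR R) := k z.2 * f (z.1 + z.2).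
suff : cmeas g by move=> /(cmeas_CI_param lam).
apply: cmeasM.
  by apply: (cmeas_comp _ mk); exact: measurable_snd.
apply: (cmeas_comp _ mf); apply: measurable_funD.
  exact: measurable_fst.
exact: measurable_snd.
Qed.

Lemma corr_comm k1 k2 f C x : cint lam k1 -> cint lam k2 -> bdd f C ->
  corr k1 (corr k2 f) x = corr k2 (corr k1 f) x.
Proof.
move=> i1 i2 bf; have C0 := bdd_ge0 bf.
have m1 := cint_meas i1; have m2 := cint_meas i2.
pose g (z : measurableTypeR R * measurableTypeR R) := k1 z.1 * (k2 z.2 * f (x + z.1 + z.2)).
have mg : cmeas g.
  apply: cmeasM.
    by apply: (cmeas_comp _ m1); exact: measurable_fst.
  apply: cmeasM.
    by apply: (cmeas_comp _ m2); exact: measurable_snd.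
  case: bf => mf _; apply: (cmeas_comp _ mf).
  apply: measurable_funD; last exact: measurable_snd.
  by apply: measurable_funD => //; exact: measurable_fst.
have fing : (\int[lam]_a \int[lam]_b (normc (g (a, b)))%:E < +oo)%E.
  have in1 := integrable_normc i1; have in2 := integrable_normc i2.
  apply: (@le_lt_trans _ _ (\int[lam]_a ((normc (k1 a))%:E * (C * mass k2)%:E))%E); last first.
    rewrite ge0_integralZr//; last 3 first.
    - by apply/measurable_EFinP; exact: measurable_normc.
    - by move=> y _; rewrite lee_fin normc_ge0.
    - by rewrite lee_fin mulr_ge0// mass_ge0.
    apply: lte_mul_pinfty; rewrite ?ltry//.
      by apply: integral_ge0 => y _; rewrite lee_fin normc_ge0.
    by have := integrable_fin_num measurableT in1.
  apply: ge0_le_integral => //.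
  - by move=> a _; apply: integral_ge0 => b _; rewrite lee_fin normc_ge0.
  - exact: (measurable_normc_param lam mg).
  - apply: emeasurable_funM => //.
    by apply/measurable_EFinP; exact: measurable_normc.
  - move=> a _.
    have -> : ((normc (k1 a))%:E * (C * mass k2)%:E =
       \int[lam]_b ((normc (k1 a) * C)%:E * (normc (k2 b))%:E))%E.
      rewrite integralZl// -[in RHS](fineK (integrable_fin_num measurableT in2)).
      by rewrite -!EFinM mulrA.
    apply: ge0_le_integral => //.
    - by move=> b _; rewrite lee_fin normc_ge0.
    - apply/measurable_EFinP/measurable_normc.
      apply: (cmeas_comp _ mg); exact: measurable_pair1.
    - by apply: emeasurable_funM => //; apply/measurable_EFinP; exact: measurable_normc.
    - move=> b _; rewrite -EFinM lee_fin /g !normcM -mulrA ler_wpM2l ?normc_ge0//.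
      by rewrite mulrC ler_wpM2r ?normc_ge0//; case: bf.
have [_ _ e] := cfubini mg fing.
transitivity (CI lam (fun a => CI lam (fun b => g (a, b)))).
  by apply: eq_CI => a; rewrite /g -(CIZ (k1 a) (cint_corr (x + a) i2 bf)).
rewrite e; apply: eq_CI => b; rewrite /corr -(CIZ (k2 b) (cint_corr (x + b) i1 bf)).
apply: eq_CI => a; rewrite /g /=.
rewrite (_ : x + a + b = x + b + a); first by rewrite mulrCA.
by rewrite -!addrA (addrC a).
Qed.

(** Correlations commute, so smoothing [f] preserves its annihilators. *)
Lemma annihilates_corr k k' f C : cint lam k -> cint lam k' -> bdd f C ->
  annihilates k f -> annihilates k (corr k' f).
Proof.
move=> ik ik' bf kf x; rewrite (corr_comm _ ik ik' bf) {1}/corr.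
by under eq_CI do rewrite kf mulr0; rewrite CI0.
Qed.

Lemma corrD k k' f C x : cint lam k -> cint lam k' -> bdd f C ->
  corr (fun y => k y + k' y) f x = corr k f x + corr k' f x.
Proof.
move=> ik ik' bf; rewrite /corr -CID; [|exact: cint_corr ik bf|exact: cint_corr ik' bf].
by apply: eq_CI => y; rewrite mulrDl.
Qed.

Lemma corrZ k f C z x : cint lam k -> bdd f C ->
  corr (fun y => z * k y) f x = z * corr k f x.
Proof.
move=> ik bf; rewrite /corr -CIZ; last exact: cint_corr ik bf.
by apply: eq_CI => y; rewrite mulrA.
Qed.

Lemma corrB k k' f C x : cint lam k -> cint lam k' -> bdd f C ->
  corr (fun y => k y - k' y) f x = corr k f x - corr k' f x.
Proof.
move=> ik ik' bf; rewrite /corr -CIB; [|exact: cint_corr ik bf|exact: cint_corr ik' bf].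
by apply: eq_CI => y; rewrite mulrBl.
Qed.

Lemma corr_sum (I : Type) (r : seq I) (K : I -> R -> R[i]) f C x :
  (forall i, cint lam (K i)) -> bdd f C ->
  corr (fun y => \sum_(i <- r) K i y) f x = \sum_(i <- r) corr (K i) f x.
Proof.
move=> iK bf; rewrite /corr -CI_sum; last by move=> i; exact: cint_corr (iK i) bf.
by apply: eq_CI => y; rewrite mulr_suml.
Qed.

Lemma corrBr k f g C C' x : cint lam k -> bdd f C -> bdd g C' ->
  corr k (fun y => f y - g y) x = corr k f x - corr k g x.
Proof.
move=> ik bf bg; rewrite /corr -CIB; [|exact: cint_corr ik bf|exact: cint_corr ik bg].
by apply: eq_CI => y; rewrite mulrBr.
Qed.

Lemma corr_shift k f a x : cmeas (T := measurableTypeR R) k ->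
  cmeas (T := measurableTypeR R) f -> corr (fun y => k (y - a)) f x = corr k f (x + a).
Proof.
move=> mk mf; rewrite /corr -(CI_shift (- a) (f := fun y => k y * f (x + a + y))).
  by apply: eq_CI => y; rewrite (addrC (- a)) -(addrA x) (addrC a) subrK.
by apply: cmeasM => //; exact: cmeas_shift.
Qed.

Definition modulate (w : R) f x := expi (w * x) * f x.

Lemma cmeas_expi (w : R) : cmeas (T := measurableTypeR R) (fun x => expi (w * x)).
Proof.
split => /=; apply: (@measurableT_comp _ _ _ _ _ _ _ _ (fun x : measurableTypeR R => w * x)).
- exact: (continuous_measurable_fun (@continuous_cos R)).
- exact: measurable_funM.
- exact: (continuous_measurable_fun (@continuous_sin R)).
- exact: measurable_funM.
Qed.

Lemma bdd_expi (w : R) : bdd (fun x => expi (w * x)) 1.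
Proof. by split; [exact: cmeas_expi|move=> x; rewrite normc_expi]. Qed.

Lemma bdd_modulate w f C : bdd f C -> bdd (modulate w f) C.
Proof.
move=> [mf fC]; split; first by apply: cmeasM => //; exact: cmeas_expi.
by move=> x; rewrite normcM normc_expi mul1r.
Qed.

Lemma cint_modulate w k : cint lam k -> cint lam (modulate w k).
Proof.
move=> ik; have := cintM_bdd ik (bdd_expi w).
by under eq_fun do rewrite mulrC.
Qed.

Lemma mass_modulate w k : mass (modulate w k) = mass k.
Proof. by apply: eq_Rintegral => x _; rewrite normcM normc_expi mul1r. Qed.

Lemma corr_modulate w k f C x : cint lam k -> bdd f C ->
  corr (modulate (- w) k) (modulate w f) x = expi (w * x) * corr k f x.
Proof.
move=> ik bf; rewrite /corr -CIZ; last exact: cint_corr ik bf.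
apply: eq_CI => y; rewrite /modulate mulrDr expiD mulNr.
by rewrite -[RHS]mul1r -(expiNK (w * y)); ring.
Qed.

Lemma fourierE k w : fourier k w = CI lam (modulate (- w) k).
Proof. by apply: eq_CI => y; rewrite /modulate mulNr mulrC. Qed.

Lemma fourier_modulate v k w : fourier (modulate v k) w = fourier k (w - v).
Proof.
apply: eq_CI => y; rewrite /modulate [in RHS]mulrBl opprB expiD.
by ring.
Qed.

Lemma corr_expi k w x : cint lam k ->
  corr k (fun y => expi (- (w * y))) x = expi (- (w * x)) * fourier k w.
Proof.
move=> ik; rewrite /fourier -CIZ; last first.
  have := cintM_bdd ik (bdd_expi (- w)).
  by under eq_fun do rewrite mulNr.
by apply: eq_CI => y; rewrite mulrDr opprD expiD; ring.
Qed.

(** The indicator is written as a factor so that all integrals run over the line. *)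
Definition tail k (A : R) := \int[lam]_(x in setT) (normc (k x) * ((A < `|x : R|)%R)%:R).

Lemma integrable_tail k (A : R) : cint lam k ->
  lam.-integrable setT (EFin \o (fun x => normc (k x) * ((A < `|x : R|)%R)%:R)).
Proof.
move=> ik; apply: le_integrable (integrable_normc ik) => //.
  apply/measurable_EFinP; apply: measurable_funM.
    exact: measurable_normc (cint_meas ik).
  rewrite (_ : (fun x => _) = \1_[set x : R | A < `|x|]).
    apply: measurable_indic; rewrite -[X in measurable X]setTI.
    by apply: measurable_fun_ltr => //; exact: measurableT_comp.
  by apply/funext => x; rewrite indicE; congr ((nat_of_bool _)%:R); apply/idP/idP; rewrite inE.
move=> x _ /=; rewrite lee_fin normrM normr_nat ler_piMr// lern1 leq_b1//.
Qed.

Lemma tail_small k (e : R) : cint lam k -> 0 < e -> exists2 A, 0 < A & tail k A <= e.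
Proof.
move=> ik e0.
have ik' : cint lam (fun x => (normc (k x))%:C).
  split => /=; first exact: integrable_normc.
  exact: integrable0.
have := @CI_dct _ _ _ lam (fun n x => (normc (k x) * ((n%:R < `|x : R|)%R)%:R)%:C) (fun=> 0)
  (fun x => normc (k x)).
case.
- move=> n; apply: cmeas_real.
  by have /measurable_int/measurable_EFinP := integrable_tail n%:R ik.
- exact: cmeas_cst.
- exact: integrable_normc.
- move=> n x; rewrite normc_real normrM normr_nat (ger0_norm (normc_ge0 _)).
  by rewrite ler_piMr ?normc_ge0// lern1 leq_b1.
- move=> x; split => /=; last exact: cvg_cst.
  apply: cvg_near_cst; near=> n; apply/eqP.
  rewrite ltNge (_ : _ <= _) ?mulr0//.
  by near: n; exact: nbhs_infty_ger.
rewrite CI0 /= => t0 _.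
move/cvgrPdist_le : t0 => /(_ e e0)[N _ hN].
have {hN} h := hN N (leqnn N).
exists N.+1%:R => //.
move: h; rewrite sub0r normrN ger0_norm; last first.
  by apply: Rintegral_ge0 => x _; rewrite mulr_ge0 ?normc_ge0.
apply: le_trans; apply: le_Rintegral => //; try exact: integrable_tail.
move=> x _; rewrite ler_wpM2l ?normc_ge0//.
case: ltP => // Nx; rewrite ler_nat; case: ltP => //.
by rewrite leNgt (lt_trans _ Nx)// ltr_nat.
Unshelve. all: by end_near. Qed.

(** Split the integral at [A]: this is how all smallness statements about
    integrals against an integrable kernel are obtained. *)
Lemma CIM_split k f (A D : R) C : cint lam k -> bdd f C -> 0 <= D ->
  (forall y, `|y| <= A -> normc (f y) <= D) ->
  normc (CI lam (fun y => k y * f y)) <= mass k * D + C * tail k A.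
Proof.
move=> ik [mf fC] D0 fD; have C0 := bdd_ge0 (conj mf fC).
have i1 := integrable_normc ik; have i2 := integrable_tail A ik.
have i1' : lam.-integrable setT (EFin \o (fun x => D * normc (k x))).
  by apply: eq_integrable (integrableZl measurableT D i1).
have i2' : lam.-integrable setT (EFin \o (fun x => C * (normc (k x) * ((A < `|x : R|)%R)%:R))).
  by apply: eq_integrable (integrableZl measurableT C i2).
rewrite mulrC /mass /tail -!RintegralZl// -RintegralD//.
apply: CI_le.
- by apply: cmeasM => //; exact: cint_meas ik.
- by apply: eq_integrable (integrableD measurableT i1' i2').
move=> y; rewrite normcM; have k0 := normc_ge0 (k y).
case: ltP => yA; last first.
  by rewrite mulr0 mulr0 addr0 mulrC ler_wpM2r// fD.
rewrite mulr1 ler_wpDl ?mulr_ge0//.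
by rewrite mulrC ler_wpM2r.
Qed.

(** Continuity of the Fourier transform, in the only form used: the size is at
    least half of its value on a neighbourhood. *)
Lemma fourier_near k w : cint lam k -> fourier k w != 0 ->
  exists2 d, 0 < d & forall v, `|v - w| <= d ->
    normc (fourier k w) / 2 <= normc (fourier k v).
Proof.
move=> ik kw; set c := normc (fourier k w).
have c0 : 0 < c by rewrite lt_neqAle normc_ge0 andbT eq_sym; apply: contra_neq kw; exact: normc_eq0.
have [A A0 tA] : exists2 A, 0 < A & tail k A <= c / 8.
  by apply: tail_small => //; rewrite divr_gt0.
have M0 : 0 < mass k + 1 by rewrite ltr_wpDl// mass_ge0.
exists (c / (4 * A * (mass k + 1))); first by rewrite !(divr_gt0, mulr_gt0).
move=> v vw.
have : normc (fourier k w - fourier k v) <= c / 2.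
  pose f y := expi (- (w * y)) - expi (- (v * y)).
  have bf : bdd f 2.
    split.
      by apply: cmeasB; [have := cmeas_expi (- w)|have := cmeas_expi (- v)];
        under eq_fun do rewrite mulNr.
    by move=> x; rewrite (le_trans (normcB _ _))// !normc_expi.
  have -> : fourier k w - fourier k v = CI lam (fun y => k y * f y).
    rewrite /fourier -CIB; first by apply: eq_CI => y; rewrite /f; ring.
      have := cintM_bdd ik (bdd_expi (- w)).
      by under eq_fun do rewrite mulNr.
    have := cintM_bdd ik (bdd_expi (- v)).
    by under eq_fun do rewrite mulNr.
  have fA y : `|y| <= A -> normc (f y) <= c / (4 * (mass k + 1)).
    move=> yA.
    have -> : f y = expi (- (v * y)) * (expi ((v - w) * y) - 1).
      by rewrite /f mulrBr mulr1 -expiD; congr (expi _ - _); ring.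
    rewrite normcM normc_expi mul1r (le_trans (normc_expi1 _))// normrM.
    rewrite (le_trans (ler_pM _ _ vw yA))//.
    rewrite le_eqVlt; apply/orP; left; apply/eqP; field.
    by rewrite !gt_eqF.
  rewrite (le_trans (CIM_split ik bf _ fA))//.
    by rewrite divr_ge0 ?mulr_ge0// ltW.
  have : mass k * (c / (4 * (mass k + 1))) <= c / 4.
    have -> : mass k * (c / (4 * (mass k + 1))) = c / 4 * (mass k / (mass k + 1)).
      by field; rewrite gt_eqF.
    rewrite ler_piMr// ?divr_ge0// ?(ltW c0)//.
    by rewrite ler_pdivrMr// mul1r lerDl.
  by lra.
have := normcD (fourier k w - fourier k v) (fourier k v); rewrite subrK -/c.
by lra.
Qed.

End correlation.

(** * Local vanishing near a frequency where an annihilator does not vanish *)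

Section local_vanishing.
Context {R : realType}.
Local Notation lam := (@lebesgue_measure R).
Implicit Types (k f F : R -> R[i]) (g : R -> R) (C c eta : R).

Definition witch_mass := \int[lam]_x (@oneDsqr R x)^-1.

Let measurable_witch : measurable_fun (setT : set (measurableTypeR R)) (fun x : R => (oneDsqr x)^-1).
Proof. by apply: continuous_measurable_fun; exact: continuous_oneDsqrV. Qed.

Let witch_ge0 x : 0 <= (@oneDsqr R x)^-1.
Proof. by rewrite invr_ge0 (le_trans ler01). Qed.

Lemma integrable_witch : lam.-integrable setT (EFin \o (fun x : R => (oneDsqr x)^-1)).
Proof.
apply/integrableP; split; first exact/measurable_EFinP.
under eq_integral do rewrite /= ger0_norm//.
rewrite (@ge0_symfun_integralT R (fun x => (oneDsqr x)^-1))//.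
- by rewrite -set_itvcy integral0y_oneDsqr -EFinM ltry.
- exact: continuous_oneDsqrV.
- by move=> x; rewrite /oneDsqr /= sqrrN.
Qed.

Definition dilate eta g (y : R) : R[i] := (eta * g (eta * y))%:C.

Section dilate.
Variables (c eta : R) (g : R -> R).
Hypotheses (eta0 : 0 < eta) (mg : measurable_fun (setT : set (measurableTypeR R)) g).
Hypothesis gc : forall y, `|g y| <= c * (oneDsqr y)^-1.

Let integrable_g : lam.-integrable setT (EFin \o g).
Proof.
have := integrableZl measurableT c integrable_witch.
apply: le_integrable => //; first exact/measurable_EFinP.
by move=> x _ /=; rewrite lee_fin (le_trans (gc x)) ?ler_norm.
Qed.

Lemma cint_dilate : cint lam (dilate eta g).
Proof.
split; last exact: integrable0.
have := integrableZl measurableT eta (integrable_scale eta0 integrable_g).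
by apply: eq_integrable.
Qed.

Lemma mass_dilate : mass (dilate eta g) <= c * witch_mass.
Proof.
have ig := integrable_norm integrable_g.
rewrite /mass (_ : Rintegral _ _ _ = \int[lam]_x (eta * `|g (eta * x)|)); last first.
  by apply: eq_Rintegral => x _; rewrite /dilate normc_real normrM gtr0_norm.
rewrite (Rintegral_scale (f := fun x => `|g x|) eta0 ig).
rewrite /witch_mass -RintegralZl//; last exact: integrable_witch.
apply: le_Rintegral => //.
by apply: eq_integrable (integrableZl measurableT c integrable_witch).
Qed.

End dilate.

Lemma witch_mass_ge0 : 0 <= witch_mass.
Proof. exact: Rintegral_ge0. Qed.

Section band_dilate.
Variables (c eta : R) (g : R -> R).
Hypotheses (eta0 : 0 < eta) (bg : band c g).

Lemma cint_band : cint lam (dilate eta g).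
Proof.
apply: (@cint_dilate (4 * c)) => //; first exact: band_measurable bg.
by move=> y; exact: band_le.
Qed.

Lemma corr_band_le f C x : bdd f C ->
  normc (corr (dilate eta g) f x) <= 4 * c * witch_mass * C.
Proof.
move=> bf; rewrite (le_trans (corr_le _ cint_band bf))// ler_wpM2r ?(bdd_ge0 bf)//.
by apply: mass_dilate => //; [exact: band_measurable bg|move=> y; exact: band_le].
Qed.

End band_dilate.

Section fejer_dilate.
Variables (eta : R).
Hypothesis (eta0 : 0 < eta).

Lemma cint_fejer : cint lam (dilate eta fejer).
Proof.
by apply: (@cint_dilate 8) => //; [exact: measurable_fejer|exact: fejer_le].
Qed.

Lemma corr_fejer_le f C x : bdd f C ->
  normc (corr (dilate eta fejer) f x) <= 8 * witch_mass * C.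
Proof.
move=> bf; rewrite (le_trans (corr_le _ cint_fejer bf))// ler_wpM2r ?(bdd_ge0 bf)//.
by apply: mass_dilate => //; [exact: measurable_fejer|exact: fejer_le].
Qed.

End fejer_dilate.

Let corr_dilate_shift (g g1 g2 : R -> R) eta f C x z : 0 < eta ->
  cint lam (dilate eta g) -> cint lam (dilate eta g1) -> cint lam (dilate eta g2) ->
  bdd f C -> (forall y, g (y - eta * z) - g y = g1 y + g2 y) ->
  corr (dilate eta g) f (x + z) - corr (dilate eta g) f x =
  corr (dilate eta g1) f x + corr (dilate eta g2) f x.
Proof.
move=> e0 ig i1 i2 bf gE.
have mg := cint_meas ig; case: (bf) => mf _.
rewrite -corr_shift// -(corrD x i1 i2 bf).
have igz : cint lam (fun y => dilate eta g (y - z)).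
  have := cint_shift (- z) ig.
  by under eq_fun do rewrite addrC.
rewrite -(corrB x igz ig bf); apply: eq_CI => y; congr (_ * _).
rewrite /dilate -!rmorphB -rmorphD /=; congr (_ %:C).
by rewrite -mulrBr -mulrDr (mulrBr eta y z) gE.
Qed.

Lemma corr_band_shift c g eta f C x z : 0 < eta -> band c g -> bdd f C ->
  `|eta * z| <= 1 -> exists g1 g2,
  [/\ band (4 * (c * `|eta * z|)) g1, band (4 * (c * `|eta * z|)) g2 &
   corr (dilate eta g) f (x + z) - corr (dilate eta g) f x =
   corr (dilate eta g1) f x + corr (dilate eta g2) f x].
Proof.
move=> e0 bg bf z1; have [g1 [g2 [b1 b2 gE]]] := band_shift bg z1.
exists g1, g2; split => //.
by apply: corr_dilate_shift bf gE => //; apply: cint_band => //; eassumption.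
Qed.

Lemma corr_fejer_shift eta f C x z : 0 < eta -> bdd f C ->
  `|eta * z| <= 1 -> exists g1 g2,
  [/\ band (8 * `|eta * z|) g1, band (8 * `|eta * z|) g2 &
   corr (dilate eta fejer) f (x + z) - corr (dilate eta fejer) f x =
   corr (dilate eta g1) f x + corr (dilate eta g2) f x].
Proof.
move=> e0 bf z1; have [g1 [g2 [b1 b2 gE]]] := fejer_shift z1.
exists g1, g2; split => //.
apply: corr_dilate_shift bf gE => //; first exact: cint_fejer.
  exact: cint_band b1.
exact: cint_band b2.
Qed.

Lemma corr_fejer_lip eta f C x z : 0 < eta -> bdd f C -> `|eta * z| <= 1 ->
  normc (corr (dilate eta fejer) f (x + z) - corr (dilate eta fejer) f x) <=
  64 * witch_mass * C * `|eta * z|.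
Proof.
move=> e0 bf z1; have [g1 [g2 [b1 b2 ->]]] := corr_fejer_shift x e0 bf z1.
rewrite (le_trans (normcD _ _))//.
have := corr_band_le e0 b1 x bf; have := corr_band_le e0 b2 x bf; lra.
Qed.

(** If [k] annihilates [F], the mean of [F] against [k] is zero, hence [F] times
    the integral of [k] is controlled by the oscillation of [F]. *)
Lemma annihilated_le k F (A B D : R) x : cint lam k -> bdd F B ->
  annihilates k F -> 0 <= D ->
  (forall y z, `|z| <= A -> normc (F (y + z) - F y) <= D) ->
  normc (CI lam k) * normc (F x) <= mass k * D + 2 * B * tail k A.
Proof.
move=> ik bF kF D0 FD; case: (bF) => mF FB.
rewrite -normcM.
have -> : CI lam k * F x = CI lam (fun y => k y * (F x - F (x + y))).
  rewrite mulrC -CIZ// -[LHS]subr0 -(kF x) /corr -CIB.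
  - by apply: eq_CI => y; ring.
  - exact: cintZ.
  - exact: cint_corr ik bF.
apply: CIM_split => //.
- split; first by apply: cmeasB; [exact: cmeas_cst|exact: cmeas_shift].
  move=> y; rewrite (le_trans (normcB _ _))//.
  by have := FB x; have := FB (x + y); lra.
- by move=> y yA; rewrite -normcN opprB FD.
Qed.

Let geometric_le0 (a C' q : R) : 0 <= q < 1 -> (forall n, a <= C' * q ^+ n) -> a <= 0.
Proof.
move=> /andP[q0 q1] h.
have c : C' * q ^+ n @[n --> \oo] --> (C' * 0 : R).
  by apply: cvgMr; apply: cvg_expr; rewrite ger0_norm.
rewrite mulr0 in c.
by apply: (cvgr_to_ge c); exact: nearW.
Qed.

Section contraction.
Variables (k f : R -> R[i]) (C A eta : R).
Hypotheses (ik : cint lam k) (bf : bdd f C) (kf : annihilates k f).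
Let c0 := normc (CI lam k).
Hypotheses (c0_gt0 : 0 < c0) (A0 : 0 < A) (tA : tail k A <= c0 / 8).
Hypotheses (eta0 : 0 < eta) (etaA : eta * A <= 1) (etaAM : 16 * (eta * A) * mass k <= c0).

Let smallz z : `|z| <= A -> `|eta * z| <= eta * A.
Proof. by move=> zA; rewrite normrM gtr0_norm// ler_pM2l. Qed.

(** Small translations multiply the size of the kernel by [8 eta A], so that
    [annihilated_le] improves any bound valid on the whole class by 3/4. *)
Let band_contract n : forall c g, band c g -> forall x,
  normc (corr (dilate eta g) f x) <= 4 * c * witch_mass * C * (3 / 4) ^+ n.
Proof.
have C0 := bdd_ge0 bf; have W0 := witch_mass_ge0.
elim: n => [c g bg x|n ih c g bg x]; first by rewrite expr0 mulr1 corr_band_le.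
set q := (3 / 4) ^+ n in ih *.
have c_ge0 : 0 <= c by case: bg => p [/profile_ge0].
have q0 : 0 <= q by rewrite exprn_ge0.
have ig := cint_band eta0 bg.
pose B := 4 * c * witch_mass * C * q.
have B0 : 0 <= B by rewrite /B !mulr_ge0.
have := @annihilated_le k (corr (dilate eta g) f) A B (8 * (eta * A) * B) x ik.
have bF : bdd (corr (dilate eta g) f) B.
  split; last by move=> y; exact: ih.
  by apply: cmeas_corr; [exact: cint_meas ig|case: bf].
move=> /(_ bF (annihilates_corr ik ig bf kf)).
have D0 : 0 <= 8 * (eta * A) * B by rewrite !mulr_ge0// ltW.
move=> /(_ D0).
have FD y z : `|z| <= A ->
    normc (corr (dilate eta g) f (y + z) - corr (dilate eta g) f y) <= 8 * (eta * A) * B.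
  move=> zA; have z1 : `|eta * z| <= 1 by rewrite (le_trans (smallz zA)).
  have [g1 [g2 [b1 b2 ->]]] := corr_band_shift y eta0 bg bf z1.
  rewrite (le_trans (normcD _ _))//.
  have h1 := ih _ _ b1 y; have h2 := ih _ _ b2 y.
  rewrite (le_trans (lerD h1 h2))//.
  have -> : 4 * (4 * (c * `|eta * z|)) * witch_mass * C * q +
     4 * (4 * (c * `|eta * z|)) * witch_mass * C * q = 8 * `|eta * z| * B.
    by rewrite /B; ring.
  by rewrite ler_wpM2r// ler_wpM2l// smallz.
move=> /(_ FD); rewrite -/c0 => h.
rewrite exprS -/q -(ler_pM2l c0_gt0) (le_trans h)//.
have -> : c0 * (4 * c * witch_mass * C * (3 / 4 * q)) = c0 * 3 / 4 * B by rewrite /B; ring.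
have h1 : mass k * (8 * (eta * A) * B) <= c0 / 2 * B.
  have -> : mass k * (8 * (eta * A) * B) = 16 * (eta * A) * mass k / 2 * B by field.
  by apply: ler_wpM2r => //; rewrite ler_pM2r.
have h2 : 2 * B * tail k A <= 2 * B * (c0 / 8) by apply: ler_wpM2l => //; rewrite mulr_ge0.
by rewrite (le_trans (lerD h1 h2))//; lra.
Qed.

Let band_zero c g x : band c g -> corr (dilate eta g) f x = 0.
Proof.
move=> bg; apply: normc_eq0; apply/eqP; rewrite eq_le normc_ge0 andbT.
apply: (@geometric_le0 _ (4 * c * witch_mass * C) (3 / 4)); first lra.
by move=> n; exact: band_contract bg x.
Qed.

(** The contraction is run twice.  Once all kernels of the class [band] give zero,
    the Fejer means are invariant under small translations, and then only the tail of
    [k] remains in [annihilated_le]. *)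
Lemma fejer_zero x : corr (dilate eta fejer) f x = 0.
Proof.
have C0 := bdd_ge0 bf; have W0 := witch_mass_ge0.
apply: normc_eq0; apply/eqP; rewrite eq_le normc_ge0 andbT.
apply: (@geometric_le0 _ (8 * witch_mass * C) (1 / 4)); first lra.
move=> n; elim: n x => [x|n ih x]; first by rewrite expr0 mulr1 corr_fejer_le.
set q := (1 / 4) ^+ n in ih *.
have q0 : 0 <= q by rewrite exprn_ge0// divr_ge0.
have iT := cint_fejer eta0.
pose B := 8 * witch_mass * C * q.
have B0 : 0 <= B by rewrite /B !mulr_ge0.
have := @annihilated_le k (corr (dilate eta fejer) f) A B 0 x ik.
have bF : bdd (corr (dilate eta fejer) f) B.
  split; last by move=> y; exact: ih.
  by apply: cmeas_corr; [exact: cint_meas iT|case: bf].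
move=> /(_ bF (annihilates_corr ik iT bf kf) (lexx 0)).
have FD y z : `|z| <= A ->
    normc (corr (dilate eta fejer) f (y + z) - corr (dilate eta fejer) f y) <= 0.
  move=> zA; have z1 : `|eta * z| <= 1 by rewrite (le_trans (smallz zA)).
  have [g1 [g2 [b1 b2 ->]]] := corr_fejer_shift y eta0 bf z1.
  by rewrite (band_zero _ b1) (band_zero _ b2) addr0 normc0.
move=> /(_ FD); rewrite -/c0 mulr0 add0r => h.
rewrite exprS -/q -(ler_pM2l c0_gt0) (le_trans h)//.
rewrite (le_trans (ler_wpM2l _ tA)) ?mulr_ge0//.
have -> : c0 * (8 * witch_mass * C * (1 / 4 * q)) = c0 / 4 * B by rewrite /B; ring.
lra.
Qed.

End contraction.

(** A frequency outside the spectrum of [f]. *)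
Definition regular f (w : R) := exists k, [/\ cint lam k, annihilates k f & fourier k w != 0].

Lemma tail_modulate v k A : tail (modulate v k) A = tail k A.
Proof. by apply: eq_Rintegral => x _; rewrite normcM normc_expi mul1r. Qed.

(** After a modulation the frequency is 0, where the transform of [k] is its
    integral.  The scale [d] depends on [k] alone, and nearby frequencies are treated
    by the same scale; this uniformity is what [regular_vanish_segment] needs. *)
Lemma regular_vanish f C w : bdd f C -> regular f w ->
  exists2 d, 0 < d & forall v, `|v - w| <= d -> forall eta, 0 < eta <= d ->
    forall x, corr (dilate eta fejer) (modulate v f) x = 0.
Proof.
move=> bf [k [ik kf kw]].
have [d d0 kd] := fourier_near ik kw.
pose c := normc (fourier k w) / 2.
have c0 : 0 < c.
  rewrite divr_gt0// lt_neqAle normc_ge0 andbT eq_sym.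
  by apply: contra_neq kw; exact: normc_eq0.
have [A A0 tA] : exists2 A, 0 < A & tail k A <= c / 8 by apply: tail_small => //; lra.
have M0 := mass_ge0 k.
have M1 : 0 < 16 * (mass k + c) by rewrite mulr_gt0// ltr_wpDl.
(* [k] is essentially carried by [-A, A]; the translation formula wants [eta * A <= 1]
   and the contraction wants [eta * A] small against [c / mass k], where the added
   [c] keeps the denominator positive. *)
pose d' := Num.min d (Num.min A^-1 (c / (16 * (mass k + c) * A))).
exists d'.
  by rewrite !lt_min d0 invr_gt0 A0 /= divr_gt0// mulr_gt0.
move=> v vw eta /andP[eta0 etad] x.
have {}etad : [/\ eta <= d, eta <= A^-1 & eta <= c / (16 * (mass k + c) * A)].
  by move: etad; rewrite !le_min => /and3P[].
case: etad => _ eA eM.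
have vw' : `|v - w| <= d by rewrite (le_trans vw)// ge_min lexx.
have cv := kd v vw'; rewrite -/c in cv.
have ikv := cint_modulate (- v) ik.
have bv := bdd_modulate v bf.
have e1 : eta * A <= 1 by rewrite -ler_pdivlMr// mul1r.
apply: (@fejer_zero (modulate (- v) k) (modulate v f) C A eta) => //.
- by move=> y; rewrite (corr_modulate _ _ ik bf) kf mulr0.
- by rewrite -fourierE (lt_le_trans c0).
- by rewrite tail_modulate -fourierE (le_trans tA)// ler_wpM2r.
- rewrite mass_modulate -fourierE (le_trans _ cv)//.
  move: eM; rewrite ler_pdivlMr; last exact: mulr_gt0. move=> eM.
  apply: le_trans eM.
  have -> : 16 * (eta * A) * mass k = eta * (16 * mass k * A) by ring.
  by rewrite ler_pM2l// ler_pM2r// ler_pM2l// lerDl ltW.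
Qed.

(** Compactness makes the scale of [regular_vanish] uniform on a segment. *)
Lemma regular_vanish_segment f C (a b : R) : bdd f C ->
  (forall w, a <= w <= b -> regular f w) ->
  exists2 d, 0 < d & forall v, a <= v <= b -> forall eta, 0 < eta < d ->
    forall x, corr (dilate eta fejer) (modulate v f) x = 0.
Proof.
move=> bf reg.
have [cnc _] := compact_near_coveringP `[a, b]%classic.
have := cnc (@segment_compact R a b).
move=> /(_ R (0:R)^'+ (fun eta v => forall x, corr (dilate eta fejer) (modulate v f) x = 0)).
case.
  move=> w /=; rewrite in_itv /= => wab.
  have [d d0 h] := regular_vanish bf (reg w wab).
  exists ([set v | `|v - w| < d], [set eta | 0 < eta < d]).
    split => /=.
      by exists d => // v /=; rewrite distrC.
    near=> eta; apply/andP; split; first by near: eta; exact: nbhs_right_gt.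
    by near: eta; exact: nbhs_right_lt.
  move=> [v eta] /= [vw /andP[eta0 etad]]; apply: h; first exact: ltW.
  by rewrite eta0 ltW.
move=> e /= e0 h; exists e => // v vab eta /andP[eta0 etae]; apply: (h eta) => //.
by rewrite /= sub0r normrN gtr0_norm.
Unshelve. all: by end_near. Qed.

End local_vanishing.

(** * Bounded functions with finite spectrum *)

Section finite_spectrum.
Context {R : realType}.
Local Notation lam := (@lebesgue_measure R).
Implicit Types (k f : R -> R[i]) (C eta : R).

Lemma realC_eq0 (a : R) : (a%:C == 0 :> R[i]) = (a == 0).
Proof. by apply/eqP/eqP => [[]|->]. Qed.

Lemma ccvg_unique (u : nat -> R[i]) (l l' : R[i]) : ccvg u l -> ccvg u l' -> l = l'.
Proof.
move=> [r i] [r' i']; apply: eqC.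
  exact: (cvg_unique (@Rhausdorff R) r r').
exact: (cvg_unique (@Rhausdorff R) i i').
Qed.

Lemma ccvg_cst (l : R[i]) : ccvg (fun=> l) l.
Proof. by split; exact: cvg_cst. Qed.

Let cc (d : nat) : R := if d is 0%N then 1 else 2.

Let dirichlet_cos (N : nat) (t : R) :
  (1 - cos t) * (\sum_(d < N.+1) cc d * cos (d%:R * t)) = cos (N%:R * t) - cos (N.+1%:R * t).
Proof.
elim: N => [|N ih].
  by rewrite big_ord_recr big_ord0 /= add0r !mul0r cos0 mul1r mulr1 mul1r.
rewrite big_ord_recr /= mulrDr ih.
have -> : N%:R * t = N.+1%:R * t - t by rewrite -natr1; ring.
have -> : N.+2%:R * t = N.+1%:R * t + t by rewrite -natr1; ring.
by rewrite cosB cosD; ring.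
Qed.

Let fejer_cos (N : nat) (t : R) :
  1 - cos (N%:R * t) = (1 - cos t) * (\sum_(d < N) (N%:R - d%:R) * cc d * cos (d%:R * t)).
Proof.
elim: N => [|N ih]; first by rewrite big_ord0 mul0r cos0 subrr mulr0.
have -> : \sum_(d < N.+1) (N.+1%:R - d%:R) * cc d * cos (d%:R * t) =
    \sum_(d < N) (N%:R - d%:R) * cc d * cos (d%:R * t) +
    \sum_(d < N.+1) cc d * cos (d%:R * t).
  rewrite !big_ord_recr /= addrA -big_split /=; congr (_ + _).
    by apply: eq_bigr => d _; rewrite -natr1; ring.
  by rewrite -natr1; ring.
by rewrite mulrDr -ih dirichlet_cos; ring.
Qed.

Let fejer_cos0 (N : nat) : \sum_(d < N) (N%:R - d%:R) * cc d = N%:R ^+ 2.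
Proof.
have cc_sum M : \sum_(d < M.+1) cc d = 2 * M%:R + 1.
  elim: M => [|M ih]; first by rewrite big_ord_recr big_ord0 /= add0r mulr0 add0r.
  by rewrite big_ord_recr /= ih -natr1; ring.
elim: N => [|N ih]; first by rewrite big_ord0 expr0n.
have -> : \sum_(d < N.+1) (N.+1%:R - d%:R) * cc d =
    \sum_(d < N) (N%:R - d%:R) * cc d + \sum_(d < N.+1) cc d.
  rewrite !big_ord_recr /= addrA -big_split /=; congr (_ + _).
    by apply: eq_bigr => d _; rewrite -natr1; ring.
  by rewrite -natr1; ring.
by rewrite ih cc_sum -natr1; ring.
Qed.

(** A tent is a piecewise linear combination of small tents. *)
Lemma dilate_fejer_sum (N : nat) eta y : (0 < N)%N -> 0 < eta ->
  N%:R%:C * dilate (N%:R * eta) fejer y = \sum_(d < N)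
    ((N%:R - d%:R) * cc d)%:C * ((cos (d%:R * eta * y))%:C * dilate eta fejer y).
Proof.
move=> N0 e0; have N0' : N%:R != 0 :> R by rewrite pnatr_eq0 -lt0n.
have -> : \sum_(d < N) ((N%:R - d%:R) * cc d)%:C *
      ((cos (d%:R * eta * y))%:C * dilate eta fejer y) =
    ((\sum_(d < N) (N%:R - d%:R) * cc d * cos (d%:R * (eta * y))) * (eta * fejer (eta * y)))%:C.
  rewrite mulr_suml rmorph_sum /=; apply: eq_bigr => d _.
  by rewrite /dilate -!rmorphM /=; congr (_ %:C); rewrite !mulrA.
rewrite /dilate -rmorphM /=; congr (_ %:C).
have [->|y0] := eqVneq y 0.
  rewrite !mulr0; under eq_bigr do rewrite mulr0 cos0 mulr1.
  by rewrite fejer_cos0; ring.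
have ey0 : eta * y != 0 by rewrite mulf_neq0// gt_eqF.
have div_sqr (a b t : R) : t != 0 -> t ^+ 2 * a = b -> a = b / t ^+ 2.
  by move=> t0 <-; rewrite mulrAC mulfV ?mul1r// sqrf_eq0.
have e1 := div_sqr _ _ _ ey0 (fejer_sqr (eta * y)).
have Ney0 : N%:R * eta * y != 0 by rewrite -mulrA mulf_neq0.
have e2 := div_sqr _ _ _ Ney0 (fejer_sqr (N%:R * eta * y)).
have e3 := fejer_cos N (eta * y); rewrite (mulrA N%:R) in e3.
rewrite e1 e2 e3; set S := \sum_(d < N) _; field.
by rewrite N0' y0 gt_eqF.
Qed.

Let cos_fejer eta (v y : R) : (cos (v * y))%:C * dilate eta fejer y =
  2^-1%:C * (modulate v (dilate eta fejer) y + modulate (- v) (dilate eta fejer) y) :> R[i].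
Proof.
rewrite /modulate -mulrDl mulrA mulNr; congr (_ * _).
by apply: eqC; rewrite !ReImE /= ?cosN ?sinN; field.
Qed.

Let cint_cos_fejer eta (v : R) : 0 < eta ->
  cint lam (fun y => (cos (v * y))%:C * dilate eta fejer y).
Proof.
move=> e0; under eq_fun do rewrite cos_fejer.
by apply: cintZ; apply: cintD; apply: cint_modulate; exact: cint_fejer.
Qed.

Let corr_cos_fejer eta (v : R) f C x : 0 < eta -> bdd f C ->
  corr (dilate eta fejer) (modulate v f) x = 0 ->
  corr (dilate eta fejer) (modulate (- v) f) x = 0 ->
  corr (fun y => (cos (v * y))%:C * dilate eta fejer y) f x = 0.
Proof.
move=> e0 bf v1 v2; have iT := cint_fejer e0.
have key w : corr (modulate w (dilate eta fejer)) f x =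
    expi (- (w * x)) * corr (dilate eta fejer) (modulate w f) x.
  rewrite /corr -CIZ; last exact: cint_corr iT (bdd_modulate w bf).
  apply: eq_CI => y; rewrite /modulate mulrDr expiD.
  by rewrite -[LHS]mul1r -(expiNK (w * x)); ring.
rewrite (_ : corr _ _ _ = 2^-1%:C * (corr (modulate v (dilate eta fejer)) f x +
    corr (modulate (- v) (dilate eta fejer)) f x)).
  by rewrite !key v1 v2 !mulr0 addr0 mulr0.
have i1 := cint_modulate v iT; have i2 := cint_modulate (- v) iT.
rewrite -(corrD x i1 i2 bf) -(corrZ _ x (cintD i1 i2) bf).
by apply: eq_CI => y; rewrite cos_fejer.
Qed.

Let corr_fejer_sum (N : nat) eta f C x : (0 < N)%N -> 0 < eta -> bdd f C ->
  N%:R%:C * corr (dilate (N%:R * eta) fejer) f x = \sum_(d < N)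
  ((N%:R - d%:R) * cc d)%:C * corr (fun y => (cos (d%:R * eta * y))%:C * dilate eta fejer y) f x.
Proof.
move=> N0 e0 bf; have eN : 0 < N%:R * eta by rewrite mulr_gt0// ltr0n.
rewrite -(corrZ _ _ (cint_fejer eN) bf).
rewrite (_ : corr _ _ _ = corr (fun y => \sum_(d < N) ((N%:R - d%:R) * cc d)%:C *
   ((cos (d%:R * eta * y))%:C * dilate eta fejer y)) f x); last first.
  by apply: eq_CI => y; rewrite dilate_fejer_sum.
rewrite (corr_sum _ _ _ bf); last by move=> d; apply: cintZ; exact: cint_cos_fejer.
by apply: eq_bigr => d _; rewrite (corrZ _ _ (cint_cos_fejer _ e0) bf).
Qed.

Lemma fejer_mass_gt0 : 0 < \int[lam]_x (@fejer R x).
Proof.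
have iT := cint_fejer (@ltr01 R).
have [i1 _] := iT; have {}i1 : lam.-integrable setT (EFin \o @fejer R).
  by apply: eq_integrable i1 => // x _; rewrite /dilate /= !mul1r.
have T1 x : `|x| <= 1 -> 1 / 2 <= @fejer R x.
  move=> x1; rewrite /fejer /cos_kernel.
  have c2 : continuous (fun u : R => 2 * (1 - u)).
    by move=> u; apply: cvgMr; apply: cvgB; [exact: cst_continuous|exact: cvg_id].
  have -> : 1 / 2 = \int[lam]_(u in `[0, 1]) (2 * (1 - u) * (1 / 2)) :> R.
    rewrite RintegralZr//; last exact: integrable01.
    rewrite (_ : Rintegral _ _ _ = 1) ?mul1r//.
    transitivity (@fejer R 0); last exact: fejer0.
    by apply: eq_Rintegral => u _; rewrite mulr0 cos0 mulr1.
  apply: le_Rintegral => //.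
  - by apply: integrable01 => u; apply: cvgM; [exact: c2|exact: cvg_cst].
  - by apply: integrable01 => u; apply: cvgM; [exact: c2|exact: continuous_cosM].
  - move=> u; rewrite /= in_itv /= => /andP[u0 u1].
    apply: ler_wpM2l; first by rewrite mulr_ge0// subr_ge0.
    have ux : `|u * x| <= 1 by rewrite normrM mulr_ile1// ger0_norm.
    have h := abs_sin_le (u * x / 2).
    have -> : cos (u * x) = 1 - 2 * sin (u * x / 2) ^+ 2.
      have {1}-> : u * x = u * x / 2 + u * x / 2 by rewrite -splitr.
      rewrite cosD.
      have -> : cos (u * x / 2) * cos (u * x / 2) = 1 - sin (u * x / 2) ^+ 2.
        by apply: (addIr (sin (u * x / 2) ^+ 2)); rewrite subrK -expr2 cos2Dsin2.
      by ring.
    have : `|sin (u * x / 2)| <= 1 / 2.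
      by rewrite (le_trans h)// normrM (ger0_norm (_ : 0 <= 2^-1))// ler_pM2r.
    by rewrite ler_norml => /andP[? ?]; nra.
apply: (@lt_le_trans _ _ (\int[lam]_x (1 / 2 * \1_(`[- 1, 1]%classic : set R) x))).
  rewrite RintegralZl//; last first.
    by apply: integrable_indic_itv.
  rewrite (_ : Rintegral _ _ _ = 2); first by lra.
  rewrite /Rintegral integral_indic//= setIT lebesgue_measure_itv /= lte_fin.
  by rewrite ifT /=; lra.
apply: le_Rintegral => //.
- by apply: eq_integrable (integrableZl measurableT (1 / 2)
    (@integrable_indic_itv R (- 1) 1 true false)).
- move=> x _; rewrite indicE; have [|_] := boolP (x \in (`[- 1, 1]%classic : set R)); last by rewrite mulr0 fejer_ge0.
  rewrite inE /= in_itv /= mulr1 => x1; apply: T1; by rewrite ler_norml.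
Qed.

Lemma CI_fejer eta : 0 < eta -> CI lam (dilate eta fejer) = (\int[lam]_x (@fejer R x))%:C.
Proof.
move=> e0; have [i1 _] := cint_fejer (@ltr01 R).
have {}i1 : lam.-integrable setT (EFin \o @fejer R).
  by apply: eq_integrable i1 => // x _; rewrite /dilate /= !mul1r.
apply: eqC => /=; first exact: (Rintegral_scale e0 i1).
by rewrite /Rintegral integral0.
Qed.

(** A bounded continuous function with empty spectrum vanishes: all its
    Fejer means are zero. *)
Lemma empty_spectrum f C x : bdd f C -> continuous (fun y => Re (f y)) ->
  continuous (fun y => Im (f y)) -> (forall w, regular f w) -> f x = 0.
Proof.
move=> bf cre cim reg; case: (bf) => mf fC.
have zero (B : R) y : 0 < B -> corr (dilate B fejer) f y = 0.
  move=> B0.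
  have [d d0 hd] := @regular_vanish_segment R f C (- B) B bf (fun w _ => reg w).
  pose N := (Num.bound (B / d)).+1.
  have N0 : 0 < N%:R :> R by rewrite ltr0n.
  pose eta := B / N%:R; have e0 : 0 < eta by rewrite divr_gt0.
  have ed : eta < d.
    rewrite /eta ltr_pdivrMr// -ltr_pdivrMl// mulrC.
    apply: (@lt_trans _ _ (Num.bound (B / d))%:R); last by rewrite ltr_nat.
    by rewrite archi_boundP// divr_ge0 ?ltW.
  have BE : B = N%:R * eta by rewrite /eta [RHS]mulrC divfK// gt_eqF.
  apply: (mulfI (_ : N%:R%:C != 0 :> R[i])).
    by rewrite realC_eq0 gt_eqF.
  rewrite mulr0 {1}BE (corr_fejer_sum y _ e0 bf)//.
  rewrite big1// => i _.
  have iB : 0 <= i%:R * eta <= B.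
    rewrite mulr_ge0 ?(ltW e0)//= BE ler_pM2r// ler_nat ltnW//.
  rewrite (@corr_cos_fejer _ _ _ C)// ?mulr0//.
  - by apply: hd; [|rewrite e0]; lra.
  - by apply: hd; [|rewrite e0]; lra.
have iT := cint_fejer (@ltr01 R).
pose F (n : nat) y := dilate 1 fejer y * f (x + n.+1%:R^-1 * y).
have F0 n : CI lam (F n) = 0.
  have n0 : 0 < n.+1%:R :> R by rewrite ltr0n.
  rewrite -(zero n.+1%:R x n0) -(CI_scale (f := F n) n0).
    apply: eq_CI => y; rewrite /F /dilate !mul1r mulKf ?gt_eqF// rmorphM /=.
    by rewrite mulrA.
  have := cintM_bdd iT (_ : bdd (fun y => f (x + n.+1%:R^-1 * y)) C); apply.
  split => //; apply: (cmeas_comp _ mf); exact: measurable_funD.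
have inT := integrable_normc iT.
have lim : ccvg (fun n => CI lam (F n)) (CI lam (fun y => dilate 1 fejer y * f x)).
  apply: (@CI_dct R _ (measurableTypeR R) lam F (fun y => dilate 1 fejer y * f x)
    (fun y => C * normc (dilate 1 fejer y))).
  - move=> n; apply: cmeasM; first exact: cint_meas iT.
    apply: (cmeas_comp _ mf); exact: measurable_funD.
  - by apply: cmeasM; [exact: cint_meas iT|exact: cmeas_cst].
  - by apply: eq_integrable (integrableZl measurableT C inT).
  - by move=> n y; rewrite normcM mulrC ler_wpM2r// normc_ge0.
  - move=> y.
    have c : x + n.+1%:R^-1 * y @[n --> \oo] --> x.
      rewrite -[X in _ --> X]addr0; apply: cvgD; first exact: cvg_cst.
      by rewrite -[X in _ --> X](mul0r y); apply: cvgM; [exact: cvg_harmonic|exact: cvg_cst].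
    have c1 : Re (f (x + n.+1%:R^-1 * y)) @[n --> \oo] --> Re (f x).
      exact: (cvg_comp _ _ c (cre x)).
    have c2 : Im (f (x + n.+1%:R^-1 * y)) @[n --> \oo] --> Im (f x).
      exact: (cvg_comp _ _ c (cim x)).
    split; rewrite /F; under eq_fun do rewrite !ReImE; rewrite !ReImE.
      by apply: cvgB; apply: cvgMr.
    by apply: cvgD; apply: cvgMr.
have e : CI lam (fun y => dilate 1 fejer y * f x) = 0.
  apply: ccvg_unique lim _; rewrite (_ : (fun n => _) = fun=> 0); first exact: ccvg_cst.
  by apply/funext => n; exact: F0.
move: e; under eq_CI do rewrite mulrC.
rewrite CIZ// CI_fejer// => /eqP; rewrite mulf_eq0 => /orP[/eqP//|].
by rewrite realC_eq0 gt_eqF// fejer_mass_gt0.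
Qed.

Let weights (m : nat) : (1 < m)%N ->
  normc ((m%:R - 1) * 2 / m%:R)%:C <= 2 :> R /\ normc ((2 - m%:R) / m%:R)%:C <= 1 :> R.
Proof.
move=> m1; have m0 : 0 < m%:R :> R by rewrite ltr0n ltnW.
have m2 : 2 <= m%:R :> R by rewrite ler_nat.
have p : 0 <= (m%:R - 1) * 2 / m%:R :> R by apply: divr_ge0; [lra|exact: ltW].
rewrite !normc_real (ger0_norm p); split; first by rewrite ler_pdivrMr//; lra.
rewrite normrM normfV (gtr0_norm m0) ler_pdivrMr// mul1r.
by rewrite ler_norml; apply/andP; split; lra.
Qed.

(** Near an isolated point of the spectrum, here 0, the Fejer mean at a small
    scale is a combination of means at arbitrarily smaller scales, which
    oscillate arbitrarily slowly; hence it is constant. *)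
Lemma isolated_spectrum f C (d x : R) : bdd f C -> 0 < d ->
  (forall w, 0 < `|w| <= d -> regular f w) ->
  corr (dilate d fejer) f x = corr (dilate d fejer) f 0.
Proof.
move=> bf d0 reg.
have C0 := bdd_ge0 bf.
pose G e := corr (dilate e fejer) f.
have refine (m : nat) y : (1 < m)%N ->
    G d y = ((m%:R - 1) * 2 / m%:R)%:C * G (2 * (d / m%:R)) y + ((2 - m%:R) / m%:R)%:C * G (d / m%:R) y.
  move=> m1; have m0 : 0 < m%:R :> R by rewrite ltr0n ltnW.
  have dm0 : 0 < d / m%:R by rewrite divr_gt0.
  have [|d1 d10 h1] := @regular_vanish_segment R f C (d / m%:R) d bf.
    move=> w /andP[w1 w2]; apply: reg; have w0 : 0 < w by exact: lt_le_trans w1.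
    by rewrite gtr0_norm// w0.
  have [|d2 d20 h2] := @regular_vanish_segment R f C (- d) (- (d / m%:R)) bf.
    move=> w /andP[w1 w2]; apply: reg; have w0 : w < 0 by rewrite (le_lt_trans w2)// oppr_lt0.
    by rewrite ltr0_norm// oppr_gt0 w0 lerNl.
  pose e := Num.min d1 d2; have e0 : 0 < e by rewrite lt_min d10.
  pose J := (Num.bound (d / m%:R / e)).+1.
  have J0 : 0 < J%:R :> R by rewrite ltr0n.
  pose eta := d / m%:R / J%:R; have eta0 : 0 < eta by rewrite divr_gt0.
  have etae : eta < e.
    rewrite /eta ltr_pdivrMr// -ltr_pdivrMl// mulrC.
    apply: (@lt_trans _ _ (Num.bound (d / m%:R / e))%:R); last by rewrite ltr_nat.
    by rewrite archi_boundP// divr_ge0 ?ltW.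
  have {etae} [etad1 etad2] : eta < d1 /\ eta < d2 by move: etae; rewrite lt_min => /andP[].
  pose Q (i : nat) := (cc i)%:C * corr (fun y => (cos (i%:R * eta * y))%:C * dilate eta fejer y) f y.
  have Q0 (i : nat) : (J <= i < m * J)%N -> Q i = 0.
    move=> /andP[Ji im].
    have iB : d / m%:R <= i%:R * eta <= d.
      have JE : d / m%:R = J%:R * eta by rewrite /eta [RHS]mulrC divfK// gt_eqF.
      rewrite {1}JE ler_pM2r// ler_nat Ji /=.
      have -> : d = (m * J)%:R * eta by rewrite natrM -mulrA -JE mulrC divfK// gt_eqF.
      by rewrite ler_pM2r// ler_nat ltnW.
    rewrite /Q (@corr_cos_fejer _ _ _ C)// ?mulr0//.
    - by apply: h1; [|rewrite eta0].
    - by apply: h2; [|rewrite eta0]; rewrite // !lerN2 andbC.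
  have sumQ (N : nat) : (J <= N)%N -> (N <= m * J)%N ->
      N%:R%:C * G (N%:R * eta) y = \sum_(i < J) (N%:R - i%:R)%:C * Q i.
    move=> JN NmJ; rewrite /G (corr_fejer_sum y _ eta0 bf); last exact: leq_trans JN.
    rewrite -(big_mkord xpredT (fun d => ((N%:R - d%:R) * cc d)%:C *
       corr (fun y => (cos (d%:R * eta * y))%:C * dilate eta fejer y) f y)).
    rewrite (big_cat_nat _ JN)//= [X in _ + X]big1_seq ?addr0.
      rewrite big_mkord; apply: eq_bigr => i _.
      by rewrite /Q rmorphM /= mulrA.
    move=> i /=; rewrite mem_index_iota => /andP[Ji iN].
    have := Q0 i; rewrite Ji (leq_trans iN)// => /(_ isT); rewrite /Q rmorphM /= -mulrA => ->.
    by rewrite mulr0.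
  have Jm : (J <= m * J)%N by rewrite leq_pmull// ltnW.
  have J2 : (2 * J <= m * J)%N by rewrite leq_mul2r m1 orbT.
  have s1 := sumQ (m * J)%N Jm (leqnn _).
  have s2 := sumQ (2 * J)%N (leq_pmull J (isT : 0 < 2)%N) J2.
  have s3 := sumQ J (leqnn J) Jm.
  have JE : d / m%:R = J%:R * eta by rewrite /eta [RHS]mulrC divfK// gt_eqF.
  have E1 : (m * J)%:R * eta = d by rewrite natrM -mulrA -JE mulrC divfK// gt_eqF.
  have E2 : (2 * J)%:R * eta = 2 * (d / m%:R) by rewrite natrM -mulrA -JE.
  rewrite E1 in s1; rewrite E2 in s2; rewrite -JE in s3.
  have mJ0 : (m%:R * J%:R)%:C != 0 :> R[i] by rewrite realC_eq0 mulf_neq0 ?gt_eqF.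
  apply: (mulfI mJ0); rewrite -natrM s1.
  transitivity ((m%:R - 1)%:C * ((2 * J)%:R%:C * G (2 * (d / m%:R)) y) +
     (2 - m%:R)%:C * (J%:R%:C * G (d / m%:R) y)).
    rewrite s2 s3 !mulr_sumr -big_split /=; apply: eq_bigr => i _.
    rewrite !mulrA -mulrDl -!rmorphM -rmorphD /=; congr (_ %:C * _).
    by rewrite !natrM; ring.
  have aux (a b c e' : R) z : a * b = c * e' -> a%:C * (b%:C * z) = c%:C * (e'%:C * z) :> R[i].
    by move=> h; rewrite !mulrA -!rmorphM /= h.
  rewrite mulrDr; congr (_ + _); apply: aux; rewrite natrM; field; rewrite gt_eqF//.
have comb (a b g1 g2 h1 h2 : R[i]) (A B e1 e2 : R) : normc a <= A -> normc b <= B ->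
    normc (g1 - h1) <= e1 -> normc (g2 - h2) <= e2 ->
    normc (a * g1 + b * g2 - (a * h1 + b * h2)) <= A * e1 + B * e2.
  move=> aA bB e1P e2P.
  have -> : a * g1 + b * g2 - (a * h1 + b * h2) = a * (g1 - h1) + b * (g2 - h2) by ring.
  by rewrite (le_trans (normcD _ _))// !normcM lerD// ler_pM// normc_ge0.
have total (L' d' m' : R) : m' != 0 ->
    2 * (L' * (2 * (d' / m'))) + 1 * (L' * (d' / m')) = 5 * L' * d' / m'.
  by move=> m0; field.
pose L := 64 * @witch_mass R * C * `|x|.
have L0 : 0 <= L by rewrite /L !mulr_ge0// witch_mass_ge0.
have lip e : 0 < e -> e * `|x| <= 1 -> normc (G e x - G e 0) <= L * e.
  move=> e0 ex; have := @corr_fejer_lip R e f C 0 x e0 bf.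
  by rewrite add0r normrM gtr0_norm// => /(_ ex); rewrite /L; lra.
apply/eqP; rewrite -subr_eq0; apply/eqP/normc_eq0/eqP; rewrite eq_le normc_ge0 andbT.
have bound (m : nat) : (1 < m)%N -> 2 * d * `|x| <= m%:R -> normc (G d x - G d 0) <= 5 * L * d / m%:R.
  move=> m1 mx; have m0 : 0 < m%:R :> R by rewrite ltr0n ltnW.
  have dm0 : 0 < d / m%:R by rewrite divr_gt0.
  have l1 : normc (G (2 * (d / m%:R)) x - G (2 * (d / m%:R)) 0) <= L * (2 * (d / m%:R)).
    apply: lip; first by rewrite mulr_gt0.
    have -> : 2 * (d / m%:R) * `|x| = 2 * d * `|x| / m%:R by ring.
    by rewrite ler_pdivrMr// mul1r.
  have l2 : normc (G (d / m%:R) x - G (d / m%:R) 0) <= L * (d / m%:R).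
    apply: lip => //.
    have -> : d / m%:R * `|x| = d * `|x| / m%:R by ring.
    rewrite ler_pdivrMr// mul1r (le_trans _ mx)// -mulrA -[leLHS]mul1r.
    by apply: ler_wpM2r; [rewrite mulr_ge0// ltW|lra].
  have [an bn] := weights m1.
  rewrite (refine m x m1) (refine m 0 m1).
  by rewrite (le_trans (comb _ _ _ _ _ _ _ _ _ _ an bn l1 l2))// total// gt_eqF.
rewrite leNgt; apply/negP => n0.
set a := normc _ in n0.
pose m := (Num.bound (2 * d * `|x|) + Num.bound (5 * L * d / a)).+2.
have m0 : 0 < m%:R :> R by rewrite ltr0n.
have := bound m isT.
have h1 : 2 * d * `|x| <= m%:R.
  rewrite (le_trans (ltW (archi_boundP _)))//; first by rewrite !mulr_ge0// ltW.
  by rewrite ler_nat; apply: leqW; apply: leqW; exact: leq_addr.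
have h2 : 5 * L * d / a < m%:R.
  rewrite (lt_le_trans (archi_boundP _))//; first by apply: divr_ge0; [apply: mulr_ge0; [exact: mulr_ge0|]|]; exact: ltW.
  by rewrite ler_nat; apply: leqW; apply: leqW; exact: leq_addl.
move=> /(_ h1); rewrite -/a ler_pdivlMr// leNgt (mulrC a).
by rewrite ltr_pdivrMr// in h2; rewrite h2.
Qed.

End finite_spectrum.

(** * Removal of isolated points of the spectrum *)

Section spectral_theorem.
Context {R : realType}.
Local Notation lam := (@lebesgue_measure R).
Implicit Types (k f : R -> R[i]) (C : R) (s : seq R).

Definition ccontinuous f := continuous (fun x => Re (f x)) /\ continuous (fun x => Im (f x)).

Lemma continuous_mulZ (w : R) : continuous (fun x : R => w * x).
Proof. by move=> x; apply: cvgMr; exact: cvg_id. Qed.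

Lemma ccontinuous_expi (w : R) : ccontinuous (fun x => expi (w * x)).
Proof.
split => x /=; apply: (@continuous_comp _ _ _ (fun x : R => w * x)).
- exact: continuous_mulZ.
- exact: continuous_cos.
- exact: continuous_mulZ.
- exact: continuous_sin.
Qed.

Lemma ccontinuousM f g : ccontinuous f -> ccontinuous g -> ccontinuous (fun x => f x * g x).
Proof.
move=> [f1 f2] [g1 g2]; split; (under eq_fun do rewrite !ReImE); move=> x.
  by apply: cvgB; apply: cvgM; [exact: f1|exact: g1|exact: f2|exact: g2].
by apply: cvgD; apply: cvgM; [exact: f1|exact: g2|exact: f2|exact: g1].
Qed.

Lemma ccontinuous_cst (z : R[i]) : ccontinuous (fun=> z).
Proof. by split => x; exact: cst_continuous. Qed.

Lemma ccontinuousD f g : ccontinuous f -> ccontinuous g -> ccontinuous (fun x => f x + g x).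
Proof.
move=> [f1 f2] [g1 g2]; split; (under eq_fun do rewrite ?ReD ?ImD); move=> x.
  by apply: cvgD; [exact: f1|exact: g1].
by apply: cvgD; [exact: f2|exact: g2].
Qed.

Lemma ccontinuousN f : ccontinuous f -> ccontinuous (fun x => - f x).
Proof.
move=> [f1 f2]; split; (under eq_fun do rewrite ?ReN ?ImN); move=> x.
  by apply: cvgN; exact: f1.
by apply: cvgN; exact: f2.
Qed.

Lemma ccontinuous_cmeas f : ccontinuous f -> cmeas (T := measurableTypeR R) f.
Proof. by move=> [f1 f2]; split; exact: continuous_measurable_fun. Qed.

(** Modulation translates the spectrum. *)
Lemma regular_modulate f C v w : bdd f C -> regular f (w + v) -> regular (modulate v f) w.
Proof.
move=> bf [k [ik kf kw]]; exists (modulate (- v) k); split.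
- exact: cint_modulate.
- by move=> x; rewrite (corr_modulate _ _ ik bf) kf mulr0.
- by rewrite fourier_modulate opprK.
Qed.

(** Replacing [k] by [k - e^{i l a} k(. - a)] kills the frequency [l] while keeping
    the frequency [w], for a suitable translation [a]. *)
Lemma regular_sub f C (l w : R) (z : R[i]) : bdd f C -> w != l -> regular f w ->
  regular (fun x => f x - z * expi (- (l * x))) w.
Proof.
move=> bf wl [k [ik kf kw]].
pose a := pi / (l - w); pose c := expi (l * a).
pose k' y := c * k (y - a).
have lw0 : l - w != 0 by rewrite subr_eq0 eq_sym.
have ika : cint lam (fun y => k (y - a)).
  by have := cint_shift (- a) ik; under eq_fun do rewrite addrC.
have ik' : cint lam k' by exact: cintZ.
have [mf fC] := bf.
have mk := cint_meas ik.
have be (v : R) : bdd (fun y => expi (- (v * y))) 1.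
  by have := bdd_expi (- v); under eq_fun do rewrite mulNr.
have fk' (v : R) : fourier k' v = expi ((l - v) * a) * fourier k v.
  rewrite /fourier /k'.
  transitivity (c * corr (fun y => k (y - a)) (fun y => expi (- (v * y))) 0).
    rewrite /corr -(CIZ c (cint_corr 0 ika (be v))).
    by apply: eq_CI => y; rewrite add0r mulrA.
  rewrite corr_shift//; last by case: (be v).
  rewrite add0r corr_expi// mulrA /c -expiD; congr (expi _ * _); ring.
exists (fun y => k y - k' y); split.
- exact: cintB.
- move=> x.
  have bze : bdd (fun y => z * expi (- (l * y))) (normc z).
    split; last by move=> y; rewrite normcM normc_expi mulr1.
    by apply: cmeasM; [exact: cmeas_cst|case: (be l)].
  rewrite (corrBr _ (cintB ik ik') bf bze).
  rewrite (corrB _ ik ik' bf) kf (corrZ _ _ ika bf) corr_shift// kf mulr0 subrr sub0r.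
  rewrite (_ : corr _ _ _ = z * corr (fun y => k y - k' y) (fun y => expi (- (l * y))) x); last first.
    rewrite /corr -(CIZ z (cint_corr x (cintB ik ik') (be l))).
    by apply: eq_CI => y; rewrite mulrCA.
  rewrite corr_expi; last exact: cintB.
  rewrite (_ : fourier _ l = fourier k l - fourier k' l); last first.
    rewrite /fourier -CIB; first by apply: eq_CI => y; rewrite mulrBl.
      exact: cintM_bdd ik (be l).
    exact: cintM_bdd ik' (be l).
  by rewrite fk' subrr mul0r expi0 mul1r subrr !mulr0 oppr0.
- rewrite (_ : fourier _ w = fourier k w - fourier k' w); last first.
    rewrite /fourier -CIB; first by apply: eq_CI => y; rewrite mulrBl.
      exact: cintM_bdd ik (be w).
    exact: cintM_bdd ik' (be w).
  rewrite fk' (_ : (l - w) * a = pi); last by rewrite /a mulrC divfK.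
  by rewrite expi_pi mulN1r opprK -mulr2n -mulr_natl mulf_neq0// pnatr_eq0.
Qed.

(** Wiener's theorem for finite spectra: points of the spectrum are removed one at
    a time. *)
Theorem finite_spectrum s f C : uniq s -> bdd f C -> ccontinuous f ->
  (forall w, w \notin s -> regular f w) ->
  exists c : R -> R[i], forall x, f x = \sum_(l <- s) c l * expi (- (l * x)).
Proof.
elim: s f C => [|l s ih] f C us bf cf reg.
  exists (fun=> 0) => x; rewrite big_nil.
  by case: cf => c1 c2; apply: (empty_spectrum x bf c1 c2) => w; exact: reg.
move: us => /= /andP[ls us].
have [d d0 sd] : exists2 d, 0 < d & forall m, m \in s -> d < `|m - l|.
  elim: s ls {us ih reg} => [|m s ih]; first by exists 1.
  rewrite in_cons negb_or => /andP[lm /ih[d d0 dP]].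
  have ml : 0 < `|m - l| / 2 by rewrite divr_gt0// normr_gt0 subr_eq0 eq_sym.
  exists (Num.min d (`|m - l| / 2)); first by rewrite lt_min d0.
  move=> n; rewrite in_cons => /predU1P[->|/dP dn].
    by rewrite gt_min; apply/orP; right; lra.
  by rewrite gt_min dn.
have bl := bdd_modulate l bf.
have iT := cint_fejer d0.
have T0 := @fejer_mass_gt0 R.
pose tau := (\int[lam]_x (@fejer R x))%:C.
have tau0 : tau != 0 by rewrite realC_eq0 gt_eqF.
(* The Fejer mean of an exponential, at its own frequency, is its coefficient times
   the mass of the kernel. *)
pose c0 := corr (dilate d fejer) (modulate l f) 0 / tau.
have const x : corr (dilate d fejer) (modulate l f) x = c0 * tau.
  rewrite /c0 divfK//; apply: (isolated_spectrum x bl d0) => w /andP[w0 wd].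
  apply: (regular_modulate bf); apply: reg; rewrite in_cons negb_or.
  rewrite -subr_eq0 addrK -normr_gt0 w0 /=; apply/negP => /sd.
  by rewrite addrK ltNge wd.
pose f1 x := f x - c0 * expi (- (l * x)).
have be (v : R) : bdd (fun y => expi (- (v * y))) 1.
  by have := bdd_expi (- v); under eq_fun do rewrite mulNr.
have bze : bdd (fun y => c0 * expi (- (l * y))) (normc c0).
  split; last by move=> y; rewrite normcM normc_expi mulr1.
  by apply: cmeasM; [exact: cmeas_cst|case: (be l)].
have bf1 : bdd f1 (C + normc c0).
  split; first by apply: cmeasB; [case: bf|case: bze].
  move=> x; rewrite (le_trans (normcB _ _))// lerD//; first by case: bf.
  by case: bze.
have cf1 : ccontinuous f1.
  apply: ccontinuousD => //; apply: ccontinuousN; apply: ccontinuousM.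
    exact: ccontinuous_cst.
  by have := ccontinuous_expi (- l); under eq_fun do rewrite mulNr.
have [c cE] : exists c : R -> R[i], forall x, f1 x = \sum_(m <- s) c m * expi (- (m * x)).
  apply: (ih f1 _ us bf1 cf1) => w ws; have [->|wl] := eqVneq w l; last first.
    apply: (regular_sub _ bf wl); apply: reg; rewrite in_cons negb_or wl//.
  exists (modulate l (dilate d fejer)); split.
  - exact: cint_modulate.
  - move=> x; apply: (mulfI (expi_neq0 (l * x))); rewrite mulr0.
    rewrite -(corr_modulate _ _ (cint_modulate l iT) bf1).
    have -> : modulate (- l) (modulate l (dilate d fejer)) = dilate d fejer.
      by apply/funext => y; rewrite /modulate mulNr mulrA expiNK mul1r.
    have -> : modulate l f1 = fun y => modulate l f y - c0.
      apply/funext => y; rewrite /modulate /f1 mulrBr mulrCA -expiD.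
      by rewrite addrN expi0 mulr1.
    have bc0 : bdd (fun=> c0) (normc c0) by split => //; exact: cmeas_cst.
    rewrite (corrBr _ iT bl bc0) const /corr.
    under [X in _ - X]eq_CI do rewrite mulrC.
    by rewrite CIZ// CI_fejer// subrr.
  - rewrite fourier_modulate subrr /fourier.
    by under eq_CI do rewrite mul0r oppr0 expi0 mulr1; rewrite CI_fejer.
exists (fun m => if m == l then c0 else c m) => x.
rewrite big_cons eqxx -[LHS](subrK (c0 * expi (- (l * x)))) -/(f1 x) cE addrC.
congr (_ + _); apply: eq_big_seq => m ms.
by case: eqP ms => // ->; rewrite (negbTE ls).
Qed.

End spectral_theorem.

(** * Proximate orders in logarithmic coordinates *)

Section log_weight.
Context {R : realType}.
Variable rho : R -> R.
Hypothesis prho : proximate_order rho.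

Let r0 := order_at_infty rho.

(** [V(e^x) = exp (r0 x + slow x)]. *)
Definition slow (x : R) := x * (rho (expR x) - order_at_infty rho).

Let order_at_inftyE : zero_proximate_order (fun r => rho r - r0).
Proof.
have [l zl] := prho; suff -> : r0 = l by [].
case: zl => c _ _ _ _; rewrite /r0 /order_at_infty.
have : rho r @[r --> +oo] --> l.
  rewrite (_ : (fun r => rho r) = (fun r => (rho r - l) + l)); last first.
    by apply/funext => r; rewrite subrK.
  rewrite -[X in _ --> X]add0r; apply: cvgD => //; exact: cvg_cst.
by move/cvg_lim; apply; exact: norm_hausdorff.
Qed.

Lemma prox_weight_exp x : prox_weight rho (expR x) = expR (r0 * x + slow x).
Proof.
rewrite /prox_weight /powR gt_eqF ?expR_gt0// expRK /slow -/r0.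
by congr expR; ring.
Qed.

Lemma slow0 : slow 0 = 0. Proof. by rewrite /slow mul0r. Qed.

Lemma slowN x : slow (- x) = slow x.
Proof.
have [->|x0] := eqVneq x 0; first by rewrite oppr0.
have [_ qV _ _ _] := order_at_inftyE.
have e1 : expR x != 1 by rewrite -expR0 (inj_eq (@expR_inj R)).
have := qV (expR x) (expR_gt0 x) e1; rewrite -expRN /slow -/r0 => ->.
by rewrite mulrNN.
Qed.

Let q r := rho r - r0.

Let is_derive_slow (x : R) : x != 0 ->
  is_derive x 1 slow (q (expR x) + expR x * x * derive1 q (expR x)).
Proof.
move=> x0; have [_ _ dq _ _] := order_at_inftyE.
have e1 : expR x != 1 by rewrite -expR0 (inj_eq (@expR_inj R)).
have [dqx _] := dq (expR x) (expR_gt0 x) e1.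
have d1 : is_derive (expR x) 1 q (derive1 q (expR x)).
  by rewrite derive1E; apply: DeriveDef.
have d2 : is_derive x 1 (q \o expR) (expR x * derive1 q (expR x)).
  have := is_derive1_comp d1 (is_derive_expR x).
  by rewrite /GRing.scale /= mulrC.
have -> : slow = (fun x => x * (q \o expR) x) by [].
by apply: is_derive_eq; rewrite /GRing.scale /=; ring.
Qed.

(** Away from [x = 0] the proximate order is differentiable; at [x = 0] this is the
    continuous extension of [r^q(r)] by 1. *)
Lemma continuous_slow : continuous slow.
Proof.
move=> x; have [->|x0] := eqVneq x 0; last first.
  apply: differentiable_continuous; apply/derivable1_diffP.
  by have := is_derive_slow x0 => ?; exact: ex_derive.
have [_ _ _ _ c1] := order_at_inftyE.
apply/continuous_withinNx; rewrite slow0.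
have ce : expR x @[x --> (0 : R)^'] --> (1 : R)^'.
  move=> A; rewrite /dnbhs /within /= => hA.
  have : \forall x \near (0 : R), expR x != 1 -> A (expR x).
    have := @continuous_expR R 0; rewrite /continuous_at expR0 => /(_ _ hA).
    by [].
  apply: filterS => y h y0; apply: h.
  by rewrite -expR0 (inj_eq (@expR_inj R)).
have c2 := cvg_comp _ _ ce c1.
have c3 := cvg_comp _ _ c2 (continuous_ln (@ltr01 R)).
rewrite ln1 in c3; apply: cvg_trans c3; apply: near_eq_cvg.
apply: nearW => y /=; rewrite /powR gt_eqF ?expR_gt0// !expRK /slow -/r0.
by rewrite mulrC.
Qed.

(** The derivative of [slow] at [x] is [q r + r ln r q'(r)] at [r = e^x], where [q] is
    the zero proximate order; both terms tend to zero. *)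
Lemma slow_near (L e : R) : 0 < e -> exists T, forall t y, T <= t -> `|y| <= L ->
  `|slow (t + y) - slow t| <= e.
Proof.
move=> e0; wlog L0 : L / 0 < L.
  have L1 : 0 < Num.max L 1 by rewrite lt_max ltr01 orbT.
  move=> h; have [T hT] := h (Num.max L 1) L1.
  by exists T => t y Tt yL; apply: hT => //; rewrite le_max yL.
have [c1 _ _ c2 _] := order_at_inftyE.
pose d := e / (2 * L); have d0 : 0 < d by rewrite divr_gt0// mulr_gt0.
move/cvgrPdist_le : c1 => /(_ d d0)[M1 [_ h1]].
move/cvgrPdist_le : c2 => /(_ d d0)[M2 [_ h2]].
pose M := Num.max 1 (Num.max M1 M2) + 1.
have M_gt : [/\ 1 < M, M1 < M & M2 < M].
  have Mlt z : z <= Num.max 1 (Num.max M1 M2) -> z < M.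
    by move=> h; rewrite (le_lt_trans h)// ltrDl.
  by split; apply: Mlt; rewrite !le_max lexx ?orbT.
exists (M + L) => t y Mt yL.
have bound z : M <= z -> `|q (expR z) + expR z * z * derive1 q (expR z)| <= e / L.
  move=> Mz; case: M_gt => M1' M2' M3'.
  have zexp : z < expR z by rewrite (lt_le_trans _ (expR_ge1Dx _))// ltrDr.
  have a1 : `|q (expR z)| <= d.
    have := h1 (expR z); rewrite /= sub0r normrN; apply.
    by rewrite (lt_trans M2')// (le_lt_trans Mz).
  have a2 : `|expR z * z * derive1 q (expR z)| <= d.
    have := h2 (expR z); rewrite /= sub0r normrN expRK; apply.
    by rewrite (lt_trans M3')// (le_lt_trans Mz).
  rewrite (le_trans (ler_normD _ _))// (le_trans (lerD a1 a2))//.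
  by rewrite /d le_eqVlt; apply/orP; left; apply/eqP; field; rewrite gt_eqF.
have key a b : M <= a -> a <= b -> `|slow b - slow a| <= e / L * (b - a).
  move=> Ma ab.
  have pos z : a <= z -> z != 0.
    by move=> az; case: M_gt => M1' _ _; rewrite gt_eqF// (lt_le_trans _ az)// (lt_le_trans _ Ma)// (lt_trans _ M1').
  have posab z : z \in `]a, b[ -> z != 0.
    by rewrite in_itv /= => /andP[/ltW az _]; exact: pos.
  have [z zab ->] := @MVT_segment R slow
      (fun z => q (expR z) + expR z * z * derive1 q (expR z)) a b ab
      (fun z zab => is_derive_slow (posab z zab))
      (continuous_subspaceT continuous_slow).
  rewrite normrM (ger0_norm (_ : 0 <= b - a)) ?subr_ge0// ler_wpM2r ?subr_ge0//.
  by apply: bound; rewrite (le_trans Ma)// (itvP zab).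
have yL' : - L <= y <= L by rewrite -ler_norml.
have eL : 0 <= e / L by rewrite divr_ge0 ?ltW.
have [y0|y0] := leP 0 y.
  rewrite (le_trans (key t (t + y) _ _))//; [lra|lra|].
  rewrite (_ : t + y - t = y); last by ring.
  rewrite (le_trans (ler_wpM2l eL (_ : y <= L)))//; first lra.
  by rewrite divfK// gt_eqF.
rewrite distrC (le_trans (key (t + y) t _ _))//; [lra|lra|].
rewrite (_ : t - (t + y) = - y); last by ring.
rewrite (le_trans (ler_wpM2l eL (_ : - y <= L)))//; first lra.
by rewrite divfK// gt_eqF.
Qed.

(** Far to the right the variation is small, far to the left it is small by
    evenness, and in between there is only a compact set. *)
Lemma slow_bounded (L : R) : exists C, forall x y, `|y| <= L -> `|slow (x + y) - slow x| <= C.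
Proof.
have [T hT] := slow_near L (@ltr01 R).
pose B := Num.max T 0 + `|L|.
have B0 : 0 <= B by rewrite addr_ge0// le_max lexx orbT.
have BB : - B <= B by lra.
have cs : {within `[- B, B], continuous (fun x => `|slow x|)}.
  apply: continuous_subspaceT => x; apply: continuous_comp; first exact: continuous_slow.
  exact: norm_continuous.
have [c _ hc] := EVT_max BB cs.
have TB : T <= Num.max T 0 by rewrite le_max lexx.
have m0 : 0 <= Num.max T 0 by rewrite le_max lexx orbT.
exists (1 + 2 * `|slow c|) => x y yL.
have L1 : L <= `|L| by exact: ler_norm.
have yL' : - L <= y <= L by rewrite -ler_norml.
have [xT|xT] := leP T x.
  by rewrite (le_trans (hT _ _ xT yL))// lerDl mulr_ge0.
have [xT'|xT'] := leP T (- x).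
  rewrite -slowN -(slowN x) opprD (le_trans (hT _ _ xT' _)) ?normrN// lerDl mulr_ge0//.
have h1 : `|slow x| <= `|slow c|.
  by apply: hc; rewrite in_itv /=; rewrite /B; apply/andP; split; lra.
have h2 : `|slow (x + y)| <= `|slow c|.
  by apply: hc; rewrite in_itv /=; rewrite /B; apply/andP; split; lra.
rewrite (le_trans (ler_normB _ _))//.
have := lerD h2 h1; lra.
Qed.

Lemma prox_gammaE y : prox_gamma rho (expR y) =
  ereal_sup [set (expR (slow (x + y) - slow x))%:E | x in setT].
Proof.
have e x : prox_weight rho (expR x * expR y) /
    (expR y `^ order_at_infty rho * prox_weight rho (expR x)) =
    expR (slow (x + y) - slow x).
  rewrite -expRD !prox_weight_exp /powR gt_eqF ?expR_gt0// expRK -/r0 -expRD -expRN -expRD.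
  by congr expR; ring.
rewrite /prox_gamma; congr ereal_sup; apply/seteqP; split => z /=.
  move=> [r]; rewrite in_itv /= andbT => rp <-; exists (ln r) => //.
  by rewrite -e lnK.
by move=> [x _ <-]; exists (expR x); rewrite ?e// in_itv /= andbT expR_gt0.
Qed.

Lemma prox_gamma_ge x y : ((expR (slow (x + y) - slow x))%:E <= prox_gamma rho (expR y))%E.
Proof. by rewrite prox_gammaE; apply: ereal_sup_ubound; exists x. Qed.

Lemma prox_gamma_fin y : prox_gamma rho (expR y) \is a fin_num.
Proof.
rewrite fin_numE; apply/andP; split.
  by rewrite gt_eqF// (lt_le_trans _ (prox_gamma_ge 0 y))// ltNyr.
rewrite lt_eqF//; have [C hC] := slow_bounded `|y|.
apply: (@le_lt_trans _ _ (expR C)%:E); last exact: ltry.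
rewrite prox_gammaE; apply: ge_ereal_sup => _ [x _ <-].
by rewrite lee_fin ler_expR (le_trans (ler_norm _))// hC.
Qed.

(** Take [x] to infinity in the supremum. *)
Lemma prox_gamma_ge1 y : (1 <= prox_gamma rho (expR y))%E.
Proof.
rewrite -(fineK (prox_gamma_fin y)) lee_fin leNgt; apply/negP => g1.
set g := fine _ in g1.
have gge x : expR (slow (x + y) - slow x) <= g.
  by rewrite -lee_fin /g fineK ?prox_gamma_fin// prox_gamma_ge.
have g0 : 0 < g by rewrite (lt_le_trans _ (gge 0))// expR_gt0.
have e0 : 0 < - ln g / 2 by rewrite divr_gt0// oppr_gt0 ln_lt0// g0.
have [T hT] := slow_near `|y| e0.
have := hT T y (lexx _) (lexx _); rewrite ler_norml => /andP[h _].
have := gge T; rewrite -ler_ln ?posrE ?expR_gt0// expRK; lra.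
Qed.

End log_weight.

(** * Measures on the half-line in logarithmic coordinates *)

Section measure_equality.
Context {R : realType}.
Variables m1 m2 : {measure set (measurableTypeR R) -> \bar R}.

(** The half-open intervals generate the Borel sets and are stable under
    intersection. *)
Lemma measure_eq_ocitv :
  (forall a b : R, m1 `]a, b]%classic = m2 `]a, b]%classic) ->
  (forall a b : R, (m1 `]a, b]%classic < +oo)%E) ->
  forall A, measurable A -> m1 A = m2 A.
Proof.
move=> m12 fin A mA.
apply: (@measure_unique _ R (measurableTypeR R) (@ocitv R)
  (fun n => `]- n%:R, n%:R]%classic)) => //.
- exact: ocitvI.
- by move=> i; exists (- i%:R, i%:R).
- apply/seteqP; split => // x _.
  exists (Num.bound `|x|).+1 => //=; rewrite in_itv /=.
  have h : `|x| < (Num.bound `|x|).+1%:R.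
    by rewrite (lt_trans (archi_boundP (normr_ge0 x)))// ltr_nat.
  by move: h; rewrite ltr_norml => /andP[-> /ltW ->].
- by move=> _ [[a b] _ <-].
Qed.

End measure_equality.

Section exponential_substitution.
Context {R : realType}.
Local Notation lam := (@lebesgue_measure R).

(** The density of [dx] seen on the half-line through [x = ln r]. *)
Let inv_pos (r : R) := if 0 < r then expR (- ln r) else 0.

Let measurable_inv_pos : measurable_fun (setT : set (measurableTypeR R)) inv_pos.
Proof.
apply: measurable_fun_ifT => //; first exact: measurable_fun_ltr.
apply: (measurableT_comp (@measurable_expR R)).
by apply: measurableT_comp => //; exact: measurable_ln.
Qed.

Let mln : measurable_fun (setT : set (measurableTypeR R)) (@ln R : measurableTypeR R -> measurableTypeR R).
Proof. exact: measurable_ln. Qed.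

Let inv_posE r : `|inv_pos r| = inv_pos r.
Proof. by rewrite ger0_norm// /inv_pos; case: ifP => // _; exact: expR_ge0. Qed.

Let ln_dens A : measurable A -> imeas mln (dens lam measurable_inv_pos) A = lam A.
Proof.
have itv a b : imeas mln (dens lam measurable_inv_pos) `]a, b]%classic = lam `]a, b]%classic.
  have [ab|ba] := ltP a b; last by rewrite set_itv_ge ?measure0// bnd_simp -leNgt.
  transitivity (\int[lam]_(x in `]expR a, expR b]) (x^-1)%:E)%E.
    rewrite [LHS]/(dens _ _ _) /dens integral_mkcond [RHS]integral_mkcond.
    apply: eq_integral => x _; rewrite /patch inv_posE /inv_pos.
    have [x0|x0] := ltP 0 x.
      have -> : (x \in @ln R @^-1` `]a, b]) = (x \in (`]expR a, expR b]%classic : set R)).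
        have e : (a < ln x <= b) = (expR a < x <= expR b).
          by rewrite -{3 4}(lnK (x0 : x \in Num.pos)) ltr_expR ler_expR.
        by apply/idP/idP; rewrite !inE /= !in_itv /= e.
      by case: ifP => // _; rewrite expRN lnK.
    case: ifP => _; case: ifP => //; rewrite inE /= in_itv /= => /andP[h _].
      by have := lt_le_trans h x0; rewrite ltNge expR_ge0.
    by have := lt_le_trans h x0; rewrite ltNge expR_ge0.
  have eab : expR a < expR b by rewrite ltr_expR.
  have pos x : expR a <= x -> 0 < x by apply: lt_le_trans; exact: expR_gt0.
  have cinv : {within `[expR a, expR b], continuous (fun x : R => x^-1)}.
    apply: continuous_in_subspaceT => x; rewrite inE /= in_itv /= => /andP[/pos x0 _].
    by apply: inv_continuous; rewrite gt_eqF.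
  rewrite integral_itv_obnd_cbnd; last first.
    apply/measurable_EFinP; apply: (@measurable_funS _ _ _ _ `[expR a, expR b]) => //.
      by move=> x /=; rewrite !in_itv /= => /andP[/ltW -> ->].
    apply: subspace_continuous_measurable_fun => //.
  rewrite (continuous_FTC2 (F := @ln R) eab cinv).
  - by rewrite !expRK lebesgue_measure_itv /= lte_fin ab.
  - split.
    + move=> x; rewrite in_itv /= => /andP[/ltW/pos x0 _].
      by have := is_derive1_ln x0 => ?; exact: ex_derive.
    + apply: cvg_at_right_filter; apply: continuous_ln; exact: expR_gt0.
    + apply: cvg_at_left_filter; apply: continuous_ln; exact: expR_gt0.
  - move=> x; rewrite in_itv /= => /andP[/ltW/pos x0 _].
    by rewrite derive1E; have := is_derive1_ln x0 => ?; rewrite derive_val.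
apply: measure_eq_ocitv => a b; first exact: itv.
by rewrite itv lebesgue_measure_itv /=; case: ifP => _; rewrite ?ltry// -EFinB ltry.
Qed.

Lemma ge0_integral_exp (f : R -> \bar R) : measurable_fun (setT : set (measurableTypeR R)) (f \o expR) ->
  (forall x, 0 <= f (expR x))%E ->
  (\int[lam]_(t in `]0%R, +oo[) f t = \int[lam]_x (f (expR x) * (expR x)%:E))%E.
Proof.
move=> mf f0.
have mfe : measurable_fun (setT : set (measurableTypeR R)) (fun x => f (expR x) * (expR x)%:E)%E.
  by apply: emeasurable_funM => //; apply/measurable_EFinP; exact: measurable_expR.
have fe0 x : (0 <= f (expR x) * (expR x)%:E)%E by rewrite mule_ge0// lee_fin expR_ge0.
rewrite -[RHS](same_integral ln_dens) (ge0_integral_pushforward mln)//.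
have mfl : measurable_fun (setT : set (measurableTypeR R))
    (fun r => f (expR (ln r)) * (expR (ln r))%:E)%E.
  exact: (measurableT_comp mfe mln).
rewrite preimage_setT (ge0_integral_dens lam measurable_inv_pos mfl)//.
rewrite [LHS]integral_mkcond; apply: eq_integral => x _; rewrite /= inv_posE /inv_pos /patch.
have -> : (x \in (`]0, +oo[%classic : set R)) = (0 < x).
  by apply/idP/idP; rewrite ?inE /= in_itv /= andbT.
case: ltP => x0; last by rewrite mule0.
by rewrite lnK// -muleA -EFinM expRN lnK// mulfV ?mule1// gt_eqF.
Qed.

Lemma integral_exp (f : R -> R) : measurable_fun (setT : set (measurableTypeR R)) (f \o expR) ->
  (\int[lam]_(t in `]0%R, +oo[) (f t)%:E = \int[lam]_x (expR x * f (expR x))%R%:E)%E.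
Proof.
move=> mf; have mEf : measurable_fun setT (EFin \o (f \o expR)) by exact/measurable_EFinP.
have mp : measurable_fun (setT : set (measurableTypeR R)) ((EFin \o f)^\+ \o expR)%E.
  rewrite (_ : _ \o _ = (EFin \o (f \o expR))^\+)%E; first exact: measurable_funepos.
  by apply/funext => x; rewrite /= !funeposE.
have mn : measurable_fun (setT : set (measurableTypeR R)) ((EFin \o f)^\- \o expR)%E.
  rewrite (_ : _ \o _ = (EFin \o (f \o expR))^\-)%E; first exact: measurable_funeneg.
  by apply/funext => x; rewrite /= !funenegE.
rewrite integralE (ge0_integral_exp mp)// (ge0_integral_exp mn)//.
rewrite [RHS]integralE; congr (_ - _)%E; apply: eq_integral => x _.
  by rewrite !funeposE -!EFin_max -EFinM maxr_pMl ?expR_ge0// mul0r mulrC.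
by rewrite !funenegE -!EFinN -!EFin_max -EFinM maxr_pMl ?expR_ge0// mul0r mulNr mulrC.
Qed.

Lemma integrable_exp (f : R -> R) : measurable_fun (setT : set (measurableTypeR R)) (f \o expR) ->
  measurable_fun (`]0, +oo[%classic : set (measurableTypeR R)) f ->
  lam.-integrable (`]0, +oo[%classic : set (measurableTypeR R)) (EFin \o f) <->
  lam.-integrable setT (EFin \o (fun x => expR x * f (expR x))).
Proof.
move=> mfe mf.
have e : (\int[lam]_(t in `]0%R, +oo[) `|(f t)%:E| = \int[lam]_x `|(expR x * f (expR x))%R%:E|)%E.
  rewrite (ge0_integral_exp (f := fun t => `|(f t)%:E|%E)).
  - by apply: eq_integral => x _; rewrite /= -EFinM normrM mulrC (ger0_norm (expR_ge0 _)).
  - by apply/measurable_EFinP; exact: measurableT_comp.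
  - by [].
split=> /integrableP[_ i]; apply/integrableP; split.
- apply/measurable_EFinP; apply: measurable_funM => //; exact: measurable_expR.
- by rewrite -e.
- exact/measurable_EFinP.
- by rewrite e.
Qed.

End exponential_substitution.

Section log_image.
Context {R : realType}.
Variable r : R.
Implicit Types (p : positive_radon R).

Let mln : measurable_fun (setT : set (measurableTypeR R)) (@ln R : measurableTypeR R -> measurableTypeR R).
Proof. exact: measurable_ln. Qed.

Let weight (y : R) := expR (- (r * y)).

Let measurable_weight : measurable_fun (setT : set (measurableTypeR R)) weight.
Proof.
apply: continuous_measurable_fun => y; apply: continuous_comp; last exact: continuous_expR.
by apply: continuousN; apply: continuousM; [exact: cst_continuous|].
Qed.

(** The image of [t^-r p(dt)] under [t = e^y]. *)
Definition tilt p : set (measurableTypeR R) -> \bar R :=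
  dens (imeas mln p) measurable_weight.
HB.instance Definition _ p := Measure.on (tilt p).

Let weight0 y : 0 <= weight y. Proof. exact: expR_ge0. Qed.

Let pos_setT p (f : R -> \bar R) : measurable_fun (setT : set (measurableTypeR R)) f ->
  (forall t, 0 <= f t)%E ->
  (\int[p]_t f t = \int[p]_(t in `]0%R, +oo[) f t)%E.
Proof.
move=> mf f0; rewrite (@ge0_negligible_integral _ _ _ p setT `]-oo, 0%R]%classic)//; last exact: pradon_support.
congr integral; rewrite setTD; apply/seteqP; split => x /=; rewrite !in_itv /= ?andbT.
  by move/negP; rewrite -ltNge.
by move=> x0; apply/negP; rewrite -ltNge.
Qed.

Lemma ge0_integral_tilt p (f : R -> \bar R) :
  measurable_fun (setT : set (measurableTypeR R)) f -> (forall t, 0 <= f t)%E ->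
  (\int[tilt p]_y f y = \int[p]_(t in `]0%R, +oo[) (f (ln t) * (weight (ln t))%:E))%E.
Proof.
move=> mf f0; rewrite /tilt ge0_integral_dens//.
have mw : measurable_fun (setT : set (measurableTypeR R)) (fun y => f y * `|weight y|%:E)%E.
  by apply: emeasurable_funM => //; apply/measurable_EFinP; exact: measurableT_comp.
have w0 y : (0 <= f y * `|weight y|%:E)%E by rewrite mule_ge0// lee_fin.
rewrite (ge0_integral_pushforward mln)// preimage_setT.
have mwl : measurable_fun (setT : set (measurableTypeR R)) (fun t => f (ln t) * `|weight (ln t)|%:E)%E.
  exact: (measurableT_comp mw mln).
rewrite pos_setT; last 2 first.
- exact: mwl.
- by move=> t; exact: w0.
by apply: eq_integral => t _ /=; rewrite ger0_norm.
Qed.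

Lemma ge0_integral_half p (f : R -> \bar R) :
  measurable_fun (setT : set (measurableTypeR R)) (f \o expR) -> (forall t, 0 <= f t)%E ->
  (\int[p]_(t in `]0%R, +oo[) f t = \int[tilt p]_y ((expR (r * y))%:E * f (expR y)))%E.
Proof.
move=> mf f0; rewrite ge0_integral_tilt//; last 2 first.
- apply: emeasurable_funM => //; apply/measurable_EFinP.
  by apply: measurableT_comp => //; exact: measurable_funM.
- by move=> t; rewrite mule_ge0// lee_fin expR_ge0.
apply: eq_integral => t; rewrite inE /= in_itv /= andbT => t0.
by rewrite muleC muleA -EFinM /weight -expRD addNr expR0 mul1e lnK.
Qed.

Lemma Rintegral_half p (f : R -> R) : measurable_fun (setT : set (measurableTypeR R)) (f \o expR) ->
  \int[p]_(t in `]0, +oo[) f t = \int[tilt p]_y (expR (r * y) * f (expR y)).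
Proof.
move=> mf; have mEf : measurable_fun setT (EFin \o (f \o expR)) by exact/measurable_EFinP.
rewrite /Rintegral; congr fine; rewrite integralE [RHS]integralE.
have mp : measurable_fun (setT : set (measurableTypeR R)) ((EFin \o f)^\+ \o expR)%E.
  rewrite (_ : _ \o _ = (EFin \o (f \o expR))^\+)%E; first exact: measurable_funepos.
  by apply/funext => x; rewrite /= !funeposE.
have mn : measurable_fun (setT : set (measurableTypeR R)) ((EFin \o f)^\- \o expR)%E.
  rewrite (_ : _ \o _ = (EFin \o (f \o expR))^\-)%E; first exact: measurable_funeneg.
  by apply/funext => x; rewrite /= !funenegE.
rewrite (ge0_integral_half _ mp)// (ge0_integral_half _ mn)//.
congr (_ - _)%E; apply: eq_integral => y _.
  by rewrite !funeposE -!EFin_max -EFinM maxr_pMr ?expR_ge0// mulr0.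
by rewrite !funenegE -!EFinN -!EFin_max -EFinM maxr_pMr ?expR_ge0// mulr0 mulrN.
Qed.

Lemma tilt_itv_le p (a b c : R) : 0 <= c -> (forall y, a <= y <= b -> expR (- (r * y)) <= c) ->
  (tilt p `[a, b]%classic <= c%:E * p `[expR a, expR b]%classic)%E.
Proof.
move=> c0 hc; have -> : tilt p `[a, b]%classic = (\int[tilt p]_y (\1_`[a, b] y)%:E)%E.
  by rewrite integral_indic// setIT.
have mab : measurable_fun (setT : set (measurableTypeR R)) (fun t => (\1_`[a, b] t)%:E : \bar R).
  exact/measurable_EFinP.
rewrite (ge0_integral_tilt p mab); last by move=> t; rewrite lee_fin.
have -> : p `[expR a, expR b]%classic = (\int[p]_t (\1_`[expR a, expR b] t)%:E)%E.
  by rewrite integral_indic// setIT.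
have mi : measurable_fun (setT : set (measurableTypeR R)) (fun t => (\1_`[expR a, expR b] t)%:E : \bar R).
  exact/measurable_EFinP.
rewrite -ge0_integralZl//.
apply: (@le_trans _ _ (\int[p]_(t in `]0%R, +oo[) (c%:E * (\1_`[expR a, expR b] t)%:E))%E).
  apply: ge0_le_integral => //.
  - by move=> t _; rewrite mule_ge0// lee_fin.
  - apply: emeasurable_funM; apply/measurable_EFinP.
      by apply: (measurable_funS measurableT) => //; apply: measurableT_comp.
    by apply: (measurable_funS measurableT) => //; apply: measurableT_comp.
  - by apply: emeasurable_funM => //; apply/measurable_EFinP.
  move=> t; rewrite /= in_itv /= andbT => t0.
  rewrite !indicE.
  have -> : (ln t \in (`[a, b]%classic : set R)) = (t \in (`[expR a, expR b]%classic : set R)).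
    have e : (a <= ln t <= b) = (expR a <= t <= expR b).
      by rewrite -{3 4}(lnK (t0 : t \in Num.pos)) !ler_expR.
    by apply/idP/idP; rewrite !inE /= !in_itv /= e.
  have [|] := boolP (t \in (`[expR a, expR b]%classic : set R)); last by rewrite mul0e mule0.
  rewrite inE /= in_itv /= => h; rewrite mul1e mule1 lee_fin; apply: hc.
  by move: h; rewrite -{1 2}(lnK (t0 : t \in Num.pos)) !ler_expR.
apply: ge0_subset_integral => //; first by apply: emeasurable_funM => //; apply/measurable_EFinP.
by move=> t _; rewrite mule_ge0// lee_fin.
Qed.

Lemma tilt_fin p (a b : R) : (tilt p `[a, b]%classic < +oo)%E.
Proof.
pose c := expR (`|r| * (`|a| + `|b|)).
apply: (@le_lt_trans _ _ (c%:E * p `[expR a, expR b]%classic)%E).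
  apply: tilt_itv_le => [|y /andP[ay yb]]; first exact: expR_ge0.
  rewrite ler_expR (le_trans (ler_norm _))// normrN normrM ler_wpM2l//.
  have := ler_norm b; have := ler_norm (- a); rewrite normrN => h1 h2.
  have a0 : 0 <= `|a| by []. have b0 : 0 <= `|b| by [].
  by rewrite ler_norml; apply/andP; split; lra.
apply: lte_mul_pinfty; rewrite ?lee_fin ?expR_ge0//.
apply: pradon_compact; first exact: segment_compact.
by move=> x /=; rewrite !in_itv /= andbT => /andP[+ _]; apply: lt_le_trans; exact: expR_gt0.
Qed.

Let tilt_sigma_finite p : sigma_finite setT (tilt p).
Proof.
exists (fun n => `[- n%:R, n%:R]%classic).
  apply/seteqP; split => // x _.
  exists (Num.bound `|x|) => //=; rewrite in_itv /=.
  have h := archi_boundP (normr_ge0 x).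
  by move: h => /ltW; rewrite ler_norml.
by move=> n; split => //; exact: tilt_fin.
Qed.

HB.instance Definition _ p := @Measure_isSigmaFinite.Build _ _ _ (tilt p) (tilt_sigma_finite p).

End log_image.

(** * Continuous approximation of Borel sets *)

Section indicator_approximation.
Context {R : realType} (I : finType).
Variable m : I -> {finite_measure set (measurableTypeR R) -> \bar R}.
Implicit Types (A : set (measurableTypeR R)) (g : R -> R).

Definition unit_continuous g := continuous g /\ forall x, 0 <= g x <= 1.

Let unit_measurable g : unit_continuous g ->
  measurable_fun (setT : set (measurableTypeR R)) g.
Proof. by move=> [cg _]; exact: continuous_measurable_fun. Qed.

Let dist j A g := \int[m j]_x `|\1_A x - g x|.

Let approximable A := measurable A /\ forall e : R, 0 < e ->
  exists2 g, unit_continuous g & forall j, dist j A g <= e.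

Let bounded_integrable j (f : R -> R) (C : R) :
  measurable_fun (setT : set (measurableTypeR R)) f -> (forall x, `|f x| <= C) ->
  (m j).-integrable setT (EFin \o f).
Proof.
move=> mf fC; have ic : (m j).-integrable setT (fun=> C%:E) by exact: finite_measure_integrable_cst.
apply: (le_integrable measurableT _ _ ic) => //; first exact/measurable_EFinP.
by move=> x _ /=; rewrite lee_fin (le_trans (fC x))// ler_norm.
Qed.

Let indic01 A x : 0 <= (\1_A x : R) <= 1.
Proof. by rewrite indicE; case: (x \in A); rewrite /= ?ler01 ?lexx. Qed.

Let diff_le1 (a b : R) : 0 <= a <= 1 -> 0 <= b <= 1 -> `|a - b| <= 1.
Proof. by move=> /andP[? ?] /andP[? ?]; rewrite ler_norml; apply/andP; split; lra. Qed.

Let integrable_dist j A g : measurable A -> unit_continuous g ->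
  (m j).-integrable setT (EFin \o (fun x => `|\1_A x - g x|)).
Proof.
move=> mA ug; apply: (@bounded_integrable j _ 1).
  by apply: measurableT_comp => //; apply: measurable_funB; [exact: measurable_indic|exact: unit_measurable].
by move=> x; rewrite normr_id; apply: diff_le1; [exact: indic01|exact: ug.2].
Qed.

Let approximableT : approximable setT.
Proof.
split=> // e e0; exists (fun=> 1); first by split; [exact: cst_continuous|move=> x; rewrite ler01 lexx].
move=> j; rewrite /dist; under eq_Rintegral do rewrite indicT subrr normr0.
by rewrite /Rintegral integral0 /= ltW.
Qed.

Let approximableD : setSD_closed approximable.
Proof.
move=> A B BA [mA hA] [mB hB]; split; first exact: measurableD.
move=> e e0; have e2 : 0 < e / 2 by rewrite divr_gt0.
have [g ug hg] := hA _ e2; have [h uh hh] := hB _ e2.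
have ugh : unit_continuous (fun x => g x * (1 - h x)).
  split; first by move=> x; apply: cvgM; [exact: ug.1|apply: cvgB; [exact: cst_continuous|exact: uh.1]].
  move=> x; have /andP[g0 g1] := ug.2 x; have /andP[h0 h1] := uh.2 x.
  have h2 : 0 <= 1 - h x by lra.
  by rewrite mulr_ge0//= -[leRHS]mulr1 ler_pM//; lra.
exists (fun x => g x * (1 - h x)) => // j.
rewrite (splitr e) (le_trans _ (lerD (hg j) (hh j)))// /dist -RintegralD//; last 2 first.
- exact: integrable_dist.
- exact: integrable_dist.
have ? := integrable_dist; apply: le_Rintegral => //.
- by apply: integrable_dist => //; exact: measurableD.
- have := integrableD measurableT (integrable_dist j mA ug) (integrable_dist j mB uh).
  by apply: eq_integrable.
move=> x _.
have -> : (\1_(A `\` B) x : R) = \1_A x * (1 - \1_B x).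
  rewrite !indicE in_setD; case: (x \in A) (x \in B) => [] [] /=;
  by rewrite ?subrr ?subr0 ?mulr0 ?mul0r ?mulr1.
have -> : \1_A x * (1 - \1_B x) - g x * (1 - h x) =
  (\1_A x - g x) * (1 - h x) + \1_A x * (h x - \1_B x) :> R by ring.
rewrite (le_trans (ler_normD _ _))// !normrM.
have /andP[h0 h1] := uh.2 x; have /andP[a0 a1] := indic01 A x.
rewrite lerD//.
  by rewrite -[leRHS]mulr1 ler_wpM2l// ger0_norm; lra.
by rewrite distrC -[leRHS]mul1r ler_wpM2r// ger0_norm.
Qed.

Let approximable_bigcup : ndseq_closed approximable.
Proof.
move=> F ndF hF; have mF i : measurable (F i) := (hF i).1.
have mU : measurable (\bigcup_i F i) by exact: bigcup_measurable.
split => // e e0; have e2 : 0 < e / 2 by rewrite divr_gt0.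
have near_j j : \forall n \near \oo, dist j (\bigcup_i F i) (\1_(F n)) <= e / 2.
  have : (fun n => fine (m j (F n))) n @[n --> \oo] --> fine (m j (\bigcup_i F i)).
    apply: fine_cvg; rewrite fineK ?fin_num_measure//; exact: nondecreasing_cvg_mu.
  move/cvgrPdist_le => /(_ _ e2); apply: filterS => n.
  suff -> : dist j (\bigcup_i F i) \1_(F n) = fine (m j (\bigcup_i F i)) - fine (m j (F n)).
    by move=> h; rewrite (le_trans (ler_norm _) h).
  have Fsub : F n `<=` \bigcup_i F i by exact: bigcup_sup.
  transitivity (\int[m j]_x (\1_(\bigcup_i F i) x - \1_(F n) x)).
    apply: eq_Rintegral => x _; rewrite ger0_norm// subr_ge0 !indicE ler_nat.
    case: (boolP (x \in F n)) => //; rewrite inE => /Fsub Ux.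
    by rewrite mem_set.
  rewrite RintegralB//.
  - by rewrite /Rintegral !integral_indic// !setIT.
  - by apply: (@bounded_integrable j _ 1) => // x; have /andP[? ?] := indic01 (\bigcup_i F i) x; rewrite ger0_norm.
  - by apply: (@bounded_integrable j _ 1) => // x; have /andP[? ?] := indic01 (F n) x; rewrite ger0_norm.
have [n hn] : exists n, forall j, dist j (\bigcup_i F i) (\1_(F n)) <= e / 2.
  have : \forall n \near \oo, forall j, dist j (\bigcup_i F i) (\1_(F n)) <= e / 2.
    by apply: filter_forall.
  by move=> [N _ hN]; exists N => j; apply: hN => /=.
have [g ug hg] := (hF n).2 _ e2; exists g => // j.
rewrite (splitr e) (le_trans _ (lerD (hn j) (hg j)))// /dist -RintegralD//; last 2 first.
- apply: (@bounded_integrable j _ 1); first by apply: measurableT_comp => //; apply: measurable_funB.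
  by move=> x; rewrite normr_id; apply: diff_le1.
- exact: integrable_dist.
apply: le_Rintegral => //.
- exact: integrable_dist.
- have i1 : (m j).-integrable setT (EFin \o (fun x => `|\1_(\bigcup_i F i) x - \1_(F n) x : R|)).
    apply: (@bounded_integrable j _ 1); first by apply: measurableT_comp => //; apply: measurable_funB.
    by move=> x; rewrite normr_id; apply: diff_le1.
  have := integrableD measurableT i1 (integrable_dist j (mF n) ug).
  by apply: eq_integrable.
by move=> x _; exact: ler_distD.
Qed.

(** Clamped affine functions are the continuous cut-offs used below. *)
Definition clamp (x : R) := Num.min 1 (Num.max 0 x).

Lemma clamp01 x : 0 <= clamp x <= 1.
Proof. by rewrite /clamp le_min ler01 le_max lexx /= ge_min lexx. Qed.
Lemma clamp_le0 x : x <= 0 -> clamp x = 0.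
Proof. by move=> x0; rewrite /clamp (max_idPl x0) min_r. Qed.
Lemma clamp_ge1 x : 1 <= x -> clamp x = 1.
Proof. by move=> x1; rewrite /clamp max_r ?(le_trans ler01)// min_l. Qed.
Lemma continuous_clamp : continuous clamp.
Proof.
move=> x; apply: continuous_min; first exact: cst_continuous.
by apply: continuous_max; [exact: cst_continuous|].
Qed.

Let approximable_itv (a b : R) : approximable `]a, b]%classic.
Proof.
split=> // e e0; pose g n x := clamp (n%:R * (x - a)) * clamp (1 - n%:R * (x - b)).
have ug n : unit_continuous (g n).
  split; last first.
    move=> x; have /andP[g0 g1] := clamp01 (n%:R * (x - a)).
    have /andP[h0 h1] := clamp01 (1 - n%:R * (x - b)).
    by rewrite /g mulr_ge0//= -[leRHS]mulr1 ler_pM.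
  move=> x; apply: cvgM.
    apply: (@continuous_comp _ _ _ (fun x => n%:R * (x - a)) clamp); last exact: continuous_clamp.
    by apply: cvgM; [exact: cvg_cst|apply: cvgB; [exact: cvg_id|exact: cvg_cst]].
  apply: (@continuous_comp _ _ _ (fun x => 1 - n%:R * (x - b)) clamp); last exact: continuous_clamp.
  apply: cvgB; first exact: cvg_cst.
  by apply: cvgM; [exact: cvg_cst|apply: cvgB; [exact: cvg_id|exact: cvg_cst]].
have pt x : \forall n \near \oo, `|\1_(`]a, b]) x - g n x| = 0.
  have [xa|ax] := leP x a.
    apply: nearW => n; rewrite /g clamp_le0 ?mul0r; last first.
      by rewrite mulr_ge0_le0// subr_le0.
    by rewrite indicE memNset ?subrr ?normr0//= in_itv /= ltNge xa.
  have big (y : R) : 0 < y -> \forall n \near \oo, 1 <= n%:R * y.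
    move=> y0; exists (Num.bound (y^-1)) => // n /= hn.
    have yi : 0 <= y^-1 by rewrite invr_ge0 ltW.
    by rewrite -ler_pdivrMr// div1r (le_trans (ltW (archi_boundP yi)))// ler_nat.
  have [xb|bx] := leP x b.
    have xa0 : 0 < x - a by rewrite subr_gt0.
    apply: filterS (big _ xa0) => n h; rewrite /g !clamp_ge1 ?mulr1//; last first.
      by rewrite lerBrDr gerDl mulr_ge0_le0// subr_le0.
    by rewrite indicE mem_set ?subrr ?normr0//= in_itv /= ax xb.
  have xb0 : 0 < x - b by rewrite subr_gt0.
  apply: filterS (big _ xb0) => n h; rewrite /g (@clamp_le0 (1 - _)) ?mulr0 ?subr_le0//.
  by rewrite indicE memNset ?subrr ?normr0//= in_itv /= ax leNgt bx.
have near_j j : \forall n \near \oo, dist j `]a, b]%classic (g n) <= e.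
  have mf n : measurable_fun setT (EFin \o (fun x => `|\1_(`]a, b]) x - g n x|)).
    exact: measurable_int (integrable_dist j _ (ug n)).
  have [|||| _ _ c] := @dominated_convergence _ _ _ (m j) setT measurableT
     (fun n => EFin \o (fun x => `|\1_(`]a, b]) x - g n x|)) (EFin \o cst 0) (EFin \o cst 1) mf.
  - exact/measurable_EFinP.
  - apply/aeW => x _ /=; apply: cvg_near_cst; apply: filterS (pt x) => n /= ->. by [].
  - exact: finite_measure_integrable_cst.
  - by apply/aeW => x n _ /=; rewrite lee_fin normr_id; apply: diff_le1; [exact: indic01|exact: (ug n).2].
  have {c} : dist j `]a, b]%classic (g n) @[n --> \oo] --> (0 : R).
    have := c; rewrite /= integral0 => c'.
    exact: (@fine_cvg _ _ _ _ _ 0).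
  move/cvgrPdist_le => /(_ _ e0); apply: filterS => n.
  by rewrite sub0r normrN; apply: le_trans; exact: ler_norm.
have : \forall n \near \oo, forall j, dist j `]a, b]%classic (g n) <= e.
  by apply: filter_forall.
by move=> [N _ hN]; exists (g N) => // j; apply: hN => /=.
Qed.

(** Sets whose indicator is approximable in mean for all the measures at once form a
    lambda-system: complements use [1 - g], increasing unions use continuity of the
    measures.  It contains the intervals.  The approximation is simultaneous because a
    complex measure has four components. *)
Lemma indicator_approximation A (e : R) : measurable A -> 0 < e ->
  exists2 g, unit_continuous g & forall j, \int[m j]_x `|\1_A x - g x| <= e.
Proof.
move=> mA e0; suff [_ /(_ _ e0)] : approximable A by [].
apply: (@lambda_system_subset _ (@ocitv R) (@ocitvI R) setT approximable) => //.
by move=> _ [[a b] _ <-]; exact: approximable_itv.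
Qed.

End indicator_approximation.

(** * Radon measures as combinations of four positive measures *)

Section components.
Context {R : realType}.
Implicit Types (mu nu : complex_radon R) (A : set (measurableTypeR R)).

Definition comp mu (j : 'I_4) : positive_radon R :=
  tnth [tuple rpos (cre mu); rneg (cre mu); rpos (cim mu); rneg (cim mu)] j.

Definition coef (j : 'I_4) : R[i] := tnth [tuple 1; -1; 0 +i* 1; 0 +i* (-1)] j.

Lemma normc_coef j : normc (coef j) = 1.
Proof.
by case: j => [[|[|[|[|//]]]]] h; rewrite /coef /tnth /=;
  rewrite ?oppr0 ?expr0n ?sqrrN ?expr1n /= ?addr0 ?add0r sqrtr1.
Qed.

Let sum4 (F : 'I_4 -> R[i]) : \sum_j F j =
  F ord0 + F (lift ord0 ord0) + F (lift ord0 (lift ord0 ord0)) +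
  F (lift ord0 (lift ord0 (lift ord0 ord0))).
Proof. by rewrite !big_ord_recl big_ord0 addr0 !addrA. Qed.

Lemma cvalue_comp mu A : cvalue mu A = \sum_j coef j * (fine (comp mu j A))%:C.
Proof. by rewrite sum4 /coef /comp /tnth /=; apply: eqC; rewrite !ReImE /= /rvalue; ring. Qed.

Lemma radon_integral_comp mu (f : R -> R[i]) : radon_integral mu f = \sum_j coef j *
  ((\int[comp mu j]_(t in `]0, +oo[) Re (f t)) +i* (\int[comp mu j]_(t in `]0, +oo[) Im (f t))).
Proof.
by rewrite sum4 /coef /comp /tnth /radon_integral /rintegral /=; apply: eqC; rewrite !ReImE /=; ring.
Qed.

Lemma sum_coef_le (F : 'I_4 -> R[i]) (e : R) : (forall j, normc (F j) <= e) ->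
  normc (\sum_j coef j * F j) <= 4 * e.
Proof.
move=> h; rewrite (le_trans (normc_sum _ _ _))//.
apply: (@le_trans _ _ (\sum_(j < 4) e)).
  by apply: ler_sum => j _; rewrite normcM normc_coef mul1r.
by rewrite sumr_const card_ord mulr_natl.
Qed.

(** The integral of [f] against the combination of the components of [mu]
    tilted by [t^-r]. *)
Definition lint r mu (f : R -> R[i]) : R[i] := \sum_j coef j * CI (tilt r (comp mu j)) f.

Lemma radon_integral_lint r mu f : cmeas (T := measurableTypeR R) (f \o expR) ->
  radon_integral mu f = lint r mu (fun y => (expR (r * y))%:C * f (expR y)).
Proof.
move=> [f1 f2]; rewrite radon_integral_comp; apply: eq_bigr => j _; congr (_ * _).
rewrite (Rintegral_half r (comp mu j) (f := fun t => Re (f t)))// (Rintegral_half r (comp mu j) (f := fun t => Im (f t)))//.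
by apply: eqC; apply: eq_Rintegral => y _; rewrite !ReImE /= mul0r ?subr0 ?addr0.
Qed.

Lemma pradon_fin (p : positive_radon R) (a b : R) : 0 < a -> (p `[a, b]%classic < +oo)%E.
Proof.
move=> a0; apply: pradon_compact; first exact: segment_compact.
by move=> x /=; rewrite !in_itv /= andbT => /andP[+ _]; apply: lt_le_trans.
Qed.

Lemma pradon_fin_num (p : positive_radon R) A : relcompact_borel A -> p A \is a fin_num.
Proof.
move=> [mA [a [b [a0 Aab]]]]; rewrite ge0_fin_numE//.
by apply: le_lt_trans (pradon_fin p b a0); apply: le_measure => //; rewrite inE.
Qed.

Section approximation.
Variables (mu nu : complex_radon R) (a b : R).
Hypotheses (a0 : 0 < a) (ab : a <= b).

Let D := `[a / 2, 2 * b]%classic : set (measurableTypeR R).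
Let mD : measurable D. Proof. exact: measurable_itv. Qed.
Let a2 : 0 < a / 2. Proof. by rewrite divr_gt0. Qed.

Let part (j : bool * 'I_4) : {finite_measure set (measurableTypeR R) -> \bar R} :=
  mfrestr mD (pradon_fin (comp (if j.1 then mu else nu) j.2) (2 * b) a2).

Let cutoff x := clamp ((2 * x - a) / a) * clamp ((2 * b - x) / b).

Let b0 : 0 < b. Proof. exact: lt_le_trans ab. Qed.

Let cutoff01 x : 0 <= cutoff x <= 1.
Proof.
have /andP[g0 g1] := clamp01 ((2 * x - a) / a).
have /andP[h0 h1] := clamp01 ((2 * b - x) / b).
by rewrite /cutoff mulr_ge0//= -[leRHS]mulr1 ler_pM.
Qed.

Let cutoff_in x : a <= x <= b -> cutoff x = 1.
Proof.
by move=> /andP[ax xb]; rewrite /cutoff !clamp_ge1 ?mulr1// ler_pdivlMr//; lra.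
Qed.

Let cutoff_out x : x \notin D -> cutoff x = 0.
Proof.
rewrite /D notin_setE /= in_itv /= => /negP; rewrite negb_and -!ltNge => /orP[h|h].
  by rewrite /cutoff clamp_le0 ?mul0r// ler_pdivrMr// mul0r; lra.
by rewrite /cutoff (@clamp_le0 _ ((2 * b - x) / b)) ?mulr0// ler_pdivrMr// mul0r; lra.
Qed.

Let continuous_cutoff : continuous cutoff.
Proof.
have c1 : continuous (fun x : R => clamp ((2 * x - a) / a)).
  move=> x; apply: (@continuous_comp _ _ _ (fun x : R => (2 * x - a) / a) clamp); last exact: continuous_clamp.
  apply: cvgM; last exact: cvg_cst; apply: cvgB; last exact: cvg_cst.
  by apply: cvgM; [exact: cvg_cst|exact: cvg_id].
have c2 : continuous (fun x : R => clamp ((2 * b - x) / b)).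
  move=> x; apply: (@continuous_comp _ _ _ (fun x : R => (2 * b - x) / b) clamp); last exact: continuous_clamp.
  by apply: cvgM; [apply: cvgB; [exact: cvg_cst|exact: cvg_id]|exact: cvg_cst].
by move=> x; apply: cvgM; [exact: c1|exact: c2].
Qed.

(** Only compact sets have finite mass, so the components are restricted to a larger
    segment, where [indicator_approximation] applies, and the approximant is multiplied
    by a continuous cut-off.  Both measures share the approximant, since it serves to
    compare them. *)
Lemma cvalue_approximation A (e : R) : measurable A -> A `<=` `[a, b] -> 0 < e ->
  exists phi : R -> R, [/\ unit_continuous phi, forall x, x \notin D -> phi x = 0,
    normc (cvalue mu A - radon_integral mu (fun x => (phi x)%:C)) <= e &
    normc (cvalue nu A - radon_integral nu (fun x => (phi x)%:C)) <= e].
Proof.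
move=> mA Aab e0; have e4 : 0 < e / 4 by rewrite divr_gt0.
have [g ug hg] := indicator_approximation part mA e4.
pose phi x := g x * cutoff x.
have uphi : unit_continuous phi.
  split; first by move=> x; apply: cvgM; [exact: ug.1|exact: continuous_cutoff].
  move=> x; have /andP[g0 g1] := ug.2 x; have /andP[h0 h1] := cutoff01 x.
  by rewrite /phi mulr_ge0//= -[leRHS]mulr1 ler_pM.
have out x : x \notin D -> phi x = 0 by move=> /cutoff_out h; rewrite /phi h mulr0.
have mphi : measurable_fun (setT : set (measurableTypeR R)) phi.
  exact: continuous_measurable_fun uphi.1.
have mg : measurable_fun (setT : set (measurableTypeR R)) g.
  exact: continuous_measurable_fun ug.1.
have DD : D `<=` `]0, +oo[.
  by move=> x; rewrite /D /= !in_itv /= andbT => /andP[+ _]; apply: lt_le_trans; exact: a2.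
have AD : A `<=` D.
  move=> x /Aab; rewrite /D /= !in_itv /= => /andP[ax xb].
  by have := b0; have := a0; move=> ? ?; apply/andP; split; lra.
have dist (p : positive_radon R) (pr : (p D < +oo)%E) : \int[mfrestr mD pr]_x `|\1_A x - g x| <= e / 4 ->
    `|fine (p A) - \int[p]_(t in `]0, +oo[) phi t| <= e / 4.
  set m := mfrestr mD pr => mle.
  have bi (f : R -> R) : measurable_fun (setT : set (measurableTypeR R)) f ->
      (forall x, `|f x| <= 1) -> m.-integrable setT (EFin \o f).
    move=> mf fC; have ic : m.-integrable setT (fun=> 1%:E) by exact: finite_measure_integrable_cst.
    apply: (le_integrable measurableT _ _ ic) => //; first exact/measurable_EFinP.
    by move=> x _ /=; rewrite lee_fin (le_trans (fC x))// normr1.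
  have ep : \int[p]_(t in `]0, +oo[) phi t = \int[m]_x phi x.
    transitivity (\int[p]_(t in D) phi t).
      rewrite /Rintegral; congr fine; rewrite [LHS]integral_mkcond [RHS]integral_mkcond.
      apply: eq_integral => x _; rewrite /patch; case: ifPn => [xp|xp]; case: ifPn => xD//.
        by rewrite out.
      by move: xp; rewrite mem_set//; apply: DD; rewrite -in_setE.
    rewrite /Rintegral; congr fine; transitivity (\int[m]_(t in D) (phi t)%:E)%E.
      apply: eq_measure_integral => B mB BD; rewrite /m /= /mfrestr /mrestr.
      by rewrite setIidl.
    rewrite [LHS]integral_mkcond; apply: eq_integral => x _; rewrite /patch.
    by case: ifPn => // /out ->.
  have eA : fine (p A) = \int[m]_x \1_A x.
    by rewrite /Rintegral integral_indic// setIT /m /= /mfrestr /mrestr setIidl.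
  have i1 : m.-integrable setT (EFin \o \1_A).
    apply: bi; first exact: measurable_indic.
    by move=> x; rewrite indicE; case: (x \in A); rewrite /= ?normr1 ?normr0.
  have i2 : m.-integrable setT (EFin \o phi).
    by apply: bi => // x; have /andP[? ?] := uphi.2 x; rewrite ger0_norm.
  have i3 : m.-integrable setT (EFin \o (fun x => \1_A x - phi x)).
    by have := integrableB measurableT i1 i2; exact: eq_integrable.
  rewrite ep eA -RintegralB// (le_trans (le_normr_Rintegral measurableT i3))// (le_trans _ mle)//.
  apply: le_Rintegral => //; first exact: integrable_norm i3.
    apply: bi; first by apply: measurableT_comp => //; apply: measurable_funB.
    move=> x; rewrite normr_id indicE; have /andP[? ?] := ug.2 x.
    by case: (x \in A) => /=; rewrite ler_norml; apply/andP; split; lra.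
  move=> x _; have /andP[c0 c1] := cutoff01 x.
  have -> : \1_A x - phi x = (\1_A x - g x) * cutoff x :> R.
    rewrite mulrBl -/(phi x) indicE; case: (boolP (x \in A)) => xA; last by rewrite mul0r.
    by rewrite cutoff_in ?mulr1//; move: xA; rewrite inE => /Aab; rewrite /= in_itv.
  by rewrite normrM (ger0_norm c0) -[leRHS]mulr1 ler_wpM2l.
have fin i : normc (cvalue (if i then mu else nu) A -
    radon_integral (if i then mu else nu) (fun x => (phi x)%:C)) <= e.
  rewrite cvalue_comp radon_integral_comp -sumrB (_ : e = 4 * (e / 4)); last by field.
  under eq_bigr do rewrite -mulrBr.
  apply: sum_coef_le => j.
  have -> (x y : R) : x%:C - (y +i* \int[comp (if i then mu else nu) j]_(t in `]0, +oo[) Im ((phi t)%:C)) = (x - y)%:C.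
    apply: eqC => //=; rewrite (_ : Rintegral _ _ _ = 0) ?subrr//.
    by rewrite /Rintegral integral0.
  rewrite normc_real; exact: dist (hg (i, j)).
by exists phi; split => //; [exact: fin true|exact: fin false].
Qed.

End approximation.

End components.

(** * Equality of Radon measures and test functions *)

Section test_functions.
Context {R : realType}.
Implicit Types (mu nu : complex_radon R) (A : set (measurableTypeR R)) (phi : R -> R[i]).

Lemma compact_half_line (K : set R) : compact K -> K `<=` `]0, +oo[ ->
  exists a b : R, [/\ 0 < a, a <= b & K `<=` `[a, b]].
Proof.
move=> cK K0; have [M [_ hM]] := compact_bounded cK.
have clK : closed K by exact: compact_closed.
have : nbhs (0 : R) (~` K).
  by apply: open_nbhs_nbhs; split; [exact: closed_openC|move=> /K0 /=; rewrite in_itv /= ltxx].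
move=> /nbhs_ballP[e /= e0 he].
exists e, (Num.max e (M + 1)); split => //; first by rewrite le_max lexx.
move=> x Kx; have /= := K0 x Kx; rewrite !in_itv /= andbT => x0.
apply/andP; split.
  rewrite leNgt; apply/negP => xe; apply: (he x) => //.
  by rewrite /ball /= sub0r normrN gtr0_norm.
rewrite le_max; apply/orP; right; rewrite (le_trans (ler_norm _))//.
by apply: (hM (M + 1)) => //; rewrite ltrDl.
Qed.

Lemma test_function_itv phi (a b : R) : 0 < a -> ccontinuous phi ->
  (forall x, x \notin (`[a, b]%classic : set R) -> phi x = 0) -> test_function phi.
Proof.
move=> a0 [c1 c2] out.
have sub : closure [set t | phi t != 0] `<=` `[a, b]%classic.
  rewrite closureE => x; apply; split; first exact: itv_closed.
  move=> t /= /eqP ft; apply: contrapT => h; apply: ft; apply: out.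
  by rewrite memNset.
split => //.
  by apply: subclosed_compact sub; [exact: closed_closure|exact: segment_compact].
by move=> x /sub /=; rewrite !in_itv /= andbT => /andP[+ _]; exact: lt_le_trans.
Qed.

Lemma test_function_support phi : test_function phi -> exists a b : R,
  [/\ 0 < a, a <= b & forall x, x \notin (`[a, b]%classic : set R) -> phi x = 0].
Proof.
move=> [_ _ /compact_half_line h /h [a [b [a0 ab sub]]]].
exists a, b; split => // x; rewrite notin_setE => xab; apply/eqP/negPn/negP => f0.
by apply: xab; apply: sub; apply: subset_closure.
Qed.

Lemma relcompact_itv A : relcompact_borel A -> exists a b : R,
  [/\ 0 < a, a <= b, measurable A & A `<=` `[a, b]].
Proof.
move=> [mA [a [b [a0 Aab]]]]; exists a, (Num.max a b); split => //.
  by rewrite le_max lexx.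
by move=> x /Aab /=; rewrite !in_itv /= le_max => /andP[-> ->]; rewrite orbT.
Qed.

(** Both values on a relatively compact set are approximated by the integrals of one
    test function. *)
Lemma radon_eq_test mu nu :
  (forall phi, test_function phi -> radon_integral mu phi = radon_integral nu phi) ->
  radon_eq mu nu.
Proof.
move=> h A /relcompact_itv[a [b [a0 ab mA Aab]]].
apply/eqP; rewrite -subr_eq0; apply/eqP/normc_eq0/eqP; rewrite eq_le normc_ge0 andbT.
apply/ler_addgt0Pr => e e0; rewrite add0r.
have e2 : 0 < e / 2 by rewrite divr_gt0.
have [phi [[c1 _] out h1 h2]] := cvalue_approximation mu nu a0 ab mA Aab e2.
have tphi : test_function (fun x => (phi x)%:C).
  apply: (@test_function_itv _ (a / 2) (2 * b)); first by rewrite divr_gt0.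
    by split => //= x; exact: cst_continuous.
  by move=> x /out ->.
rewrite -(subrKA (radon_integral mu (fun x => (phi x)%:C))) {2}(h _ tphi).
rewrite (le_trans (normcD _ _))// (splitr e) lerD//.
by rewrite -normcN opprB.
Qed.

Let fin_add_eq (x y z w : \bar R) : x \is a fin_num -> y \is a fin_num ->
  z \is a fin_num -> w \is a fin_num ->
  (x + w = y + z)%E <-> fine x - fine y = fine z - fine w.
Proof.
case: x y z w => [x| |] [y| |] [z| |] [w| |] //= _ _ _ _; rewrite -!EFinD.
by split=> [[] e|e]; [|congr EFin]; lra.
Qed.

Section supported.
Variables (a b C : R) (f : R -> R).
Hypotheses (a0 : 0 < a) (mf : measurable_fun (setT : set (measurableTypeR R)) f).
Hypotheses (fC : forall x, `|f x| <= C) (out : forall x, x \notin (`[a, b]%classic : set R) -> f x = 0).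

Lemma integrable_supported (p : positive_radon R) :
  p.-integrable (`[a, b]%classic : set (measurableTypeR R)) (EFin \o f).
Proof.
have ic : p.-integrable (`[a, b]%classic : set (measurableTypeR R)) (fun=> C%:E).
  apply/integrableP; split => //; under eq_integral do rewrite abse_EFin.
  rewrite integral_cst//; apply: lte_mul_pinfty => //; exact: pradon_fin.
apply: (le_integrable _ _ _ ic) => //.
  by apply/measurable_EFinP; exact: measurable_funTS.
by move=> x _ /=; rewrite lee_fin (le_trans (fC x))// ler_norm.
Qed.

Lemma integral_supported (p : {measure set (measurableTypeR R) -> \bar R}) :
  (\int[p]_(t in `]0%R, +oo[) (f t)%:E = \int[p]_(t in `[a, b]) (f t)%:E)%E.
Proof.
rewrite [LHS]integral_mkcond [RHS]integral_mkcond.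
apply: eq_integral => x _; rewrite /patch; case: ifPn => [xp|xp]; case: ifPn => xD//.
  by rewrite out.
move: xp; rewrite mem_set//; move: xD; rewrite inE /= !in_itv /= andbT => /andP[+ _].
exact: lt_le_trans.
Qed.

Lemma rintegral_eq (m m' : real_radon R) :
  (forall A, relcompact_borel A -> rvalue m A = rvalue m' A) ->
  rintegral m f = rintegral m' f.
Proof.
move=> h; set D : set (measurableTypeR R) := `[a, b]%classic.
have mD : measurable D by exact: measurable_itv.
have e : (\int[measure_add (rpos m) (rneg m')]_(t in D) (f t)%:E =
    \int[measure_add (rneg m) (rpos m')]_(t in D) (f t)%:E)%E.
  apply: eq_measure_integral => A mA AD; transitivity (rpos m A + rneg m' A)%E; first exact: measure_addE.
  transitivity (rneg m A + rpos m' A)%E; last by apply/esym; exact: measure_addE.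
  have rA : relcompact_borel A by split => //; exists a, b.
  apply/(fin_add_eq (pradon_fin_num _ rA) (pradon_fin_num _ rA) (pradon_fin_num _ rA) (pradon_fin_num _ rA)).
  exact: h A rA.
have I (p : positive_radon R) := integrable_supported p.
move: e; rewrite !integral_measure_add//.
have F (p : positive_radon R) : (\int[p]_(t in D) (f t)%:E)%E \is a fin_num.
  exact: integrable_fin_num (I p).
move/(fin_add_eq (F _) (F _) (F _) (F _)) => e.
by rewrite /rintegral /Rintegral !integral_supported.
Qed.

End supported.

Lemma test_bounded phi : test_function phi -> exists C, forall x, normc (phi x) <= C.
Proof.
move=> tphi; have [a [b [a0 ab out]]] := test_function_support tphi.
case: tphi => c1 c2 _ _.
have E (g : R -> R) : continuous g -> exists M, forall x, x \in `[a, b] -> `|g x| <= M.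
  move=> cg; have cn : {within `[a, b], continuous (fun x => `|g x|)}.
    apply: continuous_subspaceT => x; apply: continuous_comp; first exact: cg.
    exact: norm_continuous.
  by have [c _ hc] := EVT_max ab cn; exists `|g c|.
have [M1 h1] := E _ c1; have [M2 h2] := E _ c2.
have M10 : 0 <= M1 by apply: le_trans (h1 a _); rewrite ?in_itv /= ?lexx.
have M20 : 0 <= M2 by apply: le_trans (h2 a _); rewrite ?in_itv /= ?lexx.
exists (M1 + M2) => x; have [xab|/negP xab] := boolP (x \in `[a, b]).
  by rewrite (le_trans (normc_le _))// lerD ?h1 ?h2.
by rewrite out ?normc0 ?addr_ge0// memNset.
Qed.

(** Equality of the values does not identify the components, because the values may
    be represented by different positive and negative parts.  Moving these across the
    equality compares sums of positive measures, whose integrals then agree. *)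
Lemma radon_integral_eq mu nu phi : radon_eq mu nu -> test_function phi ->
  radon_integral mu phi = radon_integral nu phi.
Proof.
move=> h tphi; have [C hC] := test_bounded tphi.
have [a [b [a0 ab out]]] := test_function_support tphi.
case: tphi => c1 c2 _ _.
have m1 := continuous_measurable_fun c1; have m2 := continuous_measurable_fun c2.
have b1 x : `|Re (phi x)| <= C := le_trans (normc_Re _) (hC x).
have b2 x : `|Im (phi x)| <= C := le_trans (normc_Im _) (hC x).
have o1 x : x \notin (`[a, b]%classic : set R) -> Re (phi x) = 0 by move=> /out ->.
have o2 x : x \notin (`[a, b]%classic : set R) -> Im (phi x) = 0 by move=> /out ->.
have hr A : relcompact_borel A -> rvalue (cre mu) A = rvalue (cre nu) A by move=> /h [].
have hi A : relcompact_borel A -> rvalue (cim mu) A = rvalue (cim nu) A by move=> /h [].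
rewrite /radon_integral (rintegral_eq a0 m1 b1 o1 hr) (rintegral_eq a0 m2 b2 o2 hr).
by rewrite (rintegral_eq a0 m1 b1 o1 hi) (rintegral_eq a0 m2 b2 o2 hi).
Qed.

End test_functions.

(** * Radon measures with a density *)

Section density.
Context {R : realType}.
Local Notation lam := (@lebesgue_measure R).

Lemma measurable_truncate (h : R -> R) :
  measurable_fun (`]0, +oo[%classic : set (measurableTypeR R)) h ->
  measurable_fun (setT : set (measurableTypeR R)) (fun t => if 0 < t then h t else 0).
Proof.
move=> mh; have mD : measurable (`]0, +oo[%classic : set (measurableTypeR R)) by exact: measurable_itv.
have := (measurable_restrictT h mD).1 mh; congr (measurable_fun _ _).
apply/funext => t; rewrite /patch.
have -> : (t \in (`]0, +oo[%classic : set R)) = (0 < t).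
  by apply/idP/idP; rewrite ?inE /= in_itv /= andbT.
by [].
Qed.

Lemma measurable_exp (h : R -> R) :
  measurable_fun (`]0, +oo[%classic : set (measurableTypeR R)) h ->
  measurable_fun (setT : set (measurableTypeR R)) (h \o expR).
Proof.
move=> mh; rewrite (_ : h \o expR = (fun t => if 0 < t then h t else 0) \o expR); last first.
  by apply/funext => x /=; rewrite expR_gt0.
exact: measurableT_comp (measurable_truncate mh) (@measurable_expR R).
Qed.

Section real_density.
Variable h : R -> R.
Hypothesis mh : measurable_fun (`]0, +oo[%classic : set (measurableTypeR R)) h.
Hypothesis ih : forall a b : R, 0 < a ->
  lam.-integrable (`[a, b]%classic : set (measurableTypeR R)) (EFin \o h).

Let h0 (t : R) := if 0 < t then h t else 0.

Let mh0 : measurable_fun (setT : set (measurableTypeR R)) h0.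
Proof. exact: measurable_truncate. Qed.

Let part (c : R) (t : R) := Num.max (c * h0 t) 0.

Let mpart c : measurable_fun (setT : set (measurableTypeR R)) (part c).
Proof. by apply: measurable_maxr => //; exact: measurable_funM. Qed.

Let part_ge0 c t : 0 <= part c t. Proof. by rewrite le_max lexx orbT. Qed.

Let part_le c t : `|c| = 1 -> part c t <= `|h0 t|.
Proof. by move=> c1; rewrite ge_max normr_ge0 andbT (le_trans (ler_norm _))// normrM c1 mul1r. Qed.

Let m c : {measure set (measurableTypeR R) -> \bar R} := dens lam (mpart c).

Let m_support c : m c `]-oo, (0 : R)]%classic = 0%E.
Proof.
rewrite /m /= /dens; apply: integral0_eq => t /=; rewrite in_itv /= => t0.
by rewrite /part /h0 ltNge t0 /= mulr0 max_l// normr0.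
Qed.

Let ih0 (a b : R) : 0 < a -> lam.-integrable (`[a, b]%classic : set (measurableTypeR R)) (EFin \o h0).
Proof.
move=> a0; apply: eq_integrable (ih b a0) => //.
move=> t; rewrite inE /= in_itv /= => /andP[ta _].
by rewrite /h0 (lt_le_trans a0 ta).
Qed.

Let ipart c (a b : R) : `|c| = 1 -> 0 < a ->
  lam.-integrable (`[a, b]%classic : set (measurableTypeR R)) (EFin \o part c).
Proof.
move=> c1 a0; apply: (le_integrable _ _ _ (ih0 b a0)) => //.
  by apply/measurable_EFinP; exact: measurable_funTS.
by move=> t _; rewrite /= lee_fin ger0_norm ?part_ge0// part_le.
Qed.

Let m_compact c (K : set R) : `|c| = 1 -> compact K -> K `<=` `]0, +oo[ -> (m c K < +oo)%E.
Proof.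
move=> c1 cK K0; have [a [b [a0 ab Kab]]] := compact_half_line cK K0.
have mK : measurable (K : set (measurableTypeR R)).
  by apply: closed_measurable; exact: compact_closed.
have /integrableP[_] := ipart b c1 a0; apply: le_lt_trans.
rewrite /m /= /dens; apply: ge0_subset_integral => //.
by apply/measurable_EFinP; apply: measurableT_comp => //; exact: measurable_funTS.
Qed.

Let n1 : `|1 : R| = 1. Proof. exact: normr1. Qed.
Let nN1 : `|-1 : R| = 1. Proof. by rewrite normrN normr1. Qed.

Let ppos : positive_radon R := PositiveRadon (m_support 1) (fun K => m_compact n1 (K := K)).
Let pneg : positive_radon R := PositiveRadon (m_support (-1)) (fun K => m_compact nN1 (K := K)).

Let sing : mutually_singular ppos pneg.
Proof.
pose A : set (measurableTypeR R) := [set t | h0 t <= 0].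
exists A; split.
- have := measurable_fun_le measurableT mh0 (measurable_cst (0 : R)).
  by rewrite setTI.
- rewrite /= /dens; apply: integral0_eq => t /=.
  by rewrite /A /= => t0; rewrite /part mul1r max_r// normr0.
- rewrite /= /dens; apply: integral0_eq => t /=.
  rewrite /A /= => /negP; rewrite -ltNge => t0.
  by rewrite /part mulN1r max_r ?normr0// oppr_le0 ltW.
Qed.

Let part_sub t : part 1 t - part (-1) t = h0 t.
Proof.
rewrite /part mul1r mulN1r; case/orP: (le_total 0 (h0 t)) => t0.
  by rewrite max_l// max_r ?oppr_le0// subr0.
by rewrite max_r// max_l ?oppr_ge0// sub0r opprK.
Qed.

Lemma real_density : exists d : real_radon R, [/\
  forall A, relcompact_borel A -> rvalue d A = \int[lam]_(t in A) h t,
  rpos d `<< lam, rneg d `<< lam &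
  forall (f : R -> R) (a b C : R), 0 < a ->
    measurable_fun (setT : set (measurableTypeR R)) f -> (forall t, `|f t| <= C) ->
    (forall t, t \notin (`[a, b]%classic : set R) -> f t = 0) ->
    rintegral d f = \int[lam]_x (expR x * (f (expR x) * h (expR x)))].
Proof.
have dom c : m c `<< lam.
  apply/null_content_dominatesP => A mA A0; rewrite /m /= /dens.
  apply: null_set_integral => //.
  by apply/measurable_EFinP; apply: measurableT_comp => //; exact: measurable_funTS.
exists (RealRadon sing); split; [|exact: dom|exact: dom|].
- move=> A /relcompact_itv[a [b [a0 ab mA Aab]]].
  have i c : `|c| = 1 -> lam.-integrable A (EFin \o part c).
    move=> c1; apply: integrableS (ipart b c1 a0) => //.
  rewrite /rvalue /= /dens.
  under eq_integral do rewrite ger0_norm ?part_ge0//.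
  under [X in _ - fine X = _]eq_integral do rewrite ger0_norm ?part_ge0//.
  rewrite -[LHS]/(\int[lam]_(t in A) part 1 t - \int[lam]_(t in A) part (-1) t).
  rewrite -RintegralB//; [|exact: i|exact: i].
  apply: eq_Rintegral => t; rewrite inE => /Aab /=; rewrite in_itv /= => /andP[ta _].
  by rewrite part_sub /h0 (lt_le_trans a0 ta).
move=> f a b C a0 mf fC out.
have full (p : {measure set (measurableTypeR R) -> \bar R}) : \int[p]_(t in `]0, +oo[) f t = \int[p]_t f t.
  rewrite /Rintegral; congr fine; rewrite [LHS]integral_mkcond; apply: eq_integral => t _.
  rewrite /patch; case: ifPn => // t0; rewrite out//.
  apply: contra t0; rewrite !inE /= !in_itv /= andbT => /andP[+ _]; exact: lt_le_trans.
have i c : `|c| = 1 -> lam.-integrable setT (EFin \o (fun t => f t * part c t)).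
  move=> c1; have mab : measurable (`[a, b]%classic : set (measurableTypeR R)) by exact: measurable_itv.
  have := ipart b c1 a0 => /(integrableZl mab C) => /(integrable_mkcond _ mab).
  apply: le_integrable => //; first by apply/measurable_EFinP; exact: measurable_funM.
  move=> t _ /=; rewrite /patch; case: ifPn => tab; last by rewrite out// mul0r normr0 abse_ge0.
  by rewrite /= lee_fin !normrM ler_wpM2r//; exact: le_trans (fC t) (ler_norm _).
rewrite /rintegral /= !full !Rintegral_dens//.
rewrite -RintegralB//; [|exact: i|exact: i].
transitivity (\int[lam]_(t in `]0, +oo[) (f t * h0 t)).
  rewrite /Rintegral; congr fine; rewrite [RHS]integral_mkcond; apply: eq_integral => t _.
  rewrite -mulrBr part_sub /patch; case: ifPn => // t0; rewrite out ?mul0r//.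
  apply: contra t0; rewrite !inE /= !in_itv /= andbT => /andP[+ _]; exact: lt_le_trans.
rewrite /Rintegral (integral_exp (f := fun t => f t * h0 t)); last first.
  exact: (measurableT_comp (measurable_funM mf mh0) (@measurable_expR R)).
by congr fine; apply: eq_integral => x _; rewrite /h0 expR_gt0.
Qed.

End real_density.

(** The positive and negative parts of a locally integrable function are the densities
    of the components.  The last clause computes integrals in logarithmic coordinates. *)
Lemma radon_of_density (h : R -> R[i]) : cmeasurable `]0, +oo[ h ->
  (forall a b : R, 0 < a -> cintegrable `[a, b] h) ->
  exists d : complex_radon R, [/\ has_density d h, radon_abs_continuous d &
    forall phi, test_function phi ->
      radon_integral d phi = CI lam (fun x => (expR x)%:C * (phi (expR x) * h (expR x)))].
Proof.
move=> mh ih; have [d1 [v1 p1 q1 i1]] := real_density mh.1 (fun a b a0 => (ih a b a0).1).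
have [d2 [v2 p2 q2 i2]] := real_density mh.2 (fun a b a0 => (ih a b a0).2).
exists (ComplexRadon d1 d2); split => //.
  by split => // A rA; rewrite /cvalue /= v1// v2.
move=> phi tphi; have [C hC] := test_bounded tphi.
have [a [b [a0 ab out]]] := test_function_support tphi.
case: tphi => c1 c2 _ _.
have m1 := continuous_measurable_fun c1; have m2 := continuous_measurable_fun c2.
have b1 x : `|Re (phi x)| <= C := le_trans (normc_Re _) (hC x).
have b2 x : `|Im (phi x)| <= C := le_trans (normc_Im _) (hC x).
have o1 x : x \notin (`[a, b]%classic : set R) -> Re (phi x) = 0 by move=> /out ->.
have o2 x : x \notin (`[a, b]%classic : set R) -> Im (phi x) = 0 by move=> /out ->.
rewrite /radon_integral /= (i1 _ _ _ _ a0 m1 b1 o1) (i1 _ _ _ _ a0 m2 b2 o2).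
rewrite (i2 _ _ _ _ a0 m1 b1 o1) (i2 _ _ _ _ a0 m2 b2 o2).
have I (f g : R -> R) : measurable_fun (setT : set (measurableTypeR R)) f ->
    (forall x, `|f x| <= C) -> (forall x, x \notin (`[a, b]%classic : set R) -> f x = 0) ->
    measurable_fun (`]0, +oo[%classic : set (measurableTypeR R)) g ->
    (forall a b : R, 0 < a -> lam.-integrable (`[a, b]%classic : set (measurableTypeR R)) (EFin \o g)) ->
    lam.-integrable setT (EFin \o (fun x => expR x * (f (expR x) * g (expR x)))).
  move=> mf fC fo mg ig.
  have mge : measurable_fun (setT : set (measurableTypeR R)) (g \o expR). by exact: measurable_exp.
  apply/(integrable_exp (f := fun t => f t * g t)).
  - by apply: measurable_funM => //; exact: (measurableT_comp mf (@measurable_expR R)).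
  - by apply: measurable_funM => //; exact: measurable_funTS.
  have mab : measurable (`[a, b]%classic : set (measurableTypeR R)) by exact: measurable_itv.
  have i0 := (integrable_mkcond _ mab).1 (integrableZl mab C (ig a b a0)).
  apply: (le_integrable _ _ _ (integrableS measurableT _ (@subsetT _ _) i0)) => //.
    by apply/measurable_EFinP; apply: measurable_funM => //; exact: measurable_funTS.
  move=> t _ /=; rewrite /patch; case: ifPn => tab; last by rewrite fo// mul0r normr0 abse_ge0.
  by rewrite /= lee_fin !normrM ler_wpM2r//; exact: le_trans (fC t) (ler_norm _).
have ih1 a' b' a0' := (ih a' b' a0').1; have ih2 a' b' a0' := (ih a' b' a0').2.
apply: eqC => /=.
  rewrite -RintegralB//; [|exact: I m1 b1 o1 mh.1 ih1|exact: I m2 b2 o2 mh.2 ih2].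
  by apply: eq_Rintegral => x _; rewrite !ReImE /=; ring.
rewrite -RintegralD//; [|exact: I m2 b2 o2 mh.1 ih1|exact: I m1 b1 o1 mh.2 ih2].
by apply: eq_Rintegral => x _; rewrite !ReImE /=; ring.
Qed.

End density.

(** * Convolution of a kernel with a measure of moderate growth *)

Section moderate_growth.
Context {R : realType}.
Local Notation lam := (@lebesgue_measure R).
Variable u : R -> R.
Hypothesis u_bounded : forall L : R, exists C, forall x y, `|y| <= L -> `|u (x + y) - u x| <= C.
Implicit Types (n : {sigma_finite_measure set (measurableTypeR R) -> \bar R}) (psi : R -> R[i]).

(** Windows of length 1 are windows [r, er] on the half-line, and [exp (u x)] is what
    remains of [V] after the tilt. *)
Definition growth (n : {measure set (measurableTypeR R) -> \bar R}) :=
  exists2 C : R, 0 <= C & forall x : R, (n `[x, (x + 1)%R]%classic <= (C * expR (u x))%:E)%E.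

Let weight_near (L : R) : exists2 C, 0 <= C & forall x y, `|y| <= L -> expR (u (x + y)) <= C * expR (u x).
Proof.
have [C hC] := u_bounded L; exists (expR C); first exact: expR_ge0.
move=> x y yL; rewrite -expRD ler_expR -lerBlDr.
by rewrite (le_trans (ler_norm _))// hC.
Qed.

Lemma growth_window n (N : R) : growth n -> exists2 C, 0 <= C &
  forall x, (n `[(x - N)%R, (x + N)%R]%classic <= (C * expR (u x))%:E)%E.
Proof.
move=> [C C0 hC].
have step (M : nat) : exists2 C, 0 <= C & forall x, (n `[x, (x + M%:R)%R]%classic <= (C * expR (u x))%:E)%E.
  elim: M => [|M [C1 C10 h1]].
    exists C => // x; apply: le_trans (hC x); apply: le_measure; rewrite ?inE//.
    by apply: subset_itvl; rewrite bnd_simp addr0 lerDl.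
  have [C2 C20 h2] := weight_near M%:R.
  exists (C1 + C * C2) => [|x]; first by rewrite addr_ge0// mulr_ge0.
  apply: (@le_trans _ _ (n `[x, (x + M%:R)%R]%classic + n `[(x + M%:R)%R, (x + M%:R + 1)%R]%classic)%E).
    apply: le_trans (measureU2 _ _ _) => //; apply: le_measure; rewrite ?inE//; first exact: measurableU.
    move=> y /=; rewrite !in_itv /= -natr1 addrA => /andP[xy yx].
    by have [h|/ltW h] := leP y (x + M%:R); [left|right]; rewrite ?xy ?yx ?h.
  rewrite mulrDl EFinD leeD// (le_trans (hC _))// lee_fin -mulrA ler_wpM2l//.
  by apply: h2; rewrite ger0_norm.
pose M := Num.bound `|N|.
have NM : `|N| <= M%:R by rewrite ltW// archi_boundP.
have [C1 C10 h1] := step (M + M)%N; have [C2 C20 h2] := weight_near M%:R.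
exists (C1 * C2) => [|x]; first by rewrite mulr_ge0.
apply: (@le_trans _ _ (n `[(x - M%:R)%R, (x - M%:R + (M + M)%:R)%R]%classic)).
  apply: le_measure; rewrite ?inE//; apply: subset_itv; rewrite bnd_simp.
    by rewrite lerD2l lerN2 (le_trans (ler_norm _) NM).
  by rewrite natrD addrA subrK lerD2l (le_trans (ler_norm _) NM).
rewrite (le_trans (h1 _))// lee_fin -mulrA ler_wpM2l// h2//.
by rewrite normrN ger0_norm.
Qed.

Definition supported (N B : R) psi := [/\ cmeas (T := measurableTypeR R) psi,
  forall y, normc (psi y) <= B & forall y, N < `|y| -> psi y = 0].

Lemma supported_ge0 N B psi : supported N B psi -> 0 <= B.
Proof. by move=> [_ /(_ 0)+ _]; apply: le_trans; exact: normc_ge0. Qed.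

(** A window of any length is covered by finitely many of length 1, on which
    the weights [exp (u x)] are comparable. *)
Lemma window_bound n (N : R) : growth n -> exists2 C, 0 <= C & forall B psi x, supported N B psi ->
  cint n (fun y => psi (y - x)) /\
  (\int[n]_y (normc (psi (y - x)))%:E <= (B * C * expR (u x))%:E)%E.
Proof.
move=> gn; have [C C0 hC] := growth_window N gn; exists C => // B psi x sp.
have B0 := supported_ge0 sp; have [mp pB out] := sp.
pose A : set (measurableTypeR R) := `[x - N, x + N]%classic.
have mA : measurable A by exact: measurable_itv.
have mpx : cmeas (T := measurableTypeR R) (fun y => psi (y - x)).
  by apply: cmeas_comp mp; exact: measurable_funB.
have le y : normc (psi (y - x)) <= B * \1_A y.
  rewrite indicE; case: (boolP (y \in A)) => yA; first by rewrite mulr1.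
  rewrite mulr0 out ?normc0// ltNge; apply: contra yA; rewrite /A ler_norml inE /= in_itv /=.
  by move=> /andP[? ?]; apply/andP; split; lra.
have eI : (\int[n]_y (B * \1_A y)%:E = B%:E * n A)%E.
  under eq_integral do rewrite EFinM.
  rewrite ge0_integralZl//; last by apply/measurable_EFinP.
  by rewrite integral_indic// setIT.
have IA : (\int[n]_y (B * \1_A y)%:E <= (B * C * expR (u x))%:E)%E.
  by rewrite eI -mulrA EFinM lee_wpmul2l ?lee_fin//; exact: hC.
have mB : measurable_fun (setT : set (measurableTypeR R)) (fun y => B * \1_A y).
  by apply: measurable_funM => //; exact: measurable_indic.
split.
  apply: (@cint_dom _ _ _ _ _ (fun y => B * \1_A y)) => //.
  apply/integrableP; split; first exact/measurable_EFinP.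
  rewrite (le_lt_trans _ (ltry (B * C * expR (u x))))// (le_trans _ IA)//.
  apply: ge0_le_integral => //; [|exact/measurable_EFinP|].
    by apply/measurable_EFinP; apply: measurableT_comp.
  by move=> y _; rewrite /= lee_fin ger0_norm// mulr_ge0.
apply: le_trans IA; apply: ge0_le_integral => //.
- by move=> y _; rewrite lee_fin normc_ge0.
- by apply/measurable_EFinP; exact: measurable_normc.
- exact/measurable_EFinP.
- by move=> y _; rewrite lee_fin.
Qed.

Variables (k : R -> R[i]) (D : R -> R).
Hypothesis mk : cmeas (T := measurableTypeR R) k.
Hypothesis iD : lam.-integrable setT (EFin \o D).
Hypothesis kD : forall x z, normc (k z) * expR (u (x + z) - u x) <= D z.

Lemma ae_CI (f g : R -> R[i]) : cmeas (T := measurableTypeR R) f -> cmeas (T := measurableTypeR R) g ->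
  {ae lam, forall x, f x = g x} -> cint lam f -> cint lam g /\ CI lam f = CI lam g.
Proof.
move=> [f1 f2] [g1 g2] fg [i1 i2].
have a1 : ae_eq lam setT (EFin \o (fun x => Re (f x))) (EFin \o (fun x => Re (g x))).
  by apply: (@filterS _ _ (ae_filter_ringOfSetsType lam) _ _ _ fg) => x /= -> .
have a2 : ae_eq lam setT (EFin \o (fun x => Im (f x))) (EFin \o (fun x => Im (g x))).
  by apply: (@filterS _ _ (ae_filter_ringOfSetsType lam) _ _ _ fg) => x /= -> .
have I (p q : R -> R) : measurable_fun (setT : set (measurableTypeR R)) p ->
    measurable_fun (setT : set (measurableTypeR R)) q ->
    ae_eq lam setT (EFin \o p) (EFin \o q) -> lam.-integrable setT (EFin \o p) ->
    lam.-integrable setT (EFin \o q).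
  move=> mp mq pq /integrableP[_ ip]; apply/integrableP; split; first exact/measurable_EFinP.
  move: ip; rewrite (@ae_eq_integral _ _ _ lam setT (fun x => `|(q x)%:E|%E))//.
  - by apply/measurable_EFinP; exact: measurableT_comp.
  - by apply/measurable_EFinP; exact: measurableT_comp.
  by apply: (@filterS _ _ (ae_filter_ringOfSetsType lam) _ _ _ pq) => x h Dx; have /= [pqx] := h Dx; rewrite /= pqx.
split; first by split; [exact: I f1 g1 a1 i1|exact: I f2 g2 a2 i2].
apply: eqC => /=; rewrite /Rintegral; congr fine.
  by apply: (@ae_eq_integral _ _ _ lam setT (fun x => (Re (g x))%:E) (fun x => (Re (f x))%:E)) => //; exact/measurable_EFinP.
by apply: (@ae_eq_integral _ _ _ lam setT (fun x => (Im (g x))%:E) (fun x => (Im (f x))%:E)) => //; exact/measurable_EFinP.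
Qed.

Section fubini.
Variables (n : {sigma_finite_measure set (measurableTypeR R) -> \bar R}) (r N B : R) (psi : R -> R[i]).
Hypotheses (gn : growth n) (sp : supported N B psi).

Let mpsi : cmeas (T := measurableTypeR R) psi. Proof. by case: sp. Qed.

Let mdiff : measurable_fun (setT : set (measurableTypeR R * measurableTypeR R))
  (fun z => (z.2 - z.1 : measurableTypeR R)).
Proof. by apply: measurable_funB; [exact: measurable_snd|exact: measurable_fst]. Qed.

Let mfst : measurable_fun (setT : set (measurableTypeR R * measurableTypeR R)) fst.
Proof. exact: measurable_fst. Qed.
Let msnd : measurable_fun (setT : set (measurableTypeR R * measurableTypeR R)) snd.
Proof. exact: measurable_snd. Qed.

Lemma cmeas_translates : cmeas (T := measurableTypeR R) (fun x => CI n (fun y => psi (y - x))).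
Proof.
have h : cmeas (T := (measurableTypeR R * measurableTypeR R)%type) (fun z => psi (z.2 - z.1)).
  exact: cmeas_comp mdiff mpsi.
exact: (cmeas_CI_param n h).
Qed.

Let g (z : R * R) := k z.1 * psi (z.2 - z.1).

Let mg : cmeas (T := (measurableTypeR R * measurableTypeR R)%type) g.
Proof. by apply: cmeasM; [exact: cmeas_comp mfst mk|exact: cmeas_comp mdiff mpsi]. Qed.

Let finite_mass : (\int[lam]_x \int[n]_y (normc (g (x, y)))%:E < +oo)%E.
Proof.
have [C C0 hC] := window_bound N gn; have B0 := supported_ge0 sp.
have iBD : lam.-integrable setT (fun x => (B * C * expR (u 0))%:E * (D x)%:E)%E.
  exact: integrableZl.
have /integrableP[mBD] := iBD; apply: le_lt_trans; apply: ge0_le_integral => //.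
- by move=> x _; apply: integral_ge0 => y _; rewrite lee_fin normc_ge0.
- exact: (measurable_normc_param n mg).
- exact: measurableT_comp.
move=> x _.
have -> : (\int[n]_y (normc (g (x, y)))%:E = \int[n]_y ((normc (k x))%:E * (normc (psi (y - x)))%:E))%E.
  by apply: eq_integral => y _; rewrite /g normcM EFinM.
rewrite ge0_integralZl//; last 3 first.
- by apply/measurable_EFinP; apply: measurable_normc; apply: cmeas_comp mpsi; exact: measurable_funB.
- by move=> y _; rewrite lee_fin normc_ge0.
- by rewrite lee_fin normc_ge0.
apply: (@le_trans _ _ ((normc (k x))%:E * (B * C * expR (u x))%:E)%E).
  by rewrite lee_wpmul2l ?lee_fin ?normc_ge0//; exact: (hC _ _ _ sp).2.
rewrite -!EFinM lee_fin (le_trans _ (ler_norm _))//.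
have := kD 0 x; rewrite add0r expRD expRN => h.
have e0 : 0 < expR (u 0) by exact: expR_gt0.
have -> : normc (k x) * (B * C * expR (u x)) =
  B * C * expR (u 0) * (normc (k x) * (expR (u x) / expR (u 0))).
  by field; rewrite gt_eqF.
by rewrite ler_wpM2l// !mulr_ge0// ltW.
Qed.

Let h (z : R * R) := psi z.2 * k (z.1 - z.2).

Let mh : cmeas (T := (measurableTypeR R * measurableTypeR R)%type) h.
Proof.
apply: cmeasM; first exact: cmeas_comp msnd mpsi.
by apply: cmeas_comp mk; apply: measurable_funB; [exact: measurable_fst|exact: measurable_snd].
Qed.

Let swap_mass : (\int[n]_y \int[lam]_x (normc (h (y, x)))%:E < +oo)%E.
Proof.
apply: le_lt_trans finite_mass.
have mng : measurable_fun (setT : set (measurableTypeR R * measurableTypeR R)) (fun z => (normc (g z))%:E).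
  by apply/measurable_EFinP; exact: measurable_normc.
rewrite (@fubini_tonelli _ _ _ _ _ lam n _ mng); last by move=> z; rewrite lee_fin normc_ge0.
rewrite le_eqVlt; apply/orP; left; apply/eqP; apply: eq_integral => y _.
rewrite -[LHS](ge0_integral_sub y).
- by apply: eq_integral => x _; rewrite /h /g /= subKr mulrC.
- apply/measurable_EFinP; apply: measurable_normc; rewrite /h /=; apply: cmeasM => //.
  by apply: cmeas_comp mk; exact: measurable_funB.
- by move=> x; rewrite lee_fin normc_ge0.
Qed.

Let weight x := (expR (r * x))%:C : R[i].

Let mweight : cmeas (T := measurableTypeR R) weight.
Proof. by apply: cmeas_real; apply: measurableT_comp => //; exact: measurable_funM. Qed.

Let mweightN : cmeas (T := measurableTypeR R) (fun x => (expR (- (r * x)))%:C).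
Proof.
by apply: cmeas_real; apply: measurableT_comp => //; apply: measurableT_comp => //; exact: measurable_funM.
Qed.

Let weightK x : weight x * (expR (- (r * x)))%:C = 1.
Proof. by rewrite /weight -rmorphM /= -expRD subrr expR0. Qed.

Let conv x := CI n (fun y => weight x * k (y - x)).

Lemma cmeas_conv : cmeas (T := measurableTypeR R) conv.
Proof.
have hw : cmeas (T := (measurableTypeR R * measurableTypeR R)%type)
    (fun z => weight z.1 * k (z.2 - z.1)).
  by apply: cmeasM; [exact: cmeas_comp mfst mweight|exact: cmeas_comp mdiff mk].
exact: (cmeas_CI_param n hw).
Qed.

(** Almost every translate of the kernel is integrable, which suffices to
    take the factor depending on [x] out of the inner integral. *)
Lemma convolution_fubini : [/\
  cint lam (fun z => k z * CI n (fun y => psi (y - z))),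
  cint lam (fun x => psi x * (expR (- (r * x)))%:C * conv x) &
  CI lam (fun x => psi x * (expR (- (r * x)))%:C * conv x) =
  CI lam (fun z => k z * CI n (fun y => psi (y - z)))].
Proof.
have [C C0 hC] := window_bound N gn.
have [a1 a2 a3] := cfubini mg finite_mass.
have [b1 b2 b3] := cfubini mh swap_mass.
have e1 z : CI n (fun y => g (z, y)) = k z * CI n (fun y => psi (y - z)).
  by rewrite /g /= CIZ//; exact: (hC _ _ _ sp).1.
have e2 : {ae lam, forall x, CI n (fun y => h (y, x)) = psi x * (expR (- (r * x)))%:C * conv x}.
  have mnh : measurable_fun (setT : set (measurableTypeR R * measurableTypeR R)) (fun z => (normc (h z))%:E).
    by apply/measurable_EFinP; exact: measurable_normc.
  have inh : (n \x lam)%E.-integrable setT (fun z => (normc (h z))%:E).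
    apply/integrable12ltyP; first exact: mnh.
    rewrite (_ : integral _ _ _ = (\int[n]_y \int[lam]_x (normc (h (y, x)))%:E)%E); first exact: swap_mass.
    by apply: eq_integral => x _; apply: eq_integral => y _; rewrite gee0_abs ?lee_fin ?normc_ge0.
  have /= := ae_integrable2 inh.
  apply: (@filterS _ _ (ae_filter_ringOfSetsType lam)) => x ix.
  have [p0|p0] := eqVneq (psi x) 0.
    by rewrite p0 !mul0r -[RHS](CI0 n); apply: eq_CI => y; rewrite /h /= p0 mul0r.
  have ch : cint n (fun y => h (y, x)).
    apply: (cint_dom _ ix) => //; apply: cmeas_comp mh; exact: measurable_pair2.
  have e y : weight x * k (y - x) = (weight x / psi x) * h (y, x).
    by rewrite /h /= -mulrA mulKf.
  have cw : cint n (fun y => weight x * k (y - x)).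
    by under eq_fun do rewrite e; exact: cintZ.
  rewrite /conv -(CIZ (psi x * (expR (- (r * x)))%:C) cw); apply: eq_CI => y.
  by rewrite /h /= -mulrA (mulrA _ (weight x)) (mulrC _ (weight x)) weightK mul1r.
have mc : cmeas (T := measurableTypeR R) (fun x => psi x * (expR (- (r * x)))%:C * conv x).
  by apply: cmeasM; [apply: cmeasM|exact: cmeas_conv].
have [c1 c2] := ae_CI (cint_meas b2) mc e2 b2.
split; [|exact: c1|].
  rewrite (_ : (fun z => _) = (fun z => CI n (fun y => g (z, y)))); first exact: a1.
  by apply/funext => z; rewrite e1.
rewrite -c2 -b3; transitivity (CI lam (fun z => CI n (fun y => g (z, y)))); last exact: eq_CI.
rewrite a3; apply: eq_CI => y; rewrite -[RHS](CI_sub y).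
  by apply: eq_CI => x; rewrite /h /g /= subKr mulrC.
rewrite /g /=; apply: cmeasM => //.
by apply: cmeas_comp mpsi; exact: measurable_funB.
Qed.

End fubini.

End moderate_growth.

(** * Dilated measures *)

Section dilated_integrals.
Context {R : realType}.
Variables (c : {nonneg R}) (t : {posnum R}).
Implicit Types (p : positive_radon R) (mu : complex_radon R).

Let mdivt : measurable_fun (setT : set (measurableTypeR R)) (divt t).
Proof. exact: measurable_divt. Qed.

Let ge0_integral_dilated p (f : R -> \bar R) :
  measurable_fun (setT : set (measurableTypeR R)) f -> (forall x, 0 <= f x)%E ->
  (\int[dilated_positive c t p]_(x in `]0%R, +oo[) f x =
   c%:num%:E * \int[p]_(x in `]0%R, +oo[) f (x / t%:num)%R)%E.
Proof.
move=> mf f0; set P : set (measurableTypeR R) := `]0, +oo[%classic.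
have mP : measurable P by exact: measurable_itv.
have mfP : measurable_fun (setT : set (measurableTypeR R)) (f \_ P).
  by apply/(measurable_restrictT f mP); exact: measurable_funTS.
have f0P x : (0 <= (f \_ P) x)%E by rewrite /patch; case: ifP.
rewrite [LHS]integral_mkcond.
have same A : measurable A -> dilated_positive c t p A = mscale c (imeas mdivt p) A by [].
rewrite (same_integral same) ge0_integral_mscale//; congr (_ * _)%E.
rewrite (ge0_integral_pushforward mdivt)// preimage_setT [RHS]integral_mkcond.
apply: eq_integral => x _; rewrite /= /patch /divt.
have -> : (x / t%:num \in P) = (x \in P); last by [].
by apply/idP/idP; rewrite !inE /P /= !in_itv /= !andbT pmulr_lgt0 ?invr_gt0.
Qed.

Section supported.
Variables (a b C : R) (f : R -> R).
Hypotheses (a0 : 0 < a) (mf : measurable_fun (setT : set (measurableTypeR R)) f).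
Hypotheses (fC : forall x, `|f x| <= C) (out : forall x, x \notin (`[a, b]%classic : set R) -> f x = 0).

Let mfd : measurable_fun (setT : set (measurableTypeR R)) (fun x => f (x / t%:num)).
Proof. exact: (measurableT_comp mf mdivt). Qed.

Let outd x : x \notin (`[a * t%:num, b * t%:num]%classic : set R) -> f (x / t%:num) = 0.
Proof.
move=> xab; apply: out; apply: contra xab; rewrite !inE /= !in_itv /=.
by rewrite ler_pdivlMr// ler_pdivrMr.
Qed.

Lemma Rintegral_dilated p : \int[dilated_positive c t p]_(x in `]0, +oo[) f x =
  c%:num * \int[p]_(x in `]0, +oo[) f (x / t%:num).
Proof.
have at0 : 0 < a * t%:num by exact: mulr_gt0.
have ip : p.-integrable (`]0, +oo[%classic : set (measurableTypeR R)) (EFin \o (fun x => f (x / t%:num))).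
  have := @integrable_supported _ (a * t%:num) (b * t%:num) C (fun x => f (x / t%:num)) at0 mfd (fun x => fC _) p.
  have mD : measurable (`[a * t%:num, b * t%:num]%classic : set (measurableTypeR R)) by exact: measurable_itv.
  have mP : measurable (`]0, +oo[%classic : set (measurableTypeR R)) by exact: measurable_itv.
  move=> /(integrable_mkcond _ mD) i; apply/(integrable_mkcond _ mP).
  move: i; congr (integrable _ _ _); apply/funext => x; rewrite /patch /=.
  case: ifPn => xD; case: ifPn => xP //; last by rewrite outd.
  move: xP; rewrite mem_set//; move: xD; rewrite inE /= !in_itv /= andbT => /andP[+ _].
  exact: lt_le_trans.
have mEf : measurable_fun (setT : set (measurableTypeR R)) (EFin \o f) by exact/measurable_EFinP.
have fp : (\int[p]_(x in `]0%R, +oo[) ((EFin \o f)^\+ (x / t%:num)%R) \is a fin_num)%E.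
  have := integrable_pos_fin_num _ ip; rewrite (_ : (_ ^\+)%E = (fun x => (EFin \o f)^\+ (x / t%:num)%R)%E).
    by apply; exact: measurable_itv.
  by apply/funext => x; rewrite !funeposE.
have fn : (\int[p]_(x in `]0%R, +oo[) ((EFin \o f)^\- (x / t%:num)%R) \is a fin_num)%E.
  have := integrable_neg_fin_num _ ip; rewrite (_ : (_ ^\-)%E = (fun x => (EFin \o f)^\- (x / t%:num)%R)%E).
    by apply; exact: measurable_itv.
  by apply/funext => x; rewrite !funenegE.
rewrite /Rintegral -[RHS]/(fine c%:num%:E * _) -fineM//; last first.
  by apply: integrable_fin_num => //; exact: measurable_itv.
congr fine; rewrite integralE ge0_integral_dilated//; last exact: measurable_funepos.
rewrite ge0_integral_dilated//; last exact: measurable_funeneg.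
rewrite -muleBr//; last by rewrite fin_num_adde_defr.
congr (_ * _)%E; rewrite [RHS]integralE; congr (_ - _)%E; apply: eq_integral => x _.
  by rewrite !funeposE.
by rewrite !funenegE.
Qed.

End supported.

Lemma comp_dilated mu j : comp (dilated_radon c t mu) j = dilated_positive c t (comp mu j).
Proof. by case: j => [[|[|[|[|//]]]]] h; rewrite /comp /tnth /=. Qed.

Lemma radon_integral_dilated mu phi : test_function phi ->
  radon_integral (dilated_radon c t mu) phi =
  (c%:num)%:C * radon_integral mu (fun x => phi (x / t%:num)).
Proof.
move=> tphi; have [C hC] := test_bounded tphi.
have [a [b [a0 ab out]]] := test_function_support tphi.
case: tphi => c1 c2 _ _.
have m1 := continuous_measurable_fun c1; have m2 := continuous_measurable_fun c2.
have b1 x : `|Re (phi x)| <= C := le_trans (normc_Re _) (hC x).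
have b2 x : `|Im (phi x)| <= C := le_trans (normc_Im _) (hC x).
have o1 x : x \notin (`[a, b]%classic : set R) -> Re (phi x) = 0 by move=> /out ->.
have o2 x : x \notin (`[a, b]%classic : set R) -> Im (phi x) = 0 by move=> /out ->.
rewrite !radon_integral_comp mulr_sumr; apply: eq_bigr => j _.
rewrite mulrCA comp_dilated (Rintegral_dilated a0 m1 b1 o1) (Rintegral_dilated a0 m2 b2 o2).
by congr (_ * _); apply: eqC; rewrite !ReImE /= mul0r ?subr0 ?addr0.
Qed.

End dilated_integrals.

(** * Convolution of a kernel with a complex Radon measure *)

Section radon_convolution.
Context {R : realType}.
Local Notation lam := (@lebesgue_measure R).
Variable u : R -> R.
Hypothesis u_bounded : forall L : R, exists C, forall x y, `|y| <= L -> `|u (x + y) - u x| <= C.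
Variables (r : R) (K : R -> R[i]) (D : R -> R).
Let k z := (expR (r * z))%:C * K (expR z).
Hypothesis mK : cmeas (T := measurableTypeR R) (K \o expR).
Hypothesis iD : lam.-integrable setT (EFin \o D).
Hypothesis kD : forall x z, normc (k z) * expR (u (x + z) - u x) <= D z.
Variable nu : complex_radon R.
Hypothesis gnu : forall j, growth u (tilt r (comp nu j)).
Implicit Types (psi : R -> R[i]).

Let mweight (a : R) : cmeas (T := measurableTypeR R) (fun x => (expR (a * x))%:C).
Proof. by apply: cmeas_real; apply: measurableT_comp => //; exact: measurable_funM. Qed.

Let mk : cmeas (T := measurableTypeR R) k.
Proof. exact: cmeasM. Qed.

(** The tilted measure smoothed by [psi]: spectral analysis applies to functions. *)
Definition pairing psi x := lint r nu (fun y => psi (y - x)).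

Lemma pairing_bound (N : R) : exists2 C, 0 <= C & forall B psi x, supported N B psi ->
  normc (pairing psi x) <= B * C * expR (u x).
Proof.
have h j := @window_bound _ u u_bounded (tilt r (comp nu j)) N (gnu j).
have [C0 hC0] : exists C : 'I_4 -> R, forall j, 0 <= C j /\ forall B psi x, supported N B psi ->
    cint (tilt r (comp nu j)) (fun y => psi (y - x)) /\
    (\int[tilt r (comp nu j)]_y (normc (psi (y - x)))%:E <= (B * C j * expR (u x))%:E)%E.
  have h' j : {C : R | 0 <= C /\ forall B psi x, supported N B psi ->
      cint (tilt r (comp nu j)) (fun y => psi (y - x)) /\
      (\int[tilt r (comp nu j)]_y (normc (psi (y - x)))%:E <= (B * C * expR (u x))%:E)%E}.
    by apply: cid; have [C ? ?] := h j; exists C.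
  by exists (fun j => sval (h' j)) => j; exact: (svalP (h' j)).
exists (\sum_j C0 j) => [|B psi x sp]; first by apply: sumr_ge0 => j _; exact: (hC0 j).1.
rewrite (le_trans (normc_sum _ _ _))// mulr_sumr mulr_suml; apply: ler_sum => j _.
rewrite normcM normc_coef mul1r; have [cp ip] := (hC0 j).2 _ _ x sp.
rewrite (le_trans (CI_le_normc cp))// /Rintegral -lee_fin fineK//.
by apply: integrable_fin_num => //; exact: integrable_normc.
Qed.

Lemma cmeas_pairing (N B : R) psi : supported N B psi -> cmeas (T := measurableTypeR R) (pairing psi).
Proof.
move=> sp; apply: cmeas_sum => j; apply: cmeasM; first exact: cmeas_cst.
exact: cmeas_translates sp.
Qed.

Lemma cint_translate j (N B : R) psi x : supported N B psi ->
  cint (tilt r (comp nu j)) (fun y => psi (y - x)).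
Proof. by move=> sp; have [C _ h] := @window_bound _ u u_bounded (tilt r (comp nu j)) N (gnu j); have [] := h _ _ x sp. Qed.

Let PsiE x : Psi K nu (expR x) = \sum_j coef j *
  CI (tilt r (comp nu j)) (fun y => (expR (r * x))%:C * k (y - x)).
Proof.
have e y : expR y / expR x = expR (y - x) by rewrite expRD expRN.
rewrite /Psi (radon_integral_lint r); last first.
  rewrite (_ : _ \o _ = (fun y => (K \o expR) (y - x))); last by apply/funext => y /=; rewrite e.
  by apply: cmeas_comp mK; exact: measurable_funB.
apply: eq_bigr => j _; congr (_ * _); apply: eq_CI => y.
by rewrite e /k mulrA -rmorphM /= -expRD; congr ((expR _)%:C * _); ring.
Qed.

Lemma cmeas_Psi : cmeas (T := measurableTypeR R) (Psi K nu \o expR).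
Proof.
rewrite (_ : _ \o _ = fun x => \sum_j coef j *
  CI (tilt r (comp nu j)) (fun y => (expR (r * x))%:C * k (y - x))); last first.
  by apply/funext => x /=; exact: PsiE.
by apply: cmeas_sum => j; apply: cmeasM; [exact: cmeas_cst|exact: cmeas_conv].
Qed.

Lemma Psi_fubini (N B : R) psi : supported N B psi -> [/\
  cint lam (fun z => k z * pairing psi z),
  cint lam (fun x => psi x * (expR (- (r * x)))%:C * Psi K nu (expR x)) &
  CI lam (fun x => psi x * (expR (- (r * x)))%:C * Psi K nu (expR x)) =
  CI lam (fun z => k z * pairing psi z)].
Proof.
move=> sp; have F j := @convolution_fubini _ u u_bounded k D mk iD kD (tilt r (comp nu j)) r N B psi (gnu j) sp.
have e1 z : k z * pairing psi z =
    \sum_j coef j * (k z * CI (tilt r (comp nu j)) (fun y => psi (y - z))).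
  by rewrite /pairing /lint mulr_sumr; apply: eq_bigr => j _; rewrite mulrCA.
have e2 x : psi x * (expR (- (r * x)))%:C * Psi K nu (expR x) =
    \sum_j coef j * (psi x * (expR (- (r * x)))%:C *
      CI (tilt r (comp nu j)) (fun y => (expR (r * x))%:C * k (y - x))).
  by rewrite PsiE mulr_sumr; apply: eq_bigr => j _; rewrite mulrCA.
rewrite (funext e1) (funext e2).
have c1 j : cint lam (fun z => coef j * (k z * CI (tilt r (comp nu j)) (fun y => psi (y - z)))).
  by apply: cintZ; case: (F j).
have c2 j : cint lam (fun x => coef j * (psi x * (expR (- (r * x)))%:C *
    CI (tilt r (comp nu j)) (fun y => (expR (r * x))%:C * k (y - x)))).
  by apply: cintZ; case: (F j).
split; [exact: cint_sum|exact: cint_sum|].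
rewrite (CI_sum _ c1) (CI_sum _ c2); apply: eq_bigr => j _.
by have [i1 i2 i3] := F j; rewrite (CIZ _ i1) (CIZ _ i2) i3.
Qed.

End radon_convolution.

(** * Total variation and growth *)

Section variation.
Context {R : realType}.
Implicit Types (mu nu : complex_radon R) (A C : set (measurableTypeR R)).

(** Partition [A] into [C] and its complement. *)
Lemma variation_ge mu A C : measurable A -> measurable C -> C `<=` A ->
  ((normc (cvalue mu C))%:E <= radon_variation mu A)%E.
Proof.
move=> mA mC CA; pose B (i : 'I_2) := if i == ord0 then C else A `\` C.
apply: (@le_trans _ _ (\sum_(i < 2) normc (cvalue mu (B i)))%:E).
  by rewrite lee_fin big_ord_recl {1}/B eqxx lerDl sumr_ge0// => i _; exact: normc_ge0.
apply: ereal_sup_ubound; exists 2, B; split => //.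
- by move=> i; rewrite /B; case: ifP => // _; exact: measurableD.
- apply/trivIsetP => i j _ _; rewrite /B.
  case: i => [[|[|//]]] hi; case: j => [[|[|//]]] hj //= _.
    by rewrite setIDA setIC -setIDA setDv setI0.
  by rewrite setIC setIDA setIC -setIDA setDv setI0.
- apply/seteqP; split => [x [i _]|x Ax].
    by rewrite /B; case: ifP => _; [exact: CA|case].
  have [Cx|nCx] := pselect (C x).
    by exists ord0 => //=; rewrite /B eqxx.
  by exists (lift ord0 ord0) => //=; split.
Qed.

Let real_part_of_value (m : real_radon R) A (i : bool) : relcompact_borel A ->
  exists C, [/\ measurable C, C `<=` A &
    fine ((if i then rpos m else rneg m) A) <= `|rvalue m C|].
Proof.
move=> rA; have [S [mS pS nS]] := rsing m; have mA : measurable A by case: rA.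
have mD (p : positive_radon R) (T : set (measurableTypeR R)) : measurable T -> p T = 0%E ->
    p (A `\` T) = p A /\ p (A `&` T) = 0%E.
  move=> mT T0; have z : p (A `&` T) = 0%E.
    apply/eqP; rewrite eq_le measure_ge0 andbT -T0; apply: le_measure; rewrite ?inE//.
    exact: measurableI.
  split; last exact: z.
  have pf : (p A < +oo)%E by rewrite -ge0_fin_numE// pradon_fin_num.
  have -> : p (A `\` T) = (p A - p (A `&` T))%E by exact: measureD.
  by rewrite z sube0.
have mSC : measurable (~` S) by exact: measurableC.
case: i => /=.
  exists (A `\` S); split; [exact: measurableD|exact: subDsetl|].
  rewrite /rvalue (mD _ _ mS pS).1.
  have := (mD _ _ mSC nS).2; rewrite -setDE => ->.
  by rewrite subr0 ler_norm.
exists (A `\` ~` S); split; [exact: measurableD|exact: subDsetl|].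
rewrite /rvalue (mD _ _ mSC nS).1 setDE setCK (mD _ _ mS pS).2.
by rewrite sub0r normrN ler_norm.
Qed.

(** The components are recovered from the values on subsets, because the
    positive and negative parts live on disjoint sets. *)
Lemma comp_le_cvalue mu j A : relcompact_borel A -> exists C, [/\ measurable C, C `<=` A &
  fine (comp mu j A) <= normc (cvalue mu C)].
Proof.
move=> rA.
have [i [c ->]] : exists i c, comp mu j =
    (if i then rpos (if c then cre mu else cim mu) else rneg (if c then cre mu else cim mu)).
  case: j => [[|[|[|[|//]]]]] h; rewrite /comp /tnth /=.
  - by exists true, true. - by exists false, true.
  - by exists true, false. - by exists false, false.
have [C [mC Cab h]] := real_part_of_value (if c then cre mu else cim mu) i rA.
exists C; split => //; apply: (le_trans h).
case: (c); first exact: (normc_Re (cvalue mu C)).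
exact: (normc_Im (cvalue mu C)).
Qed.

Lemma relcompact_segment (a b : R) : 0 < a -> relcompact_borel (`[a, b]%classic : set R).
Proof. by move=> a0; split; [exact: measurable_itv|exists a, b; split]. Qed.

Lemma growth_of_itv (u : R -> R) (r G : R) (p : positive_radon R) : 0 <= G ->
  (forall x, p `[expR x, expR (x + 1)]%classic <= (G * expR (r * x + u x))%:E)%E ->
  growth u (tilt r p).
Proof.
move=> G0 h; exists (expR `|r| * G) => [|x]; first by rewrite mulr_ge0 ?expR_ge0.
apply: (@le_trans _ _ ((expR (`|r| - r * x))%:E * p `[expR x, expR (x + 1)]%classic)%E).
  apply: tilt_itv_le => [|y /andP[xy yx]]; first exact: expR_ge0.
  rewrite ler_expR lerBrDr (_ : - (r * y) + r * x = r * (x - y)); last by ring.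
  rewrite (le_trans (ler_norm _))// normrM -[leRHS]mulr1 ler_wpM2l//.
  by rewrite ler_norml; apply/andP; split; lra.
apply: (@le_trans _ _ ((expR (`|r| - r * x))%:E * (G * expR (r * x + u x))%:E)%E).
  by rewrite lee_wpmul2l ?lee_fin ?expR_ge0.
rewrite -EFinM lee_fin le_eqVlt; apply/orP; left; apply/eqP.
rewrite !expRD expRN; move: (expR `|r|) (expR (u x)) => e1 e2.
by field; rewrite gt_eqF ?expR_gt0.
Qed.

(** The growth hypothesis bounds the total variation; the convolution estimates
    need a bound on each positive component. *)
Lemma comp_le_variation mu j (a b : R) : 0 < a ->
  (comp mu j `[a, b]%classic <= radon_variation mu `[a, b]%classic)%E.
Proof.
move=> a0; have [C [mC Cab h]] := comp_le_cvalue mu j (relcompact_segment b a0).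
apply: le_trans (variation_ge mu (measurable_itv _) mC Cab).
have rab := relcompact_segment b a0.
by rewrite -(fineK (pradon_fin_num (comp mu j) rab)) lee_fin.
Qed.

Lemma growth_of_class rho mu : proximate_order rho -> radon_class rho mu ->
  forall j, growth (slow rho) (tilt (order_at_infty rho) (comp mu j)).
Proof.
move=> prho cl j; set r := order_at_infty rho.
pose G := radon_growth rho mu `]0, +oo[.
have G0 : (0 <= G)%E.
  apply: le_trans (ereal_sup_ubound _); last by exists 1 => //=; rewrite in_itv /= ltr01.
  rewrite mule_ge0 ?lee_fin ?prox_weightV_ge0//.
  have m1 : measurable (`[1, (expR 1 * 1)%R]%classic : set (measurableTypeR R)) by exact: measurable_itv.
  apply: le_trans (variation_ge mu m1 measurable0 (@sub0set _ _)).
  by rewrite lee_fin normc_ge0.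
have Gfin : G \is a fin_num by rewrite ge0_fin_numE.
apply: (@growth_of_itv _ _ (fine G)) => [|x]; first exact: fine_ge0.
have e0 : 0 < expR x by exact: expR_gt0.
  have hG : (radon_variation mu `[expR x, (expR 1 * expR x)%R]%classic * ((prox_weight rho (expR x))^-1)%:E <= G)%E.
    by apply: ereal_sup_ubound; exists (expR x) => //=; rewrite in_itv /= e0.
  have w0 : 0 < prox_weight rho (expR x) by rewrite prox_weight_exp// expR_gt0.
  rewrite EFinM fineK// -prox_weight_exp//.
  rewrite -lee_pdivrMr//.
  apply: le_trans hG; have -> : expR 1 * expR x = expR (x + 1) by rewrite mulrC -expRD.
  by apply: lee_wpmul2r; [rewrite lee_fin invr_ge0 ltW|exact: comp_le_variation].
Qed.

End variation.

(** * The kernel in logarithmic coordinates *)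

Section log_kernel.
Context {R : realType}.
Local Notation lam := (@lebesgue_measure R).

Definition log_kernel (r : R) (K : R -> R[i]) z := (expR (r * z))%:C * K (expR z).

Lemma cmeas_exp (K : R -> R[i]) : cmeasurable `]0, +oo[ K -> cmeas (T := measurableTypeR R) (K \o expR).
Proof. by move=> [m1 m2]; split; [exact: (measurable_exp m1)|exact: (measurable_exp m2)]. Qed.

Lemma cmeasurable_of_exp (f : R -> R[i]) : cmeas (T := measurableTypeR R) (f \o expR) ->
  cmeasurable `]0, +oo[ f.
Proof.
move=> [m1 m2]; have mP : measurable (`]0, +oo[%classic : set (measurableTypeR R)) by exact: measurable_itv.
have l t : t \in (`]0, +oo[%classic : set R) -> expR (ln t) = t.
  by rewrite inE /= in_itv /= andbT => t0; rewrite lnK.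
split.
  apply: (eq_measurable_fun (fun t => Re (f (expR (ln t))))); first by move=> t /l ->.
  apply: measurable_funTS; exact: (measurableT_comp m1 (@measurable_ln R)).
apply: (eq_measurable_fun (fun t => Im (f (expR (ln t))))); first by move=> t /l ->.
apply: measurable_funTS; exact: (measurableT_comp m2 (@measurable_ln R)).
Qed.

Lemma cmeas_log_kernel r (K : R -> R[i]) : cmeasurable `]0, +oo[ K ->
  cmeas (T := measurableTypeR R) (log_kernel r K).
Proof.
move=> mK; apply: cmeasM; last exact: cmeas_exp.
by apply: cmeas_real; apply: measurableT_comp => //; exact: measurable_funM.
Qed.

Section condition.
Variables (rho : R -> R) (K : R -> R[i]).
Hypotheses (prho : proximate_order rho) (mK : cmeasurable `]0, +oo[ K).
Hypothesis cK : kernel_condition rho K.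
Let r := order_at_infty rho.

Let part (f : R -> R) : measurable_fun (`]0, +oo[%classic : set (measurableTypeR R)) f ->
  lam.-integrable (`]0%R, +oo[ : set (measurableTypeR R))
    (fun t => (t `^ (r - 1))%:E * prox_gamma rho t * (f t)%:E)%E ->
  lam.-integrable setT (EFin \o (fun x => expR (r * x) * fine (prox_gamma rho (expR x)) * f (expR x))).
Proof.
move=> mf i; pose g t := t `^ (r - 1) * fine (prox_gamma rho t) * f t.
have ge t : t \in (`]0, +oo[%classic : set R) ->
    ((t `^ (r - 1))%:E * prox_gamma rho t * (f t)%:E = (g t)%:E)%E.
  rewrite inE /= in_itv /= andbT => t0.
  by rewrite -{2}(lnK (t0 : t \in Num.pos)) -(fineK (prox_gamma_fin prho (ln t))) lnK.
have mP : measurable (`]0, +oo[%classic : set (measurableTypeR R)) by exact: measurable_itv.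
have ig : lam.-integrable (`]0%R, +oo[ : set (measurableTypeR R)) (EFin \o g).
  by apply: eq_integrable i => // t /ge.
have mg : measurable_fun (`]0, +oo[%classic : set (measurableTypeR R)) g.
  by apply/measurable_EFinP; exact: measurable_int ig.
have := (integrable_exp (measurable_exp mg) mg).1 ig.
apply: eq_integrable => // x _ /=; congr EFin.
rewrite /g /powR gt_eqF ?expR_gt0// expRK !mulrA -expRD.
by congr (expR _ * _ * _); ring.
Qed.

Definition log_bound z := expR (r * z) * fine (prox_gamma rho (expR z)) *
  (`|Re (K (expR z))| + `|Im (K (expR z))|).

Let gamma_ge0 z : 0 <= fine (prox_gamma rho (expR z)).
Proof. by apply: fine_ge0; apply: le_trans (prox_gamma_ge1 prho z). Qed.

Lemma integrable_log_bound : lam.-integrable setT (EFin \o log_bound).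
Proof.
have i1 := integrable_norm (part mK.1 cK.1).
have i2 := integrable_norm (part mK.2 cK.2).
have := integrableD measurableT i1 i2; apply: eq_integrable => // x _ /=.
rewrite -EFinD /log_bound !normrM !(ger0_norm (expR_ge0 _)) !(ger0_norm (gamma_ge0 _)).
by rewrite mulrDr.
Qed.

(** This is where [gamma] enters: it is the supremum of the exponential factors over [x],
    hence one integrable function dominates the kernel with every weight. *)
Lemma log_kernel_le x z :
  normc (log_kernel r K z) * expR (slow rho (x + z) - slow rho x) <= log_bound z.
Proof.
rewrite /log_kernel normcM normc_real ger0_norm ?expR_ge0// -mulrA /log_bound -mulrA.
rewrite ler_wpM2l ?expR_ge0// mulrC ler_pM ?expR_ge0 ?normc_ge0 ?normc_le//.
by rewrite -lee_fin fineK ?prox_gamma_fin// prox_gamma_ge.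
Qed.

Lemma log_kernel_le0 z : normc (log_kernel r K z) <= log_bound z.
Proof.
rewrite /log_kernel normcM normc_real ger0_norm ?expR_ge0// /log_bound -mulrA.
rewrite ler_wpM2l ?expR_ge0// -[leLHS]mul1r ler_pM ?normc_ge0 ?normc_le//.
by rewrite -lee_fin fineK ?prox_gamma_fin// prox_gamma_ge1.
Qed.

Lemma cint_log_kernel : cint lam (log_kernel r K).
Proof. exact: cint_dom (cmeas_log_kernel r mK) integrable_log_bound log_kernel_le0. Qed.

(** The zeros of the Mellin transform of [K] on the line are those of the
    Fourier transform of the logarithmic kernel. *)
Lemma kernel_zerosE l : kernel_zeros rho K l <-> fourier (log_kernel r K) l = 0.
Proof.
rewrite /kernel_zeros /= -/r.
suff -> : cintegral `]0, +oo[ (fun t => K t * cpow t ((r - 1) +i* (- l))) = fourier (log_kernel r K) l by [].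
have e x : K (expR x) * cpow (expR x) ((r - 1) +i* (- l)) =
    (expR (- x))%:C * (log_kernel r K x * expi (- (l * x))).
  rewrite /cpow /powR gt_eqF ?expR_gt0//= expRK /log_kernel mulrBl mul1r expRD rmorphM /=.
  rewrite /expi mulNr; ring.
have mexp : cmeas (T := measurableTypeR R)
    ((fun t => K t * cpow t ((r - 1) +i* (- l))) \o expR).
  rewrite (_ : _ \o _ = (fun x => (expR (- x))%:C * (log_kernel r K x * expi (- (l * x))))); last first.
    by apply/funext => x /=; rewrite e.
  apply: cmeasM.
    by apply: cmeas_real; apply: measurableT_comp => //; exact: measurableT_comp.
  apply: cmeasM; first exact: cmeas_log_kernel.
  rewrite (_ : (fun x => _) = (fun x => expi ((- l) * x))); first exact: cmeas_expi.
  by apply/funext => x; rewrite mulNr.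
have key x (z : R[i]) : expR x * Re ((expR (- x))%:C * z) = Re z /\ expR x * Im ((expR (- x))%:C * z) = Im z.
  by rewrite !ReImE /= !mul0r subr0 addr0 !mulrA -!expRD subrr expR0 !mul1r.
rewrite /cintegral /fourier /CI /Rintegral.
rewrite (integral_exp (f := fun t => Re (K t * cpow t ((r - 1) +i* (- l))))); last exact: mexp.1.
rewrite (integral_exp (f := fun t => Im (K t * cpow t ((r - 1) +i* (- l))))); last exact: mexp.2.
by apply: eqC => /=; congr fine; apply: eq_integral => x _; rewrite e ?(key _ _).1 ?(key _ _).2.
Qed.

End condition.

Lemma test_supported phi (a : R) : test_function phi -> exists N B,
  supported N B (fun x => (expR (a * x))%:C * phi (expR x)) /\
  ccontinuous (fun x => (expR (a * x))%:C * phi (expR x)).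
Proof.
move=> tphi; have [C hC] := test_bounded tphi.
have [c [d [c0 cd out]]] := test_function_support tphi.
case: tphi => c1 c2 _ _; pose N := `|ln c| + `|ln d|.
have N0 : 0 <= N by rewrite addr_ge0.
have far y : N < `|y| -> phi (expR y) = 0.
  move=> Ny; apply: out; apply/negP; rewrite inE /= in_itv /= => /andP[h1 h2].
  move: Ny; rewrite ltNge => /negP; apply.
  have l1 : ln c <= y by rewrite -[leRHS]expRK ler_ln ?posrE ?expR_gt0.
  have l2 : y <= ln d by rewrite -[leLHS]expRK ler_ln ?posrE ?expR_gt0// (lt_le_trans c0).
  have := ler_norm (ln d); have := ler_norm (- ln c); rewrite normrN => n1 n2.
  have a0 : 0 <= `|ln c| by []. have b0 : 0 <= `|ln d| by [].
  by rewrite /N ler_norml; apply/andP; split; lra.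
have cexp : ccontinuous (fun x => (expR (a * x))%:C : R[i]).
  split => x /=; last exact: cst_continuous.
  by apply: (@continuous_comp _ _ _ (fun x : R => a * x)); [exact: continuous_mulZ|exact: continuous_expR].
have cphi : ccontinuous (fun x => phi (expR x)).
  split => x.
    by apply: (@continuous_comp _ _ _ (@expR R) (fun t => Re (phi t))); [exact: continuous_expR|exact: c1].
  by apply: (@continuous_comp _ _ _ (@expR R) (fun t => Im (phi t))); [exact: continuous_expR|exact: c2].
have cc := ccontinuousM cexp cphi.
exists N, (expR (`|a| * N) * `|C|); split => //; split.
- exact: ccontinuous_cmeas.
- move=> y; have [yN|Ny] := leP `|y| N; last first.
    by rewrite far// mulr0 normc0 mulr_ge0 ?expR_ge0.
  rewrite normcM normc_real ger0_norm ?expR_ge0// ler_pM ?expR_ge0 ?normc_ge0//.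
    rewrite ler_expR (le_trans (ler_norm _))// normrM ler_wpM2l//.
  by rewrite (le_trans (hC _))// ler_norm.
- by move=> y /far ->; rewrite mulr0.
Qed.

Section convolved.
Variables (u : R -> R) (r : R) (K : R -> R[i]) (D : R -> R) (nu : complex_radon R).
Hypothesis u_bounded : forall L : R, exists C, forall x y, `|y| <= L -> `|u (x + y) - u x| <= C.
Hypothesis mK : cmeasurable `]0, +oo[ K.
Hypothesis iD : lam.-integrable setT (EFin \o D).
Hypothesis kD : forall x z, normc (log_kernel r K z) * expR (u (x + z) - u x) <= D z.
Hypothesis gnu : forall j, growth u (tilt r (comp nu j)).

Let mKe : cmeas (T := measurableTypeR R) (K \o expR). Proof. exact: cmeas_exp. Qed.

Lemma Psi_cmeasurable : cmeasurable `]0, +oo[ (Psi K nu).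
Proof. by apply: cmeasurable_of_exp; exact: cmeas_Psi. Qed.

Lemma Psi_cintegrable (a b : R) : 0 < a -> cintegrable `[a, b] (Psi K nu).
Proof.
move=> a0; pose I : set R := `[a, b]%classic.
pose psi (x : R) : R[i] := (expR ((r + 1) * x) * \1_I (expR x))%:C.
pose N := `|ln a| + `|ln b|.
have sp : supported N (expR (`|r + 1| * N)) psi.
  have mI : measurable (I : set (measurableTypeR R)) by exact: measurable_itv.
  have far y : N < `|y| -> \1_I (expR y) = 0 :> R.
    move=> Ny; rewrite indicE memNset// /I /= in_itv /= => /andP[h1 h2].
    move: Ny; rewrite ltNge => /negP; apply.
    have b0 : 0 < b by rewrite (lt_le_trans _ h2)// expR_gt0.
    have l1 : ln a <= y by rewrite -[leRHS]expRK ler_ln ?posrE ?expR_gt0.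
    have l2 : y <= ln b by rewrite -[leLHS]expRK ler_ln ?posrE ?expR_gt0.
    have := ler_norm (ln b); have := ler_norm (- ln a); rewrite normrN => n1 n2.
    have p0 : 0 <= `|ln a| by []. have q0 : 0 <= `|ln b| by [].
    by rewrite /N ler_norml; apply/andP; split; lra.
  split.
  - apply: cmeas_real; apply: measurable_funM.
      by apply: measurableT_comp => //; exact: measurable_funM.
    have mi : measurable_fun (setT : set (measurableTypeR R)) (\1_I : R -> R).
      exact: measurable_indic.
    exact: (measurableT_comp mi (@measurable_expR R)).
  - move=> y; rewrite /psi normc_real; have [yN|Ny] := leP `|y| N; last first.
      by rewrite far// mulr0 normr0 expR_ge0.
    rewrite normrM -[leRHS]mulr1 ler_pM//; last first.
      by rewrite indicE; case: (_ \in _); rewrite /= ?normr1 ?normr0.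
    rewrite ger0_norm ?expR_ge0// ler_expR (le_trans (ler_norm _))// normrM ler_wpM2l//.
  - by move=> y /far; rewrite /psi => ->; rewrite mulr0.
have [_ + _] := Psi_fubini u_bounded mKe iD kD gnu sp.
have e x : psi x * (expR (- (r * x)))%:C = (expR x * \1_I (expR x))%:C.
  rewrite /psi -rmorphM /= mulrAC -expRD; congr ((expR _ * _)%:C); ring.
under eq_fun do rewrite e.
have [m1 m2] := Psi_cmeasurable.
have mP : measurable (`]0, +oo[%classic : set (measurableTypeR R)) by exact: measurable_itv.
have mI : measurable (I : set (measurableTypeR R)) by exact: measurable_itv.
have IP : I `<=` `]0, +oo[.
  by move=> x; rewrite /I /= !in_itv /= andbT => /andP[+ _]; exact: lt_le_trans.
have back (f : R -> R) : measurable_fun (`]0, +oo[%classic : set (measurableTypeR R)) f ->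
    lam.-integrable setT (EFin \o (fun x => expR x * (\1_I (expR x) * f (expR x)))) ->
    lam.-integrable (I : set (measurableTypeR R)) (EFin \o f).
  move=> mf i; pose g t := \1_I t * f t.
  have mg : measurable_fun (`]0, +oo[%classic : set (measurableTypeR R)) g.
    by apply: measurable_funM => //; apply: measurable_funTS; exact: measurable_indic.
  have ig := (integrable_exp (measurable_exp mg) mg).2 i.
  have := integrableS mP mI IP ig; apply: eq_integrable => // t tI.
  by rewrite /= /g indicE tI mul1r.
move=> [i1 i2]; split; apply: back => //.
  by apply: eq_integrable i1 => // x _; rewrite !ReImE /= mul0r subr0 mulrA.
by apply: eq_integrable i2 => // x _; rewrite !ReImE /= mul0r addr0 mulrA.
Qed.

(** The density may be replaced by the measure built in [radon_of_density], for which
    integrals of test functions are computed in logarithmic coordinates; then Fubini's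
    theorem applies. *)
Lemma radon_integral_Psi (d : complex_radon R) phi : has_density d (Psi K nu) ->
  test_function phi -> radon_integral d phi = CI lam (fun z => log_kernel r K z *
    pairing r nu (fun x => (expR ((r + 1) * x))%:C * phi (expR x)) z).
Proof.
move=> hd tphi; have [N [B [sp _]]] := test_supported (r + 1) tphi.
have [_ i <-] := Psi_fubini u_bounded mKe iD kD gnu sp.
have [d' [[_ _ hd'] _ di]] := radon_of_density Psi_cmeasurable Psi_cintegrable.
have dd' : radon_eq d d' by case: hd => _ _ h A rA; rewrite h// hd'.
rewrite (radon_integral_eq dd' tphi) di//; apply: eq_CI => x.
have -> : (expR x)%:C = (expR ((r + 1) * x))%:C * (expR (- (r * x)))%:C :> R[i].
  by rewrite -rmorphM /= -expRD; congr ((expR _)%:C); ring.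
by ring.
Qed.

End convolved.

End log_kernel.

(** * Averages over long windows *)

Section averaging.
Context {R : realType}.
Local Notation lam := (@lebesgue_measure R).

Let half_bound (X m t a c n e : R) : X * (n / 2) <= 8 * a * c * m + 8 * n * c * t ->
  32 * a * c * m <= n * e -> 32 * n * c * t <= n * e -> n * X <= n * e.
Proof. by move=> h1 h2 h3; lra. Qed.

Lemma ccvg_le (a : nat -> R[i]) (l : R[i]) (b : R) (n0 : nat) : ccvg a l ->
  (forall n, (n0 <= n)%N -> normc (a n) <= b) -> normc l <= b.
Proof.
move=> [c1 c2] h; apply/ler_addgt0Pr => e e0; have e2 : 0 < e / 2 by rewrite divr_gt0.
move/cvgrPdist_le : c1 => /(_ _ e2)[N1 _ h1].
move/cvgrPdist_le : c2 => /(_ _ e2)[N2 _ h2].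
pose n := maxn n0 (maxn N1 N2).
have hn : (n0 <= n)%N by rewrite leq_maxl.
have n1 : (N1 <= n)%N by rewrite !leq_max leqnn orbT.
have n2 : (N2 <= n)%N by rewrite !leq_max leqnn !orbT.
have -> : l = a n + (l - a n) by rewrite addrC subrK.
rewrite (le_trans (normcD _ _))// lerD ?h// (le_trans (normc_le _))// (splitr e).
by rewrite !ReImE lerD ?h1 ?h2.
Qed.

Lemma ccvgM (a b : nat -> R[i]) (l m : R[i]) : ccvg a l -> ccvg b m ->
  ccvg (fun n => a n * b n) (l * m).
Proof.
move=> [a1 a2] [b1 b2]; split; (under eq_fun do rewrite !ReImE); rewrite !ReImE.
  by apply: cvgB; exact: cvgM.
by apply: cvgD; exact: cvgM.
Qed.

Lemma ccvg_shift (a : nat -> R[i]) (l : R[i]) n0 : ccvg a l -> ccvg (fun n => a (n0 + n)%N) l.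
Proof.
have S (b : nat -> R) (m : R) : b n @[n --> \oo] --> m -> b (n0 + n)%N @[n --> \oo] --> m.
  move/cvgrPdist_le => h; apply/cvgrPdist_le => e e0; have [N _ hN] := h e e0.
  by exists N => // n /= Nn; apply: hN => /=; rewrite (leq_trans Nn)// leq_addl.
by move=> [c1 c2]; split; [exact: (S _ _ c1)|exact: (S _ _ c2)].
Qed.

Lemma ccvg_real (a : nat -> R) (l : R) : a n @[n --> \oo] --> l ->
  ccvg (fun n => (a n)%:C) l%:C.
Proof. by move=> h; split => //=; exact: cvg_cst. Qed.

Lemma cint_real (f : R -> R) : lam.-integrable setT (EFin \o f) -> cint lam (fun x => (f x)%:C).
Proof. by move=> i; split => //=; exact: integrable0. Qed.

(** The averaging weight.  That it is Lipschitz with constant [1 / N] makes the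
    averages vary slowly, which the indicator of the window would give only up to
    boundary terms. *)
Definition tent (N x : R) := Num.max 0 (1 - `|x| / N).

Section tent.
Variable N : R.
Hypothesis N0 : 0 < N.

Lemma tent_ge0 x : 0 <= tent N x. Proof. by rewrite le_max lexx. Qed.
Lemma tent_le1 x : tent N x <= 1.
Proof. by rewrite ge_max ler01 /= gerBl divr_ge0// ltW. Qed.
Lemma tent_out x : N < `|x| -> tent N x = 0.
Proof.
by move=> Nx; rewrite /tent max_l// subr_le0 ler_pdivlMr// mul1r ltW.
Qed.
Lemma tent_indic x : tent N x <= \1_(`[- N, N]) x.
Proof.
have [xN|Nx] := leP `|x| N; last by rewrite tent_out// indicE; case: (_ \in _).
by rewrite indicE mem_set ?tent_le1//= in_itv /= -ler_norml.
Qed.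
Lemma tent_lip x y : `|tent N x - tent N y| <= `|x - y| / N.
Proof.
have L (a b : R) : `|Num.max 0 a - Num.max 0 b| <= `|a - b|.
  wlog ab : a b / a <= b.
    by move=> h; case/orP: (le_total a b) => ab; [|rewrite distrC (distrC a)]; exact: h.
  have m : Num.max 0 a <= Num.max 0 b by rewrite ge_max !le_max lexx ab orbT.
  rewrite distrC ger0_norm ?subr_ge0// distrC ger0_norm ?subr_ge0//.
  rewrite lerBlDr ge_max; apply/andP; split.
    by rewrite addr_ge0 ?subr_ge0// le_max lexx.
  by rewrite -lerBlDl opprB addrCA subrr addr0 le_max lexx orbT.
rewrite (le_trans (L _ _))// (_ : 1 - `|x| / N - (1 - `|y| / N) = (`|y| - `|x|) / N); last by ring.
have Ni : 0 <= N^-1 by rewrite invr_ge0 ltW.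
rewrite normrM (ger0_norm Ni) ler_wpM2r//.
by rewrite (le_trans (ler_dist_dist _ _))// distrC.
Qed.
Lemma continuous_tent : continuous (tent N).
Proof.
move=> x; apply: (continuous_max (f := fun=> 0) (g := fun x : R => 1 - `|x| / N)); first exact: cst_continuous.
apply: cvgB; first exact: cvg_cst; apply: cvgM; last exact: cvg_cst.
exact: norm_continuous.
Qed.
Lemma measurable_tent : measurable_fun (setT : set (measurableTypeR R)) (tent N).
Proof. exact: continuous_measurable_fun continuous_tent. Qed.

Let indic_int (a : R) : 0 <= a -> lam.-integrable setT (EFin \o (fun x => \1_(`[- a, a]) x : R)) /\
  \int[lam]_x (\1_(`[- a, a]) x : R) = 2 * a.
Proof.
move=> a0; have e : (\int[lam]_x (\1_(`[- a, a]) x)%:E = (2 * a)%:E)%E.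
  transitivity (lam `[- a, a]%classic); first by rewrite integral_indic// setIT.
  rewrite lebesgue_measure_itv /= lte_fin.
  case: ltP => h; first by rewrite -EFinB; congr EFin; ring.
  have a00 : a = 0 by lra.
  by rewrite a00 mulr0.
split; last by rewrite /Rintegral e.
apply/integrableP; split; first by apply/measurable_EFinP; exact: measurable_indic.
rewrite (_ : integral _ _ _ = (2 * a)%:E) ?ltry// -e.
by apply: eq_integral => x _; rewrite gee0_abs// lee_fin.
Qed.

Lemma integrable_window (a c : R) : 0 <= a ->
  lam.-integrable setT (EFin \o (fun x => c * \1_(`[- a, a]) x)) /\
  \int[lam]_x (c * \1_(`[- a, a]) x) = c * (2 * a).
Proof.
move=> a0; have [i e] := indic_int a0; split; last by rewrite RintegralZl// e.
by have := integrableZl measurableT c i; exact: eq_integrable.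
Qed.

Lemma integrable_tent : lam.-integrable setT (EFin \o tent N).
Proof.
have [i _] := indic_int (ltW N0); apply: (le_integrable _ _ _ i) => //.
  by apply/measurable_EFinP; exact: measurable_tent.
move=> x _ /=; rewrite lee_fin !ger0_norm ?tent_ge0//; exact: tent_indic.
Qed.

Lemma tent_mass : N / 2 <= \int[lam]_x tent N x.
Proof.
have N2 : 0 <= N / 2 by rewrite divr_ge0// ltW.
have [i e] := integrable_window (2^-1) N2.
rewrite (_ : N / 2 = 2^-1 * (2 * (N / 2))); last by field.
rewrite -e; apply: le_Rintegral => //; first exact: integrable_tent.
move=> x _; rewrite indicE; case: (boolP (x \in _)) => xN; last by rewrite mulr0 tent_ge0.
move: xN; rewrite inE /= in_itv /= -ler_norml mulr1 => xN.
rewrite le_max; apply/orP; right; rewrite lerBrDr -lerBrDl.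
by rewrite ler_pdivrMr//; lra.
Qed.

End tent.

(** Subtracting the constant [q] costs nothing against a kernel of integral zero. *)
Lemma split_bound (k Q : R -> R[i]) (q : R[i]) (D : R -> R) (a b A : R) :
  cint lam (fun z => k z * Q z) -> cint lam k -> CI lam k = 0 ->
  lam.-integrable setT (EFin \o D) -> (forall z, 0 <= D z) -> 0 <= a ->
  (forall z, `|z| <= A -> normc (k z * Q z - q * k z) <= a * D z) ->
  (forall z, A < `|z| -> normc (k z * Q z - q * k z) <= b * D z) ->
  normc (CI lam (fun z => k z * Q z)) <=
  a * \int[lam]_z D z + b * tail (fun z => (D z)%:C) A.
Proof.
move=> f2 ck k0 iD D0 a0 hin hout.
have cq : cint lam (fun z => q * k z) := cintZ q ck.
have -> : CI lam (fun z => k z * Q z) = CI lam (fun z => k z * Q z - q * k z).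
  by rewrite (CIB f2 cq) (CIZ _ ck) k0 mulr0 subr0.
pose T z := normc (D z)%:C * (A < `|z : R|)%R%:R.
have iT : lam.-integrable setT (EFin \o T) := integrable_tail A (cint_real iD).
have i1 : lam.-integrable setT (EFin \o (fun z => a * D z)).
  by have := integrableZl measurableT a iD; apply: eq_integrable; [exact: measurableT|move=> x _; rewrite /= EFinM].
have i2 : lam.-integrable setT (EFin \o (fun z => b * T z)).
  by have := integrableZl measurableT b iT; apply: eq_integrable; [exact: measurableT|move=> x _; rewrite /= EFinM].
have i3 : lam.-integrable setT (EFin \o (fun z => a * D z + b * T z)).
  by have := integrableD measurableT i1 i2; apply: eq_integrable; [exact: measurableT|move=> x _; rewrite /= EFinD].
have le z : normc (k z * Q z - q * k z) <= a * D z + b * T z.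
  rewrite /T normc_real (ger0_norm (D0 z)); have [zA|Az] := leP `|z| A.
    by rewrite mulr0 mulr0 addr0; exact: hin.
  by rewrite mulr1; apply: (le_trans (hout z Az)); rewrite lerDr; exact: mulr_ge0.
apply: le_trans (CI_le (cint_meas (cintB f2 cq)) i3 le) _.
rewrite (RintegralD measurableT i1 i2) (RintegralZl _ measurableT iD) (RintegralZl _ measurableT iT).
exact: lexx.
Qed.

Section average.
Variables (u : R -> R) (k P : R -> R[i]) (D : R -> R) (C : R).
Hypothesis mu : measurable_fun (setT : set (measurableTypeR R)) u.
Hypothesis u_bounded : forall L : R, exists C, forall x y, `|y| <= L -> `|u (x + y) - u x| <= C.
Hypothesis mk : cmeas (T := measurableTypeR R) k.
Hypothesis iD : lam.-integrable setT (EFin \o D).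
Hypothesis kD : forall x z, normc (k z) * expR (u (x + z) - u x) <= D z.
Hypothesis kD0 : forall z, normc (k z) <= D z.
Hypothesis mP : cmeas (T := measurableTypeR R) P.
Hypothesis PC : forall x, normc (P x) <= C * expR (u x).
Hypothesis k0 : CI lam k = 0.

Let C0 : 0 <= C.
Proof.
have := le_trans (normc_ge0 (P 0)) (PC 0).
by rewrite pmulr_lge0// expR_gt0.
Qed.

Let D0 z : 0 <= D z. Proof. exact: le_trans (normc_ge0 _) (kD0 z). Qed.

Let ck : cint lam k. Proof. exact: cint_dom mk iD kD0. Qed.

Let massD := \int[lam]_z D z.
Let tailD A := tail (fun z => (D z)%:C) A.

Section window.
Variables (tau N A : R).
Hypotheses (A0 : 0 < A) (AN : A <= N).
Hypothesis flat : forall y, `|y| <= N + A -> expR (u (tau + y) - u tau) <= 2.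

Let N0 : 0 < N. Proof. exact: lt_le_trans AN. Qed.

Let p y := (expR (- u tau))%:C * P (tau + y).

Let mp : cmeas (T := measurableTypeR R) p.
Proof. by apply: cmeasM; [exact: cmeas_cst|apply: cmeas_comp mP; exact: measurable_funD]. Qed.

Let p_le y : normc (p y) <= C * expR (u (tau + y) - u tau).
Proof.
rewrite /p normcM normc_real ger0_norm ?expR_ge0// expRD mulrA [leRHS]mulrC.
by rewrite ler_wpM2l ?expR_ge0.
Qed.

Let p_flat y : `|y| <= N + A -> normc (p y) <= 2 * C.
Proof. by move=> /flat h; rewrite (le_trans (p_le y))// mulrC ler_wpM2r. Qed.

Let kp_le x z : normc (k z * p (x + z)) <= C * expR (u (tau + x) - u tau) * D z.
Proof.
rewrite normcM; apply: (@le_trans _ _ (normc (k z) * (C * expR (u (tau + (x + z)) - u tau)))).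
  by rewrite ler_wpM2l ?normc_ge0.
have -> : expR (u (tau + (x + z)) - u tau) =
    expR (u (tau + x) - u tau) * expR (u (tau + x + z) - u (tau + x)).
  by rewrite -expRD addrA; congr expR; ring.
have -> : normc (k z) * (C * (expR (u (tau + x) - u tau) * expR (u (tau + x + z) - u (tau + x)))) =
  C * expR (u (tau + x) - u tau) * (normc (k z) * expR (u (tau + x + z) - u (tau + x))) by ring.
by rewrite ler_wpM2l// mulr_ge0// expR_ge0.
Qed.

Let kp_flat x z : `|x| <= N -> normc (k z * p (x + z)) <= 2 * C * D z.
Proof.
move=> xN; rewrite (le_trans (kp_le x z))// ler_wpM2r// mulrC ler_wpM2r// flat//.
by rewrite (le_trans xN)// lerDl ltW.
Qed.

Let cint_kp x : cint lam (fun z => k z * p (x + z)).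
Proof.
apply: (cint_dom _ (integrableZl measurableT (C * expR (u (tau + x) - u tau)) iD)).
  by apply: cmeasM => //; apply: cmeas_comp mp; exact: measurable_funD.
exact: kp_le.
Qed.

Let w x : R[i] := (tent N x)%:C.
Let mw : cmeas (T := measurableTypeR R) w. Proof. by apply: cmeas_real; exact: measurable_tent. Qed.

Let cint_wp z : cint lam (fun x => w x * p (x + z)).
Proof.
have [B hB] := u_bounded (N + `|z|).
have [i _] := integrable_window (C * expR B) (ltW N0).
apply: (cint_dom _ i).
  by apply: cmeasM => //; apply: cmeas_comp mp; exact: measurable_funD.
move=> x; rewrite normcM normc_real ger0_norm ?tent_ge0//.
have [xN|Nx] := leP `|x| N; last first.
  by rewrite tent_out// mul0r mulr_ge0// mulr_ge0// expR_ge0.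
rewrite mulrC ler_pM ?normc_ge0 ?tent_ge0 ?tent_indic//.
rewrite (le_trans (p_le _))// ler_wpM2l// ler_expR (le_trans (ler_norm _))// hB//.
by rewrite (le_trans (ler_normD _ _))// lerD2r.
Qed.

Let Q z := CI lam (fun x => w x * p (x + z)).

Let fubini : CI lam (fun x => w x * CI lam (fun z => k z * p (x + z))) = CI lam (fun z => k z * Q z)
  /\ cint lam (fun z => k z * Q z).
Proof.
pose g (v : R * R) := w v.1 * (k v.2 * p (v.1 + v.2)).
have mg : cmeas (T := (measurableTypeR R * measurableTypeR R)%type) g.
  apply: cmeasM; first by apply: cmeas_comp mw; exact: measurable_fst.
  apply: cmeasM; first by apply: cmeas_comp mk; exact: measurable_snd.
  by apply: cmeas_comp mp; apply: measurable_funD; [exact: measurable_fst|exact: measurable_snd].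
have fin : (\int[lam]_x \int[lam]_z (normc (g (x, z)))%:E < +oo)%E.
  have [i _] := integrable_window (2 * C * massD) (ltW N0).
  have /integrableP[_] := i; apply: le_lt_trans; apply: ge0_le_integral => //.
  - by move=> x _; apply: integral_ge0 => z _; rewrite lee_fin normc_ge0.
  - exact: (measurable_normc_param lam mg).
  - by apply: measurableT_comp => //; exact: measurable_int i.
  move=> x _; apply: (@le_trans _ _ (\int[lam]_z ((2 * C * \1_(`[- N, N]) x)%:E * (D z)%:E))%E).
    apply: ge0_le_integral => //.
    - by move=> z _; rewrite lee_fin normc_ge0.
    - apply/measurable_EFinP; apply: measurable_normc; apply: cmeas_comp mg.
      exact: measurable_pair1.
    - by apply: emeasurable_funM => //; exact: measurable_int iD.
    move=> z _; rewrite /g -EFinM lee_fin normcM normc_real ger0_norm ?tent_ge0//.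
    have [xN|Nx] := leP `|x| N; last by rewrite tent_out// mul0r !mulr_ge0.
    rewrite indicE mem_set; last by rewrite /= in_itv /= -ler_norml.
    rewrite mulr1 (le_trans _ (kp_flat z xN))// ler_piMl ?normc_ge0 ?tent_le1//.
  have c0 : 0 <= 2 * C * \1_(`[- N, N]) x by rewrite !mulr_ge0.
  rewrite ge0_integralZl; [|exact: measurableT|exact: measurable_int iD|by move=> z _; rewrite lee_fin|by rewrite lee_fin].
  have -> : (\int[lam]_z (D z)%:E = massD%:E)%E by rewrite /massD /Rintegral fineK//; exact: integrable_fin_num.
  by rewrite -EFinM /= lee_fin mulrAC ler_norm.
have [a1 a2 a3] := cfubini mg fin.
have e1 x : CI lam (fun z => g (x, z)) = w x * CI lam (fun z => k z * p (x + z)).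
  by rewrite /g /= CIZ.
have e2 z : CI lam (fun x => g (x, z)) = k z * Q z.
  rewrite /Q -(CIZ (k z) (cint_wp z)); apply: eq_CI => x.
  by rewrite /g /= mulrCA.
split; last first.
  rewrite (_ : (fun z => k z * Q z) = (fun z => CI lam (fun x => g (x, z)))); first exact: a2.
  by apply/funext => z; rewrite e2.
transitivity (CI lam (fun x => CI lam (fun z => g (x, z)))).
  by apply: eq_CI => x; rewrite e1.
transitivity (CI lam (fun z => CI lam (fun x => g (x, z)))); first exact: a3.
by apply: eq_CI => z; rewrite e2.
Qed.

(** As the kernel has integral zero, only the variation of the average
    matters, and the average varies slowly. *)
Let near z : `|z| <= A -> normc (Q z - Q 0) <= 8 * A * C.
Proof.
move=> zA; have cQ v : Q v = CI lam (fun y => w (y - v) * p y).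
  rewrite /Q -[RHS](CI_shift v).
    by apply: eq_CI => x; rewrite /= (addrC v) addrK.
  by apply: cmeasM => //; apply: cmeas_comp mw; exact: measurable_funB.
have ci v : cint lam (fun y => w (y - v) * p y).
  have := cint_shift (- v) (cint_wp v); congr (cint _ _); apply/funext => y.
  by rewrite (addrC (- v)) subrK.
rewrite !cQ -CIB//.
have NA0 : 0 <= N + A by rewrite addr_ge0// ltW.
have [i e] := integrable_window (A / N * (2 * C)) NA0.
have le : forall y, normc (w (y - z) * p y - w (y - 0) * p y) <= A / N * (2 * C) * \1_(`[- (N + A), N + A]) y; last first.
  rewrite (le_trans (CI_le (cint_meas (cintB (ci z) (ci 0))) i le))// {le}.
  rewrite e (_ : A / N * (2 * C) * (2 * (N + A)) = 4 * A * C * ((N + A) / N)); last by field; rewrite gt_eqF.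
  rewrite (_ : 8 * A * C = 4 * A * C * 2); last by ring.
  rewrite ler_wpM2l//; first by rewrite !mulr_ge0// ltW.
  by rewrite ler_pdivrMr// mulr_natl mulr2n lerD2l.
- move=> y; rewrite -mulrBl normcM /w -rmorphB normc_real subr0.
  have [yN|Ny] := leP `|y| (N + A).
    rewrite indicE mem_set; last by rewrite /= in_itv /= -ler_norml.
    rewrite mulr1 ler_pM ?normc_ge0 ?p_flat//.
    rewrite (le_trans (tent_lip N0 _ _))// ler_wpM2r ?invr_ge0 ?(ltW N0)//.
    by rewrite (_ : y - z - y = - z) ?normrN//; ring.
  rewrite !tent_out ?subrr ?normr0 ?mul0r//.
  - by rewrite !mulr_ge0// ?invr_ge0 ltW.
  - by rewrite (le_lt_trans _ Ny)// lerDl ltW.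
  - rewrite -(ltrD2r A) (lt_le_trans Ny)// -lerBlDr (le_trans _ (lerB_dist _ _))//.
    by rewrite lerD2l lerN2.
Qed.

Let far z : normc (k z * Q z) <= 4 * N * C * D z.
Proof.
rewrite /Q -(CIZ (k z) (cint_wp z)).
have [i e] := integrable_window (2 * C * D z) (ltW N0).
have le : forall x, normc (k z * (w x * p (x + z))) <= 2 * C * D z * \1_(`[- N, N]) x; last first.
  rewrite (le_trans (CI_le (cint_meas (cintZ (k z) (cint_wp z))) i le))// e.
  by rewrite le_eqVlt; apply/orP; left; apply/eqP; ring.
- move=> x; rewrite mulrCA normcM normc_real ger0_norm ?tent_ge0//.
  have [xN|Nx] := leP `|x| N; last by rewrite tent_out// mul0r !mulr_ge0.
  rewrite indicE mem_set; last by rewrite /= in_itv /= -ler_norml.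
  by rewrite mulr1 (le_trans _ (kp_flat z xN))// ler_piMl ?normc_ge0 ?tent_le1.
Qed.

Let far0 z : normc (k z * Q 0) <= 4 * N * C * D z.
Proof.
rewrite normcM mulrC ler_pM ?normc_ge0//.
rewrite /Q; have [i e] := integrable_window (2 * C) (ltW N0).
have le : forall x, normc (w x * p (x + 0)) <= 2 * C * \1_(`[- N, N]) x; last first.
  rewrite (le_trans (CI_le (cint_meas (cint_wp 0)) i le))// e.
  by rewrite le_eqVlt; apply/orP; left; apply/eqP; ring.
- move=> x; rewrite addr0 normcM normc_real ger0_norm ?tent_ge0//.
  have [xN|Nx] := leP `|x| N; last by rewrite tent_out// mul0r !mulr_ge0.
  rewrite indicE mem_set; last by rewrite /= in_itv /= -ler_norml.
  have xNA : `|x| <= N + A by rewrite (le_trans xN)// lerDl ltW.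
  by rewrite mulr1 (le_trans _ (p_flat xNA))// ler_piMl ?normc_ge0 ?tent_le1.
Qed.

Let term_eq x : (expR (- u tau))%:C * CI lam (fun z => k z * P (tau + x + z)) =
  CI lam (fun z => k z * p (x + z)).
Proof.
have cP : cint lam (fun z => (expR (u tau))%:C * (k z * p (x + z))) by exact: cintZ.
have e z : k z * P (tau + x + z) = (expR (u tau))%:C * (k z * p (x + z)).
  by rewrite /p addrA mulrCA (mulrA (expR (u tau))%:C) -rmorphM /= -expRD subrr expR0 mul1r.
have -> : CI lam (fun z => k z * P (tau + x + z)) =
    CI lam (fun z => (expR (u tau))%:C * (k z * p (x + z))) by apply: eq_CI.
rewrite (CIZ _ (cint_kp x)) mulrA -rmorphM /= -expRD addrC subrr expR0.
by rewrite mul1r.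
Qed.

(** The window has length about [N].  For [|z| <= A] the average moves by at most
    a multiple of [A], and for [|z| > A] it is at most a multiple of [N], but there the
    kernel is small.  Dividing by [N] makes both terms small, for [A] large and
    [N] much larger than [A]. *)
Lemma window_average_le :
  normc (CI lam (fun x => (tent N x)%:C * ((expR (- u tau))%:C * CI lam (fun z => k z * P (tau + x + z))))) <=
  8 * A * C * massD + 8 * N * C * tailD A.
Proof.
have [f1 f2] := fubini.
rewrite (_ : CI lam _ = CI lam (fun z => k z * Q z)); last first.
  by rewrite -f1; apply: eq_CI => x; rewrite term_eq.
apply: (split_bound (q := Q 0) f2 ck k0 iD D0).
- exact: (mulr_ge0 (mulr_ge0 (ler0n R 8) (ltW A0)) C0).
- move=> z zA; rewrite (mulrC (Q 0)) -mulrBr normcM mulrC.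
  by apply: ler_pM; [exact: normc_ge0|exact: normc_ge0|exact: near|exact: kD0].
- move=> z Az; rewrite (mulrC (Q 0)); apply: (le_trans (normcB _ _)).
  apply: (le_trans (lerD (far z) (far0 z))).
  have -> : 4 * N * C * D z + 4 * N * C * D z = 8 * N * C * D z by ring.
  exact: lexx.
Qed.

Lemma window_term_le x : `|x| <= N ->
  normc ((expR (- u tau))%:C * CI lam (fun z => k z * P (tau + x + z))) <= 2 * C * massD.
Proof.
move=> xN; rewrite term_eq.
have i : lam.-integrable setT (EFin \o (fun z => 2 * C * D z)).
  by have := integrableZl measurableT (2 * C) iD; apply: eq_integrable; [exact: measurableT|move=> z _; rewrite /= EFinM].
apply: le_trans (CI_le (cint_meas (cint_kp x)) i (fun z => kp_flat z xN)) _.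
by rewrite (RintegralZl _ measurableT iD).
Qed.

Lemma cmeas_window_term : cmeas (T := measurableTypeR R)
  (fun x => (expR (- u tau))%:C * CI lam (fun z => k z * P (tau + x + z))).
Proof.
rewrite (funext term_eq).
pose g (v : R * R) := k v.2 * p (v.1 + v.2).
have mg : cmeas (T := (measurableTypeR R * measurableTypeR R)%type) g.
  apply: cmeasM; first by apply: cmeas_comp mk; exact: measurable_snd.
  by apply: cmeas_comp mp; apply: measurable_funD; [exact: measurable_fst|exact: measurable_snd].
exact: (cmeas_CI_param lam mg).
Qed.

End window.

Hypothesis u_slow : forall L e : R, 0 < e -> exists T, forall t y, T <= t -> `|y| <= L ->
  `|u (t + y) - u t| <= e.
Variables (tau : nat -> R) (l : R[i]).
Hypothesis tau_oo : tau n @[n --> \oo] --> +oo.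
Hypothesis lim_l : forall x, ccvg (fun n => (expR (- u (tau n + x)))%:C *
  CI lam (fun z => k z * P (tau n + x + z))) l.

Let eventually (T : R) : exists n0, forall n, (n0 <= n)%N -> T <= tau n.
Proof. by move/cvgryPge : tau_oo => /(_ T)[n0 _ h]; exists n0. Qed.

Let window_limit (N A : R) : 0 < A -> A <= N ->
  normc l * (N / 2) <= 8 * A * C * massD + 8 * N * C * tailD A.
Proof.
move=> A0 AN; have N0 : 0 < N by exact: lt_le_trans AN.
have l2 : 0 < ln (2 : R) by rewrite ln_gt0// ltr1n.
have [T hT] := u_slow (N + A) l2.
have [n0 hn0] := eventually T.
have flat n y : `|y| <= N + A -> expR (u (tau (n0 + n)%N + y) - u (tau (n0 + n)%N)) <= 2.
  move=> yN; rewrite -[leRHS](@lnK R 2) ?posrE// ler_expR (le_trans (ler_norm _))// hT// hn0//.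
  by rewrite leq_addr.
pose G n x := (expR (- u (tau (n0 + n)%N)))%:C * CI lam (fun z => k z * P (tau (n0 + n)%N + x + z)).
have [iw _] := integrable_window (2 * C * massD) (ltW N0).
have lim x : ccvg (fun n => (tent N x)%:C * G n x) ((tent N x)%:C * l).
  apply: ccvgM; first exact: ccvg_cst.
  have -> : l = 1%:C * l by rewrite mul1r.
  have -> : G ^~ x = fun n => (expR (u (tau (n0 + n)%N + x) - u (tau (n0 + n)%N)))%:C *
      ((expR (- u (tau (n0 + n)%N + x)))%:C * CI lam (fun z => k z * P (tau (n0 + n)%N + x + z))).
    apply/funext => n; rewrite /G mulrA -rmorphM /= -expRD; congr ((expR _)%:C * _); ring.
  apply: ccvgM; last exact: (ccvg_shift n0 (lim_l x)).
  apply: ccvg_real; rewrite -(expR0 R).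
  apply: (@cvg_comp _ _ _ _ expR _ (nbhs (0 : R))); last exact: continuous_expR.
  apply/cvgrPdist_le => e e0; have [T' hT'] := u_slow `|x| e0.
  have [n1 hn1] := eventually T'.
  exists n1 => // n /= n1n; rewrite sub0r normrN hT'// hn1// (leq_trans n1n)//.
  by rewrite leq_addl.
have mG n : cmeas (T := measurableTypeR R) (fun x => (tent N x)%:C * G n x).
  apply: cmeasM; first by apply: cmeas_real; exact: measurable_tent.
  exact: cmeas_window_term.
have bound n x : normc ((tent N x)%:C * G n x) <= 2 * C * massD * \1_(`[- N, N]) x.
  rewrite normcM normc_real ger0_norm ?tent_ge0//.
  have [xN|Nx] := leP `|x| N.
    rewrite indicE mem_set; last by rewrite /= in_itv /= -ler_norml.
    rewrite mulr1 (le_trans _ (window_term_le A0 (flat n) xN))// ler_piMl ?normc_ge0 ?tent_le1//.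
  rewrite tent_out// mul0r; apply: mulr_ge0 => //; apply: mulr_ge0; first exact: mulr_ge0.
  by apply: Rintegral_ge0 => z _.
have it := cint_real (integrable_tent N0).
have ml : cmeas (T := measurableTypeR R) (fun x => (tent N x)%:C * l).
  by apply: cmeasM; [exact: cint_meas it|exact: cmeas_cst].
have c := CI_dct mG ml iw bound lim.
have := ccvg_le (n0 := 0) c (fun n _ => window_average_le A0 AN (flat n)).
have -> : CI lam (fun x => (tent N x)%:C * l) = l * (\int[lam]_x tent N x)%:C.
  have -> : CI lam (fun x => (tent N x)%:C * l) = CI lam (fun x => l * (tent N x)%:C).
    by apply: eq_CI => x; rewrite mulrC.
  rewrite (CIZ _ it); congr (_ * _); apply: eqC => //=.
  by rewrite /Rintegral integral0.
rewrite normcM normc_real; apply: le_trans; rewrite ler_wpM2l ?normc_ge0//.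
by rewrite (le_trans (tent_mass N0))// ler_norm.
Qed.

(** A limit not depending on the translation equals its average, and the
    averages tend to zero. *)
Lemma limit_zero : l = 0.
Proof.
apply: normc_eq0; apply/eqP; rewrite eq_le normc_ge0 andbT.
apply/ler_addgt0Pr => e e0; rewrite add0r.
have C1 : 0 < 32 * (C + 1) by rewrite mulr_gt0// ltr_wpDl.
have cD := cint_real iD.
(* First [A] makes the tail of [D] small, then [N] makes [A / N] small. *)
have [A A0 hA] := tail_small cD (divr_gt0 e0 C1).
have m0 : 0 <= massD by apply: Rintegral_ge0 => z _.
pose N := Num.max A (32 * A * C * massD / e).
have AN : A <= N by rewrite le_max lexx.
have N0 : 0 < N by exact: lt_le_trans AN.
have hN : 32 * A * C * massD / e <= N by rewrite le_max lexx orbT.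
have h1 : 32 * A * C * massD <= N * e by rewrite -ler_pdivrMr.
have t0 : 0 <= tailD A by apply: Rintegral_ge0 => z _; rewrite mulr_ge0 ?normc_ge0.
have h2 : tailD A * (32 * (C + 1)) <= e by rewrite -ler_pdivlMr.
have h3 : tailD A * (32 * C) <= e.
  by rewrite (le_trans _ h2)// ler_wpM2l// ler_wpM2l// lerDl.
have h := window_limit A0 AN.
have h4 : 32 * N * C * tailD A <= N * e.
  have -> : 32 * N * C * tailD A = N * (tailD A * (32 * C)) by ring.
  by apply: ler_wpM2l => //; exact: ltW.
by rewrite -(ler_pM2l N0); exact: half_bound h h1 h4.
Qed.

End average.

End averaging.

(** * Azarin limit sets in logarithmic coordinates *)

Section azarin.
Context {R : realType}.
Local Notation lam := (@lebesgue_measure R).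
Implicit Types (phi : R -> R[i]) (t : {posnum R}).

Lemma test_scale phi t : test_function phi -> test_function (fun v => phi (v / t%:num)).
Proof.
move=> tphi; have [a [b [a0 ab out]]] := test_function_support tphi.
case: tphi => c1 c2 _ _.
have cd : continuous (fun v : R => v / t%:num) by move=> v; exact: mulrr_continuous.
apply: (@test_function_itv _ _ (a * t%:num) (b * t%:num)); first exact: mulr_gt0.
  split => v; first by apply: (@continuous_comp _ _ _ (fun v : R => v / t%:num) (fun v => Re (phi v))); [exact: cd|exact: c1].
  by apply: (@continuous_comp _ _ _ (fun v : R => v / t%:num) (fun v => Im (phi v))); [exact: cd|exact: c2].
move=> v vab; apply: out; apply: contra vab; rewrite !inE /= !in_itv /=.
by rewrite ler_pdivlMr// ler_pdivrMr.
Qed.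

Lemma test_cmeas_exp phi : test_function phi -> cmeas (T := measurableTypeR R) (phi \o expR).
Proof.
move=> [c1 c2 _ _]; split.
  exact: (measurableT_comp (continuous_measurable_fun c1) (@measurable_expR R)).
exact: (measurableT_comp (continuous_measurable_fun c2) (@measurable_expR R)).
Qed.

Lemma pairing_shift r (mu : complex_radon R) psi x z :
  pairing r mu (fun y => psi (y - x)) z = pairing r mu psi (x + z).
Proof.
apply: eq_bigr => j _; congr (_ * _); apply: eq_CI => y.
by congr psi; ring.
Qed.

Section shifts.
Variables (rho : R -> R) (mu : complex_radon R).
Hypotheses (prho : proximate_order rho) (cmu : radon_class rho mu).
Let r := order_at_infty rho.
Let u := slow rho.

Definition log_test (a : R) phi := fun x => (expR (a * x))%:C * phi (expR x).

Let gmu j : growth u (tilt r (comp mu j)). Proof. exact: growth_of_class. Qed.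

Let lnKt t : expR (ln t%:num) = t%:num. Proof. by rewrite lnK ?posrE. Qed.

Let weight t : prox_weight rho t%:num = expR (r * ln t%:num + u (ln t%:num)).
Proof. by rewrite -{1}lnKt prox_weight_exp. Qed.

Lemma pairingZ (N B : R) psi (c : R[i]) z : supported N B psi ->
  pairing r mu (fun y => c * psi y) z = c * pairing r mu psi z.
Proof.
move=> sp; rewrite /pairing /lint mulr_sumr; apply: eq_bigr => j _.
rewrite mulrCA; congr (_ * _).
exact: CIZ (cint_translate (slow_bounded prho) gmu j z sp).
Qed.

Let log_test_scale a phi t x : log_test a (fun v => phi (v / t%:num)) x =
  (expR (a * ln t%:num))%:C * log_test a phi (x - ln t%:num).
Proof.
have e : expR x / t%:num = expR (x - ln t%:num) by rewrite expRD expRN lnKt.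
rewrite /log_test mulrA -rmorphM /= -expRD e.
by congr ((expR _)%:C * _); ring.
Qed.

(** A dilation is a translation in logarithmic coordinates. *)
Lemma azarin_pairing phi t : test_function phi ->
  radon_integral (azarin_shift rho mu t) phi =
  (expR (- u (ln t%:num)))%:C * pairing r mu (log_test r phi) (ln t%:num).
Proof.
move=> tphi; have [N [B [sp _]]] := test_supported r tphi.
rewrite /azarin_shift radon_integral_dilated// (radon_integral_lint r); last first.
  exact: test_cmeas_exp (test_scale t tphi).
have -> : lint r mu (fun y => (expR (r * y))%:C * phi (expR y / t%:num)) =
    (expR (r * ln t%:num))%:C * pairing r mu (log_test r phi) (ln t%:num).
  rewrite -(pairingZ _ _ sp); apply: eq_bigr => j _; congr (_ * _); apply: eq_CI => y.
  by rewrite -(log_test_scale r phi t y).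
rewrite mulrA /= weight -expRN -rmorphM /= -expRD; congr ((expR _)%:C * _); ring.
Qed.

Lemma prox_weight_succ t : prox_weight (fun x => rho x + 1) t%:num =
  expR ((r + 1) * ln t%:num + u (ln t%:num)).
Proof.
have -> : prox_weight (fun x => rho x + 1) t%:num = prox_weight rho t%:num * t%:num.
  by rewrite /prox_weight powRD ?powRr1//; apply/implyP.
rewrite weight; transitivity (expR (r * ln t%:num + u (ln t%:num)) * expR (ln t%:num)).
  by rewrite lnKt.
by rewrite -expRD; congr expR; ring.
Qed.

Section density.
Variables (K : R -> R[i]) (s : complex_radon R).
Hypotheses (mK : cmeasurable `]0, +oo[ K) (cK : kernel_condition rho K).
Hypothesis hs : has_density s (Psi K mu).

Lemma azarin_density phi t : test_function phi ->
  radon_integral (azarin_shift (fun x => rho x + 1) s t) phi =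
  (expR (- u (ln t%:num)))%:C *
    CI lam (fun z => log_kernel r K z * pairing r mu (log_test (r + 1) phi) (ln t%:num + z)).
Proof.
move=> tphi; have [N [B [sp _]]] := test_supported (r + 1) tphi.
have tphit := test_scale t tphi.
rewrite /azarin_shift radon_integral_dilated//.
rewrite (radon_integral_Psi (slow_bounded prho) mK (integrable_log_bound prho mK cK)
  (log_kernel_le K prho) gmu hs tphit).
have [N' [B' [spt _]]] := test_supported (r + 1) tphit.
have [+ _ _] := Psi_fubini (slow_bounded prho) (cmeas_exp mK) (integrable_log_bound prho mK cK)
  (log_kernel_le K prho) gmu spt.
have e z : pairing r mu (fun x => (expR ((r + 1) * x))%:C * phi (expR x / t%:num)) z =
    (expR ((r + 1) * ln t%:num))%:C * pairing r mu (log_test (r + 1) phi) (ln t%:num + z).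
  rewrite -pairing_shift -(pairingZ (N := N + `|ln t%:num|) (B := B)); last first.
    case: sp => m b o; split.
    - by apply: cmeas_comp m; exact: measurable_funB.
    - by move=> y; exact: b.
    - move=> y Ny; apply: o; rewrite -(ltrD2r `|ln t%:num|) (lt_le_trans Ny)//.
      by rewrite -lerBlDr; exact: lerB_dist.
  apply: eq_bigr => j _; congr (_ * _); apply: eq_CI => y.
  exact: (log_test_scale (r + 1) phi t (y - z)).
set c := (expR ((r + 1) * ln t%:num))%:C in e *.
pose F z := log_kernel r K z * pairing r mu (log_test (r + 1) phi) (ln t%:num + z).
have eF z : log_kernel r K z * pairing r mu (fun x => (expR ((r + 1) * x))%:C * phi (expR x / t%:num)) z =
    c * F z by rewrite e mulrCA.
move=> i; have cF : cint lam F.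
  have c0 : c != 0 by rewrite realC_eq0 gt_eqF ?expR_gt0.
  have := cintZ c^-1 i; congr (cint _ _); apply/funext => z.
  rewrite -[RHS](mulKf c0) -eF /log_kernel; congr (_ * (_ * _ * _)).
transitivity (((prox_weight (fun x => rho x + 1) t%:num)^-1)%:C * CI lam (fun z => c * F z)).
  by congr (_ * _); apply: eq_CI => z; exact: eF.
rewrite (CIZ _ cF) mulrA; congr (_ * _); rewrite prox_weight_succ -expRN /c -rmorphM /= -expRD.
by congr ((expR _)%:C); ring.
Qed.

(** A dilation of a limit along [t_n] is a limit along the dilated sequence. *)
Lemma limit_dilation (t_ : nat -> {posnum R}) (sigma : complex_radon R) (x : R) :
  (t_ n)%:num @[n --> \oo] --> +oo ->
  wide_cvg (fun n => azarin_shift (fun x => rho x + 1) s (t_ n)) sigma ->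
  exists t'_ : nat -> {posnum R}, exists sigma' : complex_radon R,
    [/\ forall n, ln (t'_ n)%:num = ln (t_ n)%:num + x,
        (t'_ n)%:num @[n --> \oo] --> +oo &
        wide_cvg (fun n => azarin_shift (fun x => rho x + 1) s (t'_ n)) sigma'].
Proof.
move=> too wc; pose e : {posnum R} := PosNum (expR_gt0 x).
have te n : 0 < (t_ n)%:num * expR x by rewrite mulr_gt0// expR_gt0.
pose t'_ (n : nat) : {posnum R} := PosNum (te n).
have c0 : 0 <= expR (- ((r + 1) * x)) by exact: expR_ge0.
exists t'_, (dilated_radon (NngNum c0) e sigma).
have lnt n : ln (t'_ n)%:num = ln (t_ n)%:num + x by rewrite /= lnM ?posrE ?expR_gt0 ?expRK.
have lnoo : ln (t_ n)%:num @[n --> \oo] --> +oo.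
  apply/cvgryPge => A; move/cvgryPge : too => /(_ (expR A)); apply: filterS => n h.
  by rewrite -[leLHS]expRK ler_ln ?posrE ?expR_gt0.
split => //.
  apply/cvgryPge => A; move/cvgryPge : too => /(_ (A / expR x)); apply: filterS => n.
  by rewrite ler_pdivrMr ?expR_gt0.
move=> phi tphi; rewrite radon_integral_dilated//=.
have tphie := test_scale e tphi.
have -> : (fun n => radon_integral (azarin_shift (fun x => rho x + 1) s (t'_ n)) phi) =
    fun n => (expR (u (ln (t_ n)%:num) - u (ln (t_ n)%:num + x)))%:C *
      ((expR (- ((r + 1) * x)))%:C *
       radon_integral (azarin_shift (fun x => rho x + 1) s (t_ n)) (fun v => phi (v / e%:num))).
  apply/funext => n; rewrite /azarin_shift !radon_integral_dilated//.
  have -> : (fun v => phi (v / (t'_ n)%:num)) = (fun v => phi (v / (t_ n)%:num / e%:num)).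
    by apply/funext => v; congr phi; rewrite /= invfM mulrA.
  rewrite !mulrA; congr (_ * _); rewrite /= (prox_weight_succ (t_ n)) -!rmorphM /=.
  rewrite (prox_weight_succ (t'_ n)) lnt -!expRN -!expRD; congr ((expR _)%:C); ring.
rewrite -[X in ccvg _ X]mul1r; apply: ccvgM; last first.
  by apply: ccvgM; [exact: ccvg_cst|exact: wc].
apply: (@ccvg_real _ _ 1); rewrite -(expR0 R).
apply: (@cvg_comp _ _ _ _ expR _ (nbhs (0 : R))); last exact: continuous_expR.
apply/cvgrPdist_le => d d0; have [T hT] := slow_near prho `|x| d0.
move/cvgryPge : lnoo => /(_ T); apply: filterS => n h.
by rewrite sub0r opprB; exact: hT.
Qed.

Hypothesis k0 : CI lam (log_kernel r K) = 0.

(** By [limit_dilation] and uniqueness the limit along [ln t_n + x] is the same for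
    all [x], so [limit_zero] applies. *)
Lemma limit_integral_zero (t_ : nat -> {posnum R}) (sigma : complex_radon R) phi :
  limit_set_singleton (fun x => rho x + 1) s sigma ->
  (t_ n)%:num @[n --> \oo] --> +oo ->
  wide_cvg (fun n => azarin_shift (fun x => rho x + 1) s (t_ n)) sigma ->
  test_function phi -> radon_integral sigma phi = 0.
Proof.
move=> single too wc tphi; have [N [B [sp _]]] := test_supported (r + 1) tphi.
have [C C0 hC] := pairing_bound (slow_bounded prho) gmu N.
have lnoo : ln (t_ n)%:num @[n --> \oo] --> +oo.
  apply/cvgryPge => A; move/cvgryPge : too => /(_ (expR A)); apply: filterS => n h.
  by rewrite -[leLHS]expRK ler_ln ?posrE ?expR_gt0.
apply: (@limit_zero _ u (log_kernel r K) (pairing r mu (log_test (r + 1) phi)) (log_bound rho K) (B * C)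
  (slow_bounded prho) (cmeas_log_kernel r mK) (integrable_log_bound prho mK cK)
  (log_kernel_le K prho) (log_kernel_le0 K prho) (cmeas_pairing _ _ sp) _ k0 (slow_near prho)
  (fun n => ln (t_ n)%:num)) => //.
- by move=> x; exact: hC sp.
move=> x; have [t'_ [sigma' [lt' too' wc']]] := limit_dilation x too wc.
have e : radon_eq sigma' sigma by apply/single; exists t'_.
rewrite -(radon_integral_eq e tphi).
have := wc' phi tphi; congr (ccvg _ _); apply/funext => n.
rewrite (azarin_density (t'_ n) tphi) lt'; exact: erefl.
Qed.

End density.

End shifts.

Lemma radon_integral_zero phi : radon_integral zero_radon phi = 0.
Proof.
rewrite radon_integral_comp big1// => j _.
have z (f : R -> R) : \int[comp zero_radon j]_(t in `]0, +oo[) f t = 0.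
  have -> : comp zero_radon j = zero_positive_radon :> positive_radon R.
    by case: j => [[|[|[|[|//]]]]] h; rewrite /comp /tnth.
  by rewrite /Rintegral integral_measure_zero.
by rewrite !z mulr0.
Qed.

End azarin.

(** * Test functions in logarithmic coordinates *)

Section log_tests.
Context {R : realType}.
Local Notation lam := (@lebesgue_measure R).
Implicit Types (psi chi : R -> R[i]) (phi : R -> R[i]).

(** In logarithmic coordinates test functions are exactly these, whatever power
    of [t] they are multiplied by. *)
Definition bump psi := ccontinuous psi /\ exists N B, supported N B psi.

Lemma bump_log_test a phi : test_function phi -> bump (log_test a phi).
Proof. by move=> /(test_supported a)[N [B [sp c]]]; split => //; exists N, B. Qed.

Lemma supported_shift N B psi x : supported N B psi -> supported (N + `|x|) B (fun y => psi (y - x)).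
Proof.
case=> m b o; split.
- by apply: cmeas_comp m; exact: measurable_funB.
- by move=> y; exact: b.
- move=> y Ny; apply: o; rewrite -(ltrD2r `|x|) (lt_le_trans Ny)//.
  by rewrite -lerBlDr; exact: lerB_dist.
Qed.

Lemma bump_shift psi x : bump psi -> bump (fun y => psi (y - x)).
Proof.
move=> [[c1 c2] [N [B sp]]]; split; last by exists (N + `|x|), B; exact: supported_shift.
have cs : continuous (fun y : R => y - x).
  by move=> y; apply: cvgB; [exact: cvg_id|exact: cvg_cst].
split => y.
  by apply: (@continuous_comp _ _ _ (fun y : R => y - x) (fun y => Re (psi y))); [exact: cs|exact: c1].
by apply: (@continuous_comp _ _ _ (fun y : R => y - x) (fun y => Im (psi y))); [exact: cs|exact: c2].
Qed.

(** Truncating the argument of the logarithm away from zero makes the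
    composition continuous on the whole line. *)
Lemma bump_test a psi : bump psi -> exists2 phi, test_function phi & log_test a phi =1 psi.
Proof.
move=> [[c1 c2] [N [B sp]]]; have [mp pB out] := sp.
pose c := expR (- (`|N| + 1)); have c0 : 0 < c by exact: expR_gt0.
pose L (v : R) := ln (Num.max v c).
have Lpos v : 0 < Num.max v c by rewrite lt_max c0 orbT.
have cL : continuous L.
  move=> v; apply: (@continuous_comp _ _ _ (fun v : R => Num.max v c) (@ln R)).
    by apply: (continuous_max (f := id) (g := fun=> c)); [exact: cvg_id|exact: cst_continuous].
  exact: continuous_ln.
have clow : psi (- (`|N| + 1)) = 0.
  apply: out; rewrite normrN ger0_norm ?addr_ge0//.
  by rewrite (le_lt_trans (ler_norm _))// ltrDl.
have cpsi : ccontinuous (fun v => psi (L v)).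
  split => v.
    by apply: (@continuous_comp _ _ _ L (fun y => Re (psi y))); [exact: cL|exact: c1].
  by apply: (@continuous_comp _ _ _ L (fun y => Im (psi y))); [exact: cL|exact: c2].
have cexp : ccontinuous (fun v => (expR (- a * L v))%:C : R[i]).
  split => v /=; last exact: cst_continuous.
  apply: (@continuous_comp _ _ _ L (fun y : R => expR (- a * y))); first exact: cL.
  by apply: (@continuous_comp _ _ _ (fun y : R => - a * y)); [exact: continuous_mulZ|exact: continuous_expR].
exists (fun v => (expR (- a * L v))%:C * psi (L v)).
  apply: (@test_function_itv _ _ c (expR `|N|)) => //; first exact: ccontinuousM.
  move=> v; rewrite notin_setE /= in_itv /= => /negP; rewrite negb_and -!ltNge => /orP[h|h].
    by rewrite /L max_r ?(ltW h)// /c expRK clow mulr0.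
  have v0 : 0 < v by rewrite (lt_trans _ h)// expR_gt0.
  have lnv : `|N| < ln v by rewrite -[ltLHS]expRK ltr_ln ?posrE ?expR_gt0.
  rewrite out ?mulr0// /L max_l; last first.
    apply: (le_trans _ (ltW h)); rewrite /c ler_expR.
    by have := normr_ge0 N; lra.
  by rewrite (le_lt_trans (ler_norm N))// (lt_le_trans lnv)// ler_norm.
move=> y; rewrite /log_test /L; have [h|h] := leP c (expR y).
  by rewrite expRK mulrA -rmorphM /= -expRD mulNr subrr expR0 mul1r.
rewrite /c expRK clow !mulr0; apply/esym/out.
move: h; rewrite /c ltr_expR => h.
have y0 : y < 0 by have := normr_ge0 N; lra.
by rewrite (ltr0_norm y0); have := ler_norm N; lra.
Qed.

Lemma cint_bump psi : bump psi -> cint lam psi.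
Proof.
move=> [_ [N [B sp]]]; have B0 := supported_ge0 sp; case: sp => mp pB out.
have [i _] := integrable_window (R := R) B (normr_ge0 N).
apply: (cint_dom mp i) => y; rewrite indicE.
case: (boolP (y \in _)) => yN; first by rewrite mulr1.
rewrite out ?normc0 ?mulr_ge0//; move: yN; rewrite notin_setE /= in_itv /= => /negP.
by rewrite -ler_norml -ltNge; apply: le_lt_trans; exact: ler_norm.
Qed.

Lemma bump_tent (N : R) : 0 < N -> bump (fun x => (tent N x)%:C).
Proof.
move=> N0; split; first by split => /= x; [exact: continuous_tent|exact: cst_continuous].
exists N, 1; split.
- by apply: cmeas_real; exact: measurable_tent.
- by move=> y; rewrite normc_real ger0_norm ?tent_ge0 ?tent_le1.
- by move=> y /(tent_out N0) ->.
Qed.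

(** A bump narrow on the scale of the oscillation. *)
Lemma bump_fourier_neq0 (l : R) : exists2 chi, bump chi & fourier chi l != 0.
Proof.
pose d := (2 * (1 + `|l|))^-1.
have p0 : 0 < 2 * (1 + `|l|) by rewrite mulr_gt0// ltr_wpDr.
have d0 : 0 < d by rewrite invr_gt0.
exists (fun x => (tent d x)%:C); first exact: bump_tent.
have it := integrable_tent d0; have ct := cint_real it.
set I := \int[lam]_x tent d x.
have I0 : 0 < I by apply: lt_le_trans (tent_mass d0); rewrite divr_gt0.
have CIt : CI lam (fun x => (tent d x)%:C) = I%:C.
  by apply: eqC => //=; rewrite /Rintegral integral0.
have cf : cint lam (fun x => (tent d x)%:C * expi (- (l * x))).
  apply: (cintM_bdd ct (C := 1)).
  rewrite (_ : (fun x => _) = (fun x => expi ((- l) * x))); first exact: bdd_expi.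
  by apply/funext => x; rewrite mulNr.
have i2 : lam.-integrable setT (EFin \o (fun x => 2^-1 * tent d x)).
  by have := integrableZl measurableT 2^-1 it; apply: eq_integrable.
have le x : normc ((tent d x)%:C * expi (- (l * x)) - (tent d x)%:C) <= 2^-1 * tent d x.
  rewrite -[X in _ - X]mulr1 -mulrBr normcM normc_real ger0_norm ?tent_ge0// mulrC.
  have [xd|dx] := leP `|x| d; last by rewrite tent_out// !mulr0.
  rewrite ler_wpM2r ?tent_ge0// (le_trans (normc_expi1 _))// normrN normrM.
  rewrite (le_trans (ler_wpM2l (normr_ge0 l) xd))// /d ler_pdivrMr// mulrA mulVf// mul1r.
  by rewrite lerDr.
apply/eqP => F0; have := CI_le (cint_meas (cintB cf ct)) i2 le.
rewrite (CIB cf ct) -/(fourier _ _) F0 CIt sub0r normcN normc_real (gtr0_norm I0).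
by rewrite (RintegralZl _ measurableT it) -/I; lra.
Qed.

(** Translating by [pi / (l - l0)] changes the ratio of the exponentials [l] and [l0] by
    the sign -1, so the corresponding difference operator kills the frequency [l0] and
    doubles the coefficient of [l] in modulus. *)
Lemma expi_independent (s : seq R) (d : R -> R[i]) : uniq s ->
  (forall a, \sum_(l <- s) d l * expi (- (l * a)) = 0) -> forall l, l \in s -> d l = 0.
Proof.
elim: s d => [//|l0 s ih] d /= /andP[l0s us] h.
have hs l : l \in s -> d l = 0.
  move=> ls; have ll0 : l - l0 != 0.
    by rewrite subr_eq0; apply: contraNneq l0s => <-.
  pose e := pi / (l - l0).
  have := ih (fun m => d m * (expi (- (m * e)) - expi (- (l0 * e)))) us.
  have z a : \sum_(m <- s) d m * (expi (- (m * e)) - expi (- (l0 * e))) * expi (- (m * a)) = 0.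
    have e1 : \sum_(m <- l0 :: s) d m * (expi (- (m * e)) - expi (- (l0 * e))) * expi (- (m * a)) =
        \sum_(m <- l0 :: s) d m * expi (- (m * (a + e))) -
        expi (- (l0 * e)) * \sum_(m <- l0 :: s) d m * expi (- (m * a)).
      rewrite mulr_sumr -sumrB; apply: eq_bigr => m _.
      by rewrite (mulrDr m a e) opprD expiD; ring.
    have e2 := e1; rewrite big_cons subrr mulr0 mul0r add0r in e2.
    by rewrite e2 !h mulr0 subr0.
  move=> /(_ z l ls)/eqP; rewrite mulf_eq0 => /orP[/eqP//|/eqP F].
  have e3 : expi (- (l * e)) = - expi (- (l0 * e)).
    have -> : - (l * e) = - pi + - (l0 * e) by rewrite /e; field.
    rewrite expiD; have -> : expi (- pi) = -1 :> R[i].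
      by apply: eqC; rewrite /= ?cosN ?sinN ?cospi ?sinpi ?oppr0.
    by rewrite mulN1r.
  move: F; rewrite e3 -opprD -mulr2n => /eqP; rewrite oppr_eq0 -mulr_natl mulf_eq0.
  by rewrite (negbTE (expi_neq0 _)) orbF pnatr_eq0.
move=> l; rewrite inE => /predU1P[->|/hs//].
have := h 0; rewrite big_cons big_seq big1 => [|m ms]; last by rewrite hs// mul0r.
by rewrite mulr0 oppr0 expi0 mulr1 addr0.
Qed.

End log_tests.

(** * Measures in the limit set *)

Section limit_measure.
Context {R : realType}.
Local Notation lam := (@lebesgue_measure R).

Lemma ccvgD (a b : nat -> R[i]) (l m : R[i]) : ccvg a l -> ccvg b m ->
  ccvg (fun n => a n + b n) (l + m).
Proof.
move=> [a1 a2] [b1 b2]; split; (under eq_fun do rewrite ?ReD ?ImD); rewrite ?ReD ?ImD.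
  exact: cvgD.
exact: cvgD.
Qed.

Lemma ccvg_sum (I : Type) (s : seq I) (a : I -> nat -> R[i]) (l : I -> R[i]) :
  (forall i, ccvg (a i) (l i)) -> ccvg (fun n => \sum_(i <- s) a i n) (\sum_(i <- s) l i).
Proof.
move=> h; elim: s => [|i s ih].
  by rewrite big_nil; under eq_fun do rewrite big_nil; exact: ccvg_cst.
by rewrite big_cons; under eq_fun do rewrite big_cons; exact: ccvgD.
Qed.

(** Dominated convergence along sequences: translates by a bounded amount live on one
    compact set, which has finite mass. *)
Lemma ccontinuous_pairing r (nu : complex_radon R) psi : bump psi ->
  ccontinuous (pairing r nu psi).
Proof.
move=> [[c1 c2] [N [B sp]]]; have B0 := supported_ge0 sp; have [mp pB out] := sp.
have key (x : R) (x_ : nat -> R) : x_ n @[n --> \oo] --> x ->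
    ccvg (fun n => pairing r nu psi (x_ n)) (pairing r nu psi x).
  move=> xc; have [M hM] : exists M, forall n, `|x_ n| <= M.
    have : cvgn x_ by apply/cvg_ex; exists x.
    move=> /cvg_seq_bounded[M [_ hM]]; exists (M + 1) => n; apply: hM => //; rewrite ltrDl//.
  apply: ccvg_sum => j; apply: ccvgM; first exact: ccvg_cst.
  have M0 : 0 <= M by apply: le_trans (hM 0%N).
  pose A : set (measurableTypeR R) := `[- (M + `|N|), M + `|N|]%classic.
  have mA : measurable A by exact: measurable_itv.
  have iA : (tilt r (comp nu j)).-integrable setT (EFin \o (fun y => B * \1_A y)).
    apply/integrableP; split.
      by apply/measurable_EFinP; apply: measurable_funM => //; exact: measurable_indic.
    have -> : (\int[tilt r (comp nu j)]_y `|(B * \1_A y)%R%:E| = B%:E * tilt r (comp nu j) A)%E.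
      have -> : tilt r (comp nu j) A = (\int[tilt r (comp nu j)]_y (\1_A y)%:E)%E.
        by rewrite integral_indic// setIT.
      rewrite -ge0_integralZl//; last by apply/measurable_EFinP; exact: measurable_indic.
      apply: eq_integral => y _; rewrite /= ger0_norm// mulr_ge0//.
    by apply: lte_mul_pinfty => //; exact: tilt_fin.
  have ms x' : cmeas (T := measurableTypeR R) (fun y => psi (y - x')).
    by apply: cmeas_comp mp; exact: measurable_funB.
  apply: (CI_dct (fun n => ms (x_ n)) (ms x) iA).
    move=> n y; rewrite indicE; case: (boolP (y \in A)) => yA; first by rewrite mulr1.
    rewrite out ?normc0 ?mulr0//; move: yA; rewrite /A notin_setE /= in_itv /= => /negP.
    rewrite -ler_norml -ltNge => h; rewrite (le_lt_trans (ler_norm N))//.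
    by have := hM n; have := lerB_dist y (x_ n) => h1 h2; lra.
  move=> y; have yc : y - x_ n @[n --> \oo] --> y - x.
    by apply: cvgB => //; exact: cvg_cst.
  split.
    exact: (cvg_comp _ _ yc (c1 (y - x))).
  exact: (cvg_comp _ _ yc (c2 (y - x))).
by split => x; apply/(@cvg_nbhsP _ R^o) => x_ /key[].
Qed.

Variables (rho : R -> R) (mu nu : complex_radon R) (t_ : nat -> {posnum R}).
Hypotheses (prho : proximate_order rho) (cmu : radon_class rho mu).
Hypothesis too : (t_ n)%:num @[n --> \oo] --> +oo.
Hypothesis wc : wide_cvg (fun n => azarin_shift rho mu (t_ n)) nu.
Let r := order_at_infty rho.
Let u := slow rho.
Let tau n := ln (t_ n)%:num.
Let c n : R[i] := (expR (- u (tau n)))%:C.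

Let gmu j : growth u (tilt r (comp mu j)). Proof. exact: growth_of_class. Qed.

Let eventually (T : R) : exists n0, forall n, (n0 <= n)%N -> T <= tau n.
Proof.
move/cvgryPge : too => /(_ (expR T))[n0 _ h]; exists n0 => n /h hn.
by rewrite -[leLHS]expRK ler_ln ?posrE ?expR_gt0.
Qed.

Let flat x : exists n0, forall n, (n0 <= n)%N -> expR (u (tau n + x) - u (tau n)) <= 2.
Proof.
have l2 : 0 < ln (2 : R) by rewrite ln_gt0// ltr1n.
have [T hT] := slow_near prho `|x| l2; have [n0 hn0] := eventually T.
exists n0 => n /hn0 hn; rewrite -[leRHS](@lnK R 2) ?posrE// ler_expR.
by rewrite (le_trans (ler_norm _))// hT.
Qed.

Let limit0 psi : bump psi -> ccvg (fun n => c n * pairing r mu psi (tau n)) (pairing r nu psi 0).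
Proof.
move=> bp; have [phi tphi e] := bump_test r bp.
have {}e : log_test r phi = psi by apply/funext.
have := wc tphi; rewrite (radon_integral_lint r); last exact: test_cmeas_exp.
have -> : lint r nu (fun y => (expR (r * y))%:C * phi (expR y)) = pairing r nu psi 0.
  by apply: eq_bigr => j _; congr (_ * _); apply: eq_CI => y; rewrite subr0 -e.
congr (ccvg _ _); apply/funext => n; rewrite (azarin_pairing prho cmu)// e; exact: erefl.
Qed.

(** Wide convergence concerns fixed test functions; translating the bump gives the
    limit at every point [x]. *)
Lemma limit_pairing psi x : bump psi ->
  ccvg (fun n => c n * pairing r mu psi (tau n + x)) (pairing r nu psi x).
Proof.
move=> bp; have := limit0 (bump_shift x bp); rewrite pairing_shift addr0.
by congr (ccvg _ _); apply/funext => n; rewrite pairing_shift (addrC x).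
Qed.

(** In the limit the weight of the growth bound disappears. *)
Lemma growth_limit j : growth (fun=> 0) (tilt r (comp nu j)).
Proof.
have [C C0 hC] := pairing_bound (slow_bounded prho) gmu 2.
pose B := expR (`|r| * 2).
have B0 : 0 <= B by exact: expR_ge0.
apply: (@growth_of_itv _ _ r (1 + B * C * 2)) => [|x]; first by rewrite addr_ge0 ?mulr_ge0.
have e0 : 0 < expR x by exact: expR_gt0.
have ab : expR x <= expR (x + 1) by rewrite ler_expR lerDl.
(* The mass of a component on the window is bounded by a value of [nu] on a subset,
   hence up to any error by the integral of a test function, to which the bound for
   [mu] passes; the error [expR (r * x)] has the size of the bound aimed at. *)
have [S [mS Sab hS]] := comp_le_cvalue nu j (relcompact_segment (expR (x + 1)) e0).
have erx : 0 < expR (r * x) by exact: expR_gt0.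
have [phi [uphi out h1 _]] := cvalue_approximation nu nu e0 ab mS Sab erx.
have tphi : test_function (fun v => (phi v)%:C).
  apply: (@test_function_itv _ _ (expR x / 2) (2 * expR (x + 1))); first by rewrite divr_gt0.
    by split => //= v; [exact: uphi.1|exact: cst_continuous].
  by move=> v /out ->.
pose psi y : R[i] := (expR (r * y) * phi (expR (y + x)))%:C.
have ex1 : 2 <= expR 1 :> R by have := @expR_ge1Dx R 1; lra.
have sp : supported 2 B psi.
  have zero y : 2 < `|y| -> phi (expR (y + x)) = 0.
    rewrite ltr_normr => /orP y2; apply: out; rewrite notin_setE /= in_itv /= => /andP[l1 l2].
    case: y2 => y2.
      have : expR (y + x) < expR (y + x).
        apply: (le_lt_trans l2); apply: (@le_lt_trans _ _ (expR (2 + x))).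
          have -> : 2 + x = 1 + (x + 1) by ring.
          by rewrite (expRD 1) ler_wpM2r ?expR_ge0.
        by rewrite ltr_expR ltrD2r.
      by rewrite ltxx.
    have : expR x < expR x.
      apply: (@le_lt_trans _ _ (expR (1 + (y + x)))).
        rewrite expRD; apply: (@le_trans _ _ (2 * expR (y + x))).
          by rewrite -ler_pdivrMl// mulrC.
        by rewrite ler_wpM2r ?expR_ge0.
      by rewrite ltr_expR; lra.
    by rewrite ltxx.
  split.
  - apply: cmeas_real; apply: measurable_funM.
      by apply: measurableT_comp => //; exact: measurable_funM.
    apply: (measurableT_comp (continuous_measurable_fun uphi.1)).
    by apply: measurableT_comp => //; exact: measurable_funD.
  - move=> y; rewrite /psi normc_real; have [y2|y2] := leP `|y| 2; last first.
      by rewrite zero// mulr0 normr0.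
    have /andP[p0 p1] := uphi.2 (expR (y + x)).
    rewrite normrM !ger0_norm ?expR_ge0// -[leRHS]mulr1 ler_pM ?expR_ge0// /B ler_expR.
    by rewrite (le_trans (ler_norm _))// normrM ler_wpM2l.
  - by move=> y /zero; rewrite /psi => ->; rewrite mulr0.
have bound : normc (radon_integral nu (fun v => (phi v)%:C)) <= B * C * 2 * expR (r * x).
  have [n0 hn0] := flat x.
  apply: (ccvg_le (n0 := n0) (wc tphi)) => n /hn0 hn.
  rewrite (azarin_pairing prho cmu)//.
  have -> : log_test r (fun v => (phi v)%:C) = fun y => (expR (r * x))%:C * psi (y - x).
    apply/funext => y; rewrite /log_test /psi -!rmorphM /= subrK mulrA -expRD.
    by congr ((expR _ * _)%:C); ring.
  rewrite (pairingZ prho cmu _ _ (supported_shift x sp)) pairing_shift.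
  rewrite !normcM !normc_real !ger0_norm ?expR_ge0//.
  have h := hC _ _ (x + ln (t_ n)%:num) sp.
  apply: (@le_trans _ _ (expR (- u (tau n)) * (expR (r * x) * (B * C * expR (u (x + tau n)))))).
    by rewrite ler_wpM2l ?expR_ge0// ler_wpM2l ?expR_ge0.
  have -> : expR (- u (tau n)) * (expR (r * x) * (B * C * expR (u (x + tau n)))) =
      B * C * expR (u (tau n + x) - u (tau n)) * expR (r * x).
    by rewrite (expRD (u _)) (addrC x); ring.
  by rewrite ler_wpM2r ?expR_ge0// ler_wpM2l// mulr_ge0.
have rab := relcompact_segment (expR (x + 1)) e0.
rewrite -(fineK (pradon_fin_num (comp nu j) rab)) lee_fin addr0.
apply: (le_trans hS); rewrite -[cvalue nu S](subrK (radon_integral nu (fun v => (phi v)%:C))).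
by rewrite (le_trans (normcD _ _))// mulrDl mul1r lerD.
Qed.

Section annihilation.
Variables (K : R -> R[i]) (s : complex_radon R).
Hypotheses (mK : cmeasurable `]0, +oo[ K) (cK : kernel_condition rho K).
Hypothesis hs : has_density s (Psi K mu).
Hypothesis single : limit_set_singleton (fun x => rho x + 1) s zero_radon.
Let k := log_kernel r K.
Let D := log_bound rho K.

Let zero_bounded (L : R) : exists C, forall x y : R, `|y| <= L -> `|(0 : R) - 0| <= C.
Proof. by exists 0 => x y _; rewrite subrr normr0. Qed.

Let kD x z : normc (k z) * expR ((fun=> 0) (x + z) - (fun=> 0) x) <= D z.
Proof. by rewrite subrr expR0 mulr1; exact: log_kernel_le0. Qed.

Let iD : lam.-integrable setT (EFin \o D). Proof. exact: integrable_log_bound. Qed.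

Let translate_bound n psi N B C z : supported N B psi -> 0 <= B * C ->
  (forall B psi x, supported N B psi -> normc (pairing r mu psi x) <= B * C * expR (u x)) ->
  normc (k z * (c n * pairing r mu psi (tau n + z))) <= B * C * D z.
Proof.
move=> sp BC hC; rewrite (normcM (k z)) (normcM (c n)) normc_real ger0_norm ?expR_ge0//.
apply: (@le_trans _ _ (normc (k z) * (expR (- u (tau n)) * (B * C * expR (u (tau n + z)))))).
  have i1 : expR (- u (tau n)) * normc (pairing r mu psi (tau n + z)) <=
      expR (- u (tau n)) * (B * C * expR (u (tau n + z))).
    by rewrite ler_wpM2l; [by []|exact: expR_ge0|exact: hC sp].
  by rewrite ler_wpM2l; [by []|exact: normc_ge0|exact: i1].
have -> : normc (k z) * (expR (- u (tau n)) * (B * C * expR (u (tau n + z)))) =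
    B * C * (normc (k z) * expR (u (tau n + z) - u (tau n))).
  by rewrite (expRD (u _)); ring.
by rewrite ler_wpM2l; [by []|exact: BC|exact: log_kernel_le].
Qed.

(** The convolution of [nu] with the kernel is the density of a measure which
    is a limit of the shifts of [s]. *)
Lemma limit_convolution psi : bump psi -> CI lam (fun z => k z * pairing r nu psi z) = 0.
Proof.
move=> bp; have [d [hd _ _]] := radon_of_density
  (Psi_cmeasurable r nu mK) (Psi_cintegrable zero_bounded mK iD kD growth_limit).
have dphi phi (tphi : test_function phi) := radon_integral_Psi zero_bounded mK iD kD growth_limit hd tphi.
have dl : limit_set (fun x => rho x + 1) s d.
  exists t_; split => // phi tphi; rewrite (dphi _ tphi).
  have blt := bump_log_test (r + 1) tphi.
  have [_ [N [B sp]]] := blt; have B0 := supported_ge0 sp.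
  have [C C0 hC] := pairing_bound (slow_bounded prho) gmu N.
  have BC : 0 <= B * C by exact: mulr_ge0.
  pose F n z := k z * (c n * pairing r mu (log_test (r + 1) phi) (tau n + z)).
  have mk : cmeas (T := measurableTypeR R) k by exact: cmeas_log_kernel.
  have mF n : cmeas (T := measurableTypeR R) (F n).
    apply: cmeasM => //; apply: cmeasM; first exact: cmeas_cst.
    by apply: (@cmeas_comp _ _ _ _ _ (fun z => tau n + z)); [exact: measurable_funD|exact: cmeas_pairing sp].
  have iBD : lam.-integrable setT (EFin \o (fun z => B * C * D z)).
    by have := integrableZl measurableT (B * C) iD; apply: eq_integrable.
  have FB n z : normc (F n z) <= B * C * D z := translate_bound n z sp BC hC.
  have lim z : ccvg (fun n => F n z) (k z * pairing r nu (log_test (r + 1) phi) z).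
    by apply: ccvgM; [exact: ccvg_cst|exact: limit_pairing].
  have ml : cmeas (T := measurableTypeR R) (fun z => k z * pairing r nu (log_test (r + 1) phi) z).
    by apply: cmeasM => //; apply: ccontinuous_cmeas; exact: ccontinuous_pairing.
  have := CI_dct mF ml iBD FB lim; congr (ccvg _ _); apply/funext => n.
  rewrite (azarin_density prho cmu mK cK hs)// -/(tau n).
  have c0 : c n != 0 by rewrite realC_eq0 gt_eqF ?expR_gt0.
  have cF : cint lam (F n) := cint_dom (mF n) iBD (FB n).
  have e z : k z * pairing r mu (log_test (r + 1) phi) (tau n + z) = (c n)^-1 * F n z.
    by rewrite /F (mulrCA (k z)) mulKf.
  transitivity (c n * CI lam (fun z => (c n)^-1 * F n z)); first by rewrite (CIZ _ cF) mulVKf.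
  by congr (_ * _); apply: eq_CI => z; rewrite -e.
have dz : radon_eq d zero_radon by apply/single.
have [phi tphi e] := bump_test (r + 1) bp.
have {}e : log_test (r + 1) phi = psi by apply/funext.
have := dphi _ tphi; rewrite (radon_integral_eq dz tphi) radon_integral_zero => ->.
by apply: eq_CI => z; rewrite -e.
Qed.

(** Translates of bumps are bumps, so the value at one point gives all values. *)
Lemma limit_annihilated psi : bump psi -> annihilates k (pairing r nu psi).
Proof.
move=> bp x; rewrite -(limit_convolution (bump_shift x bp)).
by apply: eq_CI => z; rewrite pairing_shift.
Qed.

End annihilation.

End limit_measure.

(** * Limit measures are exponential sums *)

Section representation.
Context {R : realType}.
Local Notation lam := (@lebesgue_measure R).

Let zero_bounded (L : R) : exists C, forall x y : R, `|y| <= L -> `|(0 : R) - 0| <= C.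
Proof. by exists 0 => x y _; rewrite subrr normr0. Qed.

Section symmetry.
Variables (r : R) (nu : complex_radon R).
Hypothesis gnu : forall j, growth (fun=> 0) (tilt r (comp nu j)).

(** Both sides are the integral of the convolution of the two bumps. *)
Lemma pairing_symmetry psi chi : bump psi -> bump chi ->
  CI lam (fun x => psi x * pairing r nu chi x) = CI lam (fun z => chi z * pairing r nu psi z).
Proof.
move=> [_ [N [B sp]]] bchi; have cchi := cint_bump bchi.
have kD x z : normc (chi z) * expR ((fun=> 0) (x + z) - (fun=> 0 : R) x) <= normc (chi z).
  by rewrite subrr expR0 mulr1.
have F j := @convolution_fubini _ (fun=> 0) zero_bounded chi (fun z => normc (chi z))
  (cint_meas cchi) (integrable_normc cchi) kD (tilt r (comp nu j)) 0 N B psi (gnu j) sp.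
have e1 j x : psi x * (expR (- (0 * x)))%:C *
    CI (tilt r (comp nu j)) (fun y => (expR (0 * x))%:C * chi (y - x)) =
    psi x * CI (tilt r (comp nu j)) (fun y => chi (y - x)).
  rewrite mul0r oppr0 expR0 mulr1; congr (_ * _); apply: eq_CI => y.
  by rewrite mul1r.
have ex x : psi x * pairing r nu chi x =
    \sum_j coef j * (psi x * CI (tilt r (comp nu j)) (fun y => chi (y - x))).
  by rewrite /pairing /lint mulr_sumr; apply: eq_bigr => j _; rewrite mulrCA.
have ez z : chi z * pairing r nu psi z =
    \sum_j coef j * (chi z * CI (tilt r (comp nu j)) (fun y => psi (y - z))).
  by rewrite /pairing /lint mulr_sumr; apply: eq_bigr => j _; rewrite mulrCA.
have c1 j : cint lam (fun x => psi x * CI (tilt r (comp nu j)) (fun y => chi (y - x))).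
  by have [_ + _] := F j; rewrite (funext (e1 j)).
have c2 j : cint lam (fun z => chi z * CI (tilt r (comp nu j)) (fun y => psi (y - z))).
  by have [+ _ _] := F j.
rewrite (funext ex) (funext ez) (CI_sum _ (fun j => cintZ (coef j) (c1 j))).
rewrite (CI_sum _ (fun j => cintZ (coef j) (c2 j))); apply: eq_bigr => j _.
by rewrite (CIZ _ (c1 j)) (CIZ _ (c2 j)); have [_ _ <-] := F j; rewrite (funext (e1 j)).
Qed.

Lemma CI_exponential_sum (s : seq R) (d : R -> R[i]) psi : cint lam psi ->
  cint lam (fun x => psi x * \sum_(l <- s) d l * expi (- (l * x))) /\
  CI lam (fun x => psi x * \sum_(l <- s) d l * expi (- (l * x))) =
  \sum_(l <- s) d l * fourier psi l.
Proof.
move=> cp; have e x : psi x * \sum_(l <- s) d l * expi (- (l * x)) =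
    \sum_(l <- s) d l * (psi x * expi (- (l * x))).
  by rewrite mulr_sumr; apply: eq_bigr => l _; rewrite mulrCA.
have cl l : cint lam (fun x => psi x * expi (- (l * x))).
  apply: (cintM_bdd cp (C := 1)).
  rewrite (_ : (fun x => _) = (fun x => expi ((- l) * x))); first exact: bdd_expi.
  by apply/funext => x; rewrite mulNr.
rewrite (funext e); split; first by apply: cint_sum => l; exact: cintZ.
rewrite (CI_sum _ (fun l => cintZ (d l) (cl l))); apply: eq_bigr => l _.
exact: CIZ.
Qed.

Variable s : seq R.
Hypothesis us : uniq s.
Hypothesis exponential : forall psi, bump psi -> exists c : R -> R[i],
  forall x, pairing r nu psi x = \sum_(l <- s) c l * expi (- (l * x)).

Let coefficients_symmetry psi chi (c c' : R -> R[i]) l : bump psi -> bump chi ->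
  (forall x, pairing r nu psi x = \sum_(l <- s) c l * expi (- (l * x))) ->
  (forall x, pairing r nu chi x = \sum_(l <- s) c' l * expi (- (l * x))) ->
  l \in s -> c l * fourier chi l = c' l * fourier psi l.
Proof.
move=> bp bc hc hc' ls; apply/eqP; rewrite -subr_eq0; apply/eqP.
apply: (@expi_independent _ s (fun l => c l * fourier chi l - c' l * fourier psi l)) => // a.
have cp := cint_bump bp; have cc := cint_bump bc.
have := pairing_symmetry bp (bump_shift a bc).
have -> : CI lam (fun x => psi x * pairing r nu (fun y => chi (y - a)) x) =
    \sum_(m <- s) (c' m * expi (- (m * a))) * fourier psi m.
  rewrite -(CI_exponential_sum s (fun m => c' m * expi (- (m * a))) cp).2.
  apply: eq_CI => x; rewrite pairing_shift hc'; congr (_ * _); apply: eq_bigr => m _.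
  by rewrite (mulrDr m a x) opprD expiD mulrA.
have -> : CI lam (fun z => chi (z - a) * pairing r nu psi z) =
    \sum_(m <- s) (c m * expi (- (m * a))) * fourier chi m.
  rewrite -(CI_exponential_sum s (fun m => c m * expi (- (m * a))) cc).2 -(CI_shift a).
    apply: eq_CI => x; rewrite (addrC a) addrK hc; congr (_ * _); apply: eq_bigr => m _.
    by rewrite (mulrDr m x a) opprD expiD; ring.
  apply: cmeasM; last exact: (ccontinuous_cmeas (ccontinuous_pairing r nu bp)).
  by apply: cmeas_comp (cint_meas cc); exact: measurable_funB.
move=> e; rewrite (eq_bigr (fun m => c m * expi (- (m * a)) * fourier chi m -
    c' m * expi (- (m * a)) * fourier psi m)); last by move=> m _; ring.
by rewrite sumrB -e subrr.
Qed.

(** For each [l] fix a bump [chi] whose transform does not vanish at [l].  By symmetry the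
    coefficient of any [psi] at [l] is its transform there times the ratio of the
    coefficient of [chi] to the transform of [chi]. *)
Lemma pairing_density : exists C : R -> R[i], forall psi, bump psi ->
  pairing r nu psi 0 = CI lam (fun z => psi z * \sum_(l <- s) C l * expi (- (l * z))).
Proof.
pose chi l := s2val (cid2 (@bump_fourier_neq0 R l)).
have bchi l : bump (chi l) by exact: (s2valP (cid2 (@bump_fourier_neq0 R l))).
have nchi l : fourier (chi l) l != 0 by exact: (s2valP' (cid2 (@bump_fourier_neq0 R l))).
pose c l := sval (cid (exponential (bchi l))).
have hc l : forall x, pairing r nu (chi l) x = \sum_(m <- s) c l m * expi (- (m * x)).
  exact: (svalP (cid (exponential (bchi l)))).
exists (fun l => c l l / fourier (chi l) l) => psi bp.
rewrite (CI_exponential_sum s _ (cint_bump bp)).2.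
have [d hd] := exponential bp; rewrite hd big_seq [RHS]big_seq; apply: eq_bigr => l ls.
rewrite mulr0 oppr0 expi0 mulr1 mulrAC -(coefficients_symmetry bp (bchi l) hd (hc l) ls).
by rewrite mulfK.
Qed.

End symmetry.

Lemma comp_abs_continuous (nu : complex_radon R) :
  radon_abs_continuous nu <-> forall j, comp nu j `<< @lebesgue_measure R.
Proof.
split=> [[h1 h2 h3 h4]|h].
  by case=> [[|[|[|[|//]]]]] i; rewrite /comp /tnth.
by split; [exact: (h ord0)|exact: (h (lift ord0 ord0))|exact: (h (lift ord0 (lift ord0 ord0)))|
  exact: (h (lift ord0 (lift ord0 (lift ord0 ord0))))].
Qed.

(** On a null set all values vanish on relatively compact subsets, and these values
    control the components by [comp_le_cvalue]. *)
Lemma abs_continuous_eq (nu d : complex_radon R) : radon_eq nu d ->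
  radon_abs_continuous d -> radon_abs_continuous nu.
Proof.
move=> e /comp_abs_continuous hd; apply/comp_abs_continuous => j.
apply/null_content_dominatesP => A mA A0.
pose S n : set (measurableTypeR R) := A `&` `[n.+1%:R^-1, n.+1%:R]%classic.
have mS n : measurable (S n) by apply: measurableI => //; exact: measurable_itv.
have Sn n : comp nu j (S n) = 0%E.
  have rS : relcompact_borel (S n).
    by split => //; exists n.+1%:R^-1, n.+1%:R; split; [rewrite invr_gt0|exact: subIsetr].
  have [C [mC CS h]] := comp_le_cvalue nu j rS.
  have [_ [a [b [a0 Sab]]]] := rS.
  have rC : relcompact_borel C by split => //; exists a, b; split => //; exact: subset_trans Sab.
  have zC i : comp d i C = 0%E.
    apply: (hd i A) => //; last exact: (subset_trans CS (@subIsetl _ _ _)).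
    by apply/measure0_null_setP.
  have z : cvalue nu C = 0.
    by rewrite (e C rC) cvalue_comp big1// => i _; rewrite zC /= mulr0.
  have f0 : 0 <= fine (comp nu j (S n)) by exact: fine_ge0.
  rewrite -(fineK (pradon_fin_num (comp nu j) rS)); congr EFin.
  by apply/eqP; rewrite eq_le f0 andbT (le_trans h)// z normc0.
have sub : A `<=` `]-oo, 0%R]%classic `|` \bigcup_n S n.
  move=> x Ax; have [x0|x0] := leP x 0; first by left; rewrite /= in_itv.
  right; pose M := Num.max x x^-1.
  have M0 : 0 <= M by rewrite le_max (ltW x0).
  have hM : M <= (Num.bound M).+1%:R.
    by rewrite ltW// (lt_trans (archi_boundP M0))// ltr_nat.
  exists (Num.bound M) => //; split => //=; rewrite in_itv /=; apply/andP; split.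
    rewrite -[leRHS]invrK lef_pV2 ?posrE ?invr_gt0//.
    by rewrite (le_trans _ hM)// le_max lexx orbT.
  by rewrite (le_trans _ hM)// le_max lexx.
have mI : measurable (`]-oo, 0%R]%classic : set (measurableTypeR R)) by exact: measurable_itv.
have mU : measurable (\bigcup_n S n) by exact: bigcup_measurable.
have nU : comp nu j (\bigcup_n S n) = 0%E.
  apply/measure_negligible => //; apply: negligible_bigcup => n.
  by exists (S n); split; [exact: mS|exact: Sn|].
apply/eqP; rewrite eq_le measure_ge0 andbT.
apply: le_trans (_ : comp nu j (`]-oo, 0%R]%classic `|` \bigcup_n S n) <= _)%E.
  by apply: le_measure => //; rewrite inE//; exact: measurableU.
have U2 : (comp nu j (`]-oo, 0%R]%classic `|` \bigcup_n S n) <=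
    comp nu j `]-oo, 0%R]%classic + comp nu j (\bigcup_n S n))%E by exact: measureU2.
by apply: (le_trans U2); rewrite nU adde0 pradon_support.
Qed.

Section exponential_density.
Variables (r : R) (s : seq R) (C : R -> R[i]).

Definition exponential_density (t : R) : R[i] :=
  (\sum_(l <- s) C l * cpow t (0 +i* (- l))) * (t `^ (r - 1))%:C.

Lemma exponential_density_exp x : exponential_density (expR x) =
  (\sum_(l <- s) C l * expi (- (l * x))) * (expR ((r - 1) * x))%:C.
Proof.
rewrite /exponential_density /powR gt_eqF ?expR_gt0// expRK; congr (_ * _).
apply: eq_bigr => l _; congr (_ * _).
by rewrite /cpow /= powRr0 expRK mulNr mul1r.
Qed.

Let normc_density_le (N x : R) : `|x| <= N ->
  normc (exponential_density (expR x)) <= (\sum_(l <- s) normc (C l)) * expR (`|r - 1| * N).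
Proof.
move=> xN; rewrite exponential_density_exp normcM normc_real (ger0_norm (expR_ge0 _)).
apply: ler_pM; [exact: normc_ge0|exact: expR_ge0| |].
  rewrite (le_trans (normc_sum _ _ _))//; apply: ler_sum => l _.
  by rewrite normcM normc_expi mulr1.
by rewrite ler_expR (le_trans (ler_norm _))// normrM ler_wpM2l.
Qed.

Lemma exponential_density_cmeasurable : cmeasurable `]0, +oo[ exponential_density.
Proof.
apply: cmeasurable_of_exp; rewrite (_ : _ \o _ = fun x =>
  (\sum_(l <- s) C l * expi (- (l * x))) * (expR ((r - 1) * x))%:C); last first.
  by apply/funext => x; exact: exponential_density_exp.
apply: cmeasM; last by apply: cmeas_real; apply: measurableT_comp => //; exact: measurable_funM.
apply: cmeas_sum => l; apply: cmeasM; first exact: cmeas_cst.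
rewrite (_ : (fun x => _) = (fun x => expi ((- l) * x))); first exact: cmeas_expi.
by apply/funext => x; rewrite mulNr.
Qed.

Lemma exponential_density_cintegrable (a b : R) : 0 < a -> cintegrable `[a, b] exponential_density.
Proof.
move=> a0; have [m1 m2] := exponential_density_cmeasurable.
pose N := `|ln a| + `|ln b|.
pose B := (\sum_(l <- s) normc (C l)) * expR (`|r - 1| * N).
have mI : measurable (`[a, b]%classic : set (measurableTypeR R)) by exact: measurable_itv.
have mP : measurable (`]0, +oo[%classic : set (measurableTypeR R)) by exact: measurable_itv.
have IP : `[a, b]%classic `<=` `]0, +oo[%classic.
  by move=> x /=; rewrite !in_itv /= andbT => /andP[+ _]; exact: lt_le_trans.
have lf : (lam `[a, b]%classic < +oo)%E.
  by rewrite lebesgue_measure_itv /=; case: ifP => _; rewrite ?ltry// -EFinB ltry.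
have ic : lam.-integrable (`[a, b]%classic : set (measurableTypeR R)) (fun=> B%:E).
  apply/integrableP; split => //; under eq_integral do rewrite abse_EFin.
  by rewrite integral_cst//; apply: lte_mul_pinfty.
have hB t : t \in (`[a, b]%classic : set R) -> normc (exponential_density t) <= `|B|.
  rewrite inE /= in_itv /= => /andP[ta tb]; have t0 : 0 < t by exact: lt_le_trans ta.
  rewrite -(lnK (t0 : t \in Num.pos)); apply: le_trans (ler_norm _); apply: normc_density_le.
  have l1 : ln a <= ln t by rewrite ler_ln.
  have l2 : ln t <= ln b by rewrite ler_ln ?posrE// (lt_le_trans t0).
  have := ler_norm (ln b); have := ler_norm (- ln a); rewrite normrN => n1 n2.
  have p0 : 0 <= `|ln a| by []. have q0 : 0 <= `|ln b| by [].
  by rewrite /N ler_norml; apply/andP; split; lra.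
split; apply: (le_integrable _ _ _ ic) => //.
- by apply/measurable_EFinP; exact: measurable_funS m1.
- by move=> t /mem_set/hB h; rewrite /= lee_fin (le_trans (normc_Re _)).
- by apply/measurable_EFinP; exact: measurable_funS m2.
- by move=> t /mem_set/hB h; rewrite /= lee_fin (le_trans (normc_Im _)).
Qed.

(** Pairings at 0 are the integrals of all test functions, and these determine the
    measure; so it equals the one built from the density. *)
Lemma exponential_measure (nu : complex_radon R) :
  (forall psi, bump psi -> pairing r nu psi 0 =
    CI lam (fun z => psi z * \sum_(l <- s) C l * expi (- (l * z)))) ->
  radon_abs_continuous nu /\ has_density nu exponential_density.
Proof.
move=> h; have [d [[m i hd] ac di]] := radon_of_density exponential_density_cmeasurable
  exponential_density_cintegrable.
have e : radon_eq nu d.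
  apply: radon_eq_test => phi tphi; rewrite di// (radon_integral_lint r); last exact: test_cmeas_exp.
  transitivity (pairing r nu (log_test r phi) 0).
    by apply: eq_bigr => j _; congr (_ * _); apply: eq_CI => y; rewrite subr0.
  rewrite h; last exact: bump_log_test.
  apply: eq_CI => x; rewrite exponential_density_exp /log_test.
  have -> : (expR (r * x))%:C = (expR x)%:C * (expR ((r - 1) * x))%:C :> R[i].
    by rewrite -rmorphM /= -expRD; congr ((expR _)%:C); ring.
  by ring.
split; first exact: abs_continuous_eq e ac.
by split => // A rA; rewrite e// hd.
Qed.

End exponential_density.

End representation.

(** * Limit sets of a measure and of its convolution *)

Section limit_sets_of_convolutions.
Context {R : realType}.
Local Notation lam := (@lebesgue_measure R).
Variables (rho : R -> R) (mu : complex_radon R) (K : R -> R[i]) (s : complex_radon R).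
Hypotheses (prho : proximate_order rho) (cmu : radon_class rho mu).
Hypotheses (mK : cmeasurable `]0, +oo[ K) (cK : kernel_condition rho K).
Hypothesis hs : has_density s (Psi K mu).

Lemma regular_limit_zero : kernel_zeros rho K 0 -> regular_radon (fun x => rho x + 1) s ->
  limit_set_singleton (fun x => rho x + 1) s zero_radon.
Proof.
move=> /(kernel_zerosE rho mK) F0 [_ [sigma hsigma]].
have k0 : CI lam (log_kernel (order_at_infty rho) K) = 0.
  by rewrite -F0; apply: eq_CI => y; rewrite mul0r oppr0 expi0 mulr1.
have [t_ [too wc]] : limit_set (fun x => rho x + 1) s sigma by apply/hsigma.
have sz : radon_eq sigma zero_radon.
  apply: radon_eq_test => phi tphi; rewrite radon_integral_zero.
  exact: (limit_integral_zero prho cmu mK cK hs k0 hsigma too wc tphi).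
move=> nu; split=> [/hsigma h A rA|h]; first by rewrite (h A rA) sz.
by apply/hsigma => A rA; rewrite (h A rA) sz.
Qed.

(** The coefficients come from [pairing_density], whose hypothesis is Wiener's theorem
    applied to each pairing of [nu]. *)
Lemma limit_exponential_sum (zs : seq R) nu : uniq zs ->
  (forall l, kernel_zeros rho K l -> l \in zs) ->
  limit_set_singleton (fun x => rho x + 1) s zero_radon -> limit_set rho mu nu ->
  exists C : R -> R[i], radon_abs_continuous nu /\
    has_density nu (exponential_density (order_at_infty rho) zs C).
Proof.
move=> us zeros single [t_ [too wc]]; set r := order_at_infty rho.
have gnu := growth_limit prho cmu too wc.
have spectral psi : bump psi -> exists c : R -> R[i],
    forall x, pairing r nu psi x = \sum_(l <- zs) c l * expi (- (l * x)).
  move=> bp; have cp := ccontinuous_pairing r nu bp; have [_ [N [B sp]]] := bp.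
  have zb (L : R) : exists C, forall x y : R, `|y| <= L -> `|(0 : R) - 0| <= C.
    by exists 0 => x y _; rewrite subrr normr0.
  have [C C0 hC] := @pairing_bound _ (fun=> 0) zb r nu gnu N.
  have bf : bdd (pairing r nu psi) (B * C).
    split; first exact: ccontinuous_cmeas.
    by move=> x; have := hC _ _ x sp; rewrite expR0 mulr1.
  apply: (finite_spectrum us bf cp) => w wzs.
  exists (log_kernel r K); split.
  - exact: cint_log_kernel.
  - exact: (limit_annihilated prho cmu too wc mK cK hs single bp).
  - by apply: contra wzs => /eqP /(kernel_zerosE rho mK); exact: zeros.
have [C hC] := pairing_density gnu us spectral.
by exists C; exact: exponential_measure.
Qed.

End limit_sets_of_convolutions.

Unset Implicit Arguments.
Set Strict Implicit.

Theorem theorem5p7 (R : realType) (rho : R -> R) (mu : complex_radon R)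
    (K : R -> R[i]) (s : complex_radon R) :
  proximate_order rho ->
  radon_class rho mu ->
  cmeasurable `]0, +oo[ K ->
  kernel_condition rho K ->
  finite_set (kernel_zeros rho K) ->
  kernel_zeros rho K 0 ->
  has_density s (Psi K mu) ->
  regular_radon (fun r => rho r + 1) s ->
  limit_set_singleton (fun r => rho r + 1) s zero_radon /\
  (forall nu, limit_set rho mu nu ->
    radon_abs_continuous nu /\
    exists c : R -> R[i],
      has_density nu (fun t =>
        (\sum_(l \in kernel_zeros rho K) c l * cpow t (0 +i* (- l))) *
        (t `^ (order_at_infty rho - 1))%:C)).
Proof.
move=> prho cmu mK cK /finite_seqP[zs ezs] z0 hs reg.
have single := regular_limit_zero prho cmu mK cK hs z0 reg.
split=> // nu lnu.
have us : uniq (undup zs) by exact: undup_uniq.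
have eus : kernel_zeros rho K = [set` undup zs].
  by rewrite ezs; apply/seteqP; split => l; rewrite /= mem_undup.
have zeros l : kernel_zeros rho K l -> l \in undup zs by rewrite eus.
have [c [ac dc]] := limit_exponential_sum prho cmu mK cK hs us zeros single lnu.
split=> //; exists c; move: dc; congr (has_density _ _); apply/funext => t.
by rewrite /exponential_density eus -fsbig_seq.
Qed.
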